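(* Let $0<r,q\le\infty$, $-\infty<s_2<s_1<\infty$ and $0<p_1<p_2<\infty$ be such that $$s_1-\frac{d}{p_1}=s_2-\frac{d}{p_2},$$ and let $\varphi\in\mathcal{G}_{p_1}\cap\mathcal{G}_{p_2}$. (i) Then $B_{p_1,q}^{s_1,\varphi}(\mathbb{R}^d)\hookrightarrow B_{p_2,q}^{s_2,\varphi}(\mathbb{R}^d)$. (ii) Assume in addition that $\varphi$ satisfies the $\varepsilon$-condition with exponent $p_1$ if $r<\infty$, and the $\varepsilon$-condition with exponent $p_2$ if $q<\infty$. Then $F_{p_1,r}^{s_1,\varphi}(\mathbb{R}^d)\hookrightarrow F_{p_2,q}^{s_2,\varphi}(\mathbb{R}^d)$.
   Context: $X\hookrightarrow Y$ means $X\subset Y$ with continuous natural embedding. $\mathcal{F}$ is the Fourier transform on $\mathcal{S}'(\mathbb{R}^d)$. Class $\mathcal{G}_p$ ($0<p<\infty$): all nondecreasing $\varphi:(0,\infty)\to(0,\infty)$ such that $t^{-d/p}\varphi(t)\ge s^{-d/p}\varphi(s)$ for all $0<t\le s<\infty$. The $\varepsilon$-condition with exponent $p$: there exist $\varepsilon_0>0$ and $c_0>0$ such that $t^{\varepsilon_0-d/p}\varphi(t)\le c_0\,r^{\varepsilon_0-d/p}\varphi(r)$ for all $t\ge r>0$. $\mathcal{Q}$ is the set of dyadic cubes $2^{-j}([0,1)^d+k)$, $j\in\mathbb{Z}$, $k\in\mathbb{Z}^d$; $\ell(P)$ is the side length of $P$; $j_P=-\log_2\ell(P)$; $j_P\vee0=\max(j_P,0)$.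 Resolution of unity: $\theta_0\in\mathcal{S}(\mathbb{R}^d)$ with $\theta_0(x)=1$ for $|x|\le1$ and $\theta_0(x)=0$ for $|x|\ge3/2$; $\theta_k(x)=\theta_0(2^{-k}x)-\theta_0(2^{-k+1}x)$, $k\in\mathbb{N}$. For $s\in\mathbb{R}$, $0<p<\infty$, $0<q\le\infty$, $\varphi\in\mathcal{G}_p$ (and, for $F$-spaces with $q<\infty$, $\varphi$ satisfying the $\varepsilon$-condition with exponent $p$), with $f_j=\mathcal{F}^{-1}(\theta_j\mathcal{F}f)$, the spaces consist of all $f\in\mathcal{S}'(\mathbb{R}^d)$ with finite quasi-norm (usual modification for $q=\infty$) $$\|f\mid B_{p,q}^{s,\varphi}(\mathbb{R}^d)\|=\sup_{P\in\mathcal{Q}}\frac1{\varphi(\ell(P))}\Big\{\sum_{j=j_P\vee0}^\infty\Big(\int_P|2^{js}f_j(x)|^p\,dx\Big)^{q/p}\Big\}^{1/q},$$ $$\|f\mid F_{p,q}^{s,\varphi}(\mathbb{R}^d)\|=\sup_{P\in\mathcal{Q}}\frac1{\varphi(\ell(P))}\Big\{\int_P\Big(\sum_{j=j_P\vee0}^\infty|2^{js}f_j(x)|^q\Big)^{p/q}dx\Big\}^{1/p}.$$ *)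

(* Defs.v *)
From HB Require Import structures.
From mathcomp Require Import all_boot all_order all_algebra.
From mathcomp Require Import all_classical all_reals all_analysis.
From mathcomp Require Import complex.

Set Implicit Arguments.
Unset Strict Implicit.
Unset Printing Implicit Defensive.

Import Order.TTheory GRing.Theory Num.Theory.
Import numFieldNormedType.Exports.

Local Open Scope classical_set_scope.
Local Open Scope ring_scope.
Local Open Scope complex_scope.

Definition measure_rV_display : measure_display -> measure_display.
Proof. exact. Qed.

Section measurable_rV.
Context {dT} {T : measurableType dT} (n : nat).

Let coors : 'I_n -> 'rV[T]_n -> T := fun i v => v ord0 i.

Let rV_set0 : g_sigma_preimage coors set0.
Proof. exact: sigma_algebra0. Qed.

Let rV_setC A : g_sigma_preimage coors A -> g_sigma_preimage coors (~` A).
Proof. exact: sigma_algebraC. Qed.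

Let rV_bigcup (F : (set 'rV[T]_n)^nat) :
  (forall i, g_sigma_preimage coors (F i)) ->
  g_sigma_preimage coors (\bigcup_i (F i)).
Proof. exact: sigma_algebra_bigcup. Qed.

HB.instance Definition _ := @isMeasurable.Build (measure_rV_display dT)
  'rV[T]_n (g_sigma_preimage coors) rV_set0 rV_setC rV_bigcup.

End measurable_rV.

Section measurable_fun_rV.
Context d1 d2 (T1 : measurableType d1) (T2 : measurableType d2) (n : nat).

Lemma measurable_rV_coord (i : 'I_n) :
  measurable_fun setT (fun v : 'rV[T2]_n => v ord0 i).
Proof.
move=> _ Y mY; rewrite setTI; apply: sub_sigma_algebra => /=.
rewrite -bigcup_seq/=; exists i => /=; first by rewrite mem_index_enum.
by exists Y => //; rewrite setTI.
Qed.

Lemma measurable_fun_rVP (f : T1 -> 'rV[T2]_n) :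
  (forall i, measurable_fun setT (fun x => f x ord0 i)) ->
  measurable_fun setT f.
Proof.
move=> mf.
apply: (measurability (\big[setU/set0]_(i < n)
  preimage_set_system setT (fun v : 'rV[T2]_n => v ord0 i) measurable)) => //.
move=> _ [B + <-]; rewrite -bigcup_seq/= => -[i _ [A mA <-]].
by rewrite !setTI; have := mf i measurableT A mA; rewrite setTI.
Qed.

End measurable_fun_rV.

Section lebesgue_rV.
Context {R : realType}.

Definition rV_cons n (xv : measurableTypeR R * 'rV[R]_n) : 'rV[R]_n.+1 :=
  \row_i (if unlift ord0 i is Some j then xv.2 ord0 j else xv.1).

Definition rV_uncons n (v : 'rV[R]_n.+1) : measurableTypeR R * 'rV[R]_n :=
  (v ord0 ord0, \row_i v ord0 (lift ord0 i)).

Lemma rV_consK n : cancel (@rV_cons n) (@rV_uncons n).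
Proof.
move=> [x v]; rewrite /rV_uncons /rV_cons mxE unlift_none; congr pair.
by apply/rowP => i; rewrite !mxE liftK.
Qed.

Lemma measurable_rV_cons n : measurable_fun setT (@rV_cons n).
Proof.
apply: measurable_fun_rVP => i; under eq_fun do rewrite mxE.
case: unliftP => [j _|_]; last exact: measurable_fst.
exact: (measurableT_comp (measurable_rV_coord j)).
Qed.

Lemma measurable_rV_uncons n : measurable_fun setT (@rV_uncons n).
Proof.
apply: measurable_fun_pair; first exact: measurable_rV_coord.
apply: measurable_fun_rVP => i; under eq_fun do rewrite mxE.
exact: measurable_rV_coord.
Qed.

Section step.
Variables (n : nat) (mu : {sigma_finite_measure set 'rV[R]_n -> \bar R}).

Definition lebesgue_rV_step : set 'rV[R]_n.+1 -> \bar R :=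
  pushforward (lebesgue_measure \x mu)%E (@rV_cons n).

Let step0 : lebesgue_rV_step set0 = 0%E.
Proof. by rewrite /lebesgue_rV_step /pushforward preimage_set0 measure0. Qed.

Let step_ge0 A : (0 <= lebesgue_rV_step A)%E.
Proof. by rewrite /lebesgue_rV_step /pushforward measure_ge0. Qed.

Let step_sigma_additive : semi_sigma_additive lebesgue_rV_step.
Proof.
pose m := measure_function_pushforward__canonical__measure_function_Measure
  [the {measure set _ -> \bar R} of (lebesgue_measure \x mu)%E]
  (@measurable_rV_cons n).
exact: (@measure_semi_sigma_additive _ _ _ m).
Qed.

HB.instance Definition _ := isMeasure.Build _ _ _ lebesgue_rV_step
  step0 step_ge0 step_sigma_additive.

Let step_sigma_finite : sigma_finite setT lebesgue_rV_step.
Proof.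
have /sigma_finiteP[F [FT ndF Foo]] := sigma_finiteT (@lebesgue_measure R).
have /sigma_finiteP[G [GT ndG Goo]] := sigma_finiteT mu.
exists (fun i => @rV_uncons n @^-1` (F i `*` G i)).
  rewrite -preimage_bigcup (_ : \bigcup_i _ = setT) ?preimage_setT//.
  apply/seteqP; split => // -[x y] _.
  have [i _ Fix] : (\bigcup_i F i) x by rewrite -FT.
  have [j _ Gjy] : (\bigcup_i G i) y by rewrite -GT.
  exists (maxn i j) => //; split => /=.
  - by move: x Fix; exact/subsetPset/ndF/leq_maxl.
  - by move: y Gjy; exact/subsetPset/ndG/leq_maxr.
move=> i; have [mF Fi] := Foo i; have [mG Gi] := Goo i; split.
  by rewrite -[X in measurable X]setTI; apply: measurable_rV_uncons => //;
    exact: measurableX.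
rewrite /lebesgue_rV_step /pushforward -comp_preimage.
rewrite (_ : _ \o _ = id) ?preimage_id; last by apply/funext/rV_consK.
by rewrite product_measure1E// lte_mul_pinfty// ge0_fin_numE.
Qed.

HB.instance Definition _ := Measure_isSigmaFinite.Build _ _ _ lebesgue_rV_step
  step_sigma_finite.

End step.

Fixpoint lebesgue_rV n : {sigma_finite_measure set 'rV[R]_n -> \bar R} :=
  if n is m.+1 then [the {sigma_finite_measure set _ -> \bar R} of
                       lebesgue_rV_step (lebesgue_rV m)]
  else [the {sigma_finite_measure set _ -> \bar R} of
          \d_(0 : 'rV[R]_0)].

Lemma lebesgue_rV_box n (A : 'I_n -> set R) :
  (forall i, measurable (A i)) ->
  (lebesgue_rV n [set v | forall i, A i (v ord0 i)] =
   \prod_(i < n) lebesgue_measure (A i))%E.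
Proof.
elim: n A => [A _|n IH A mA].
  by rewrite big_ord0 /= diracE mem_set//= => -[].
rewrite big_ord_recl -IH; last by move=> i; exact: mA.
rewrite /= /lebesgue_rV_step /pushforward.
pose B := [set v : 'rV[R]_n | forall i, A (lift ord0 i) (v ord0 i)].
rewrite (_ : _ @^-1` _ = A ord0 `*` B); last first.
  apply/seteqP; split => [[x v]/= h|[x v]/= [h0 hB] i].
    split => [|i /=]; first by have := h ord0; rewrite mxE unlift_none.
    by have := h (lift ord0 i); rewrite mxE liftK.
  rewrite mxE; case: unliftP => [j ->|->] //; exact: hB.
rewrite product_measure1E//; first exact: mA.
rewrite (_ : B = \bigcap_(i : 'I_n)
    ((fun v : 'rV[R]_n => v ord0 i) @^-1` A (lift ord0 i))); last first.
  by apply/seteqP; split => [v h i _|v h i]; exact: h.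
apply: fin_bigcap_measurable => // i _.
by rewrite -[X in measurable X]setTI; apply: measurable_rV_coord => //; exact: mA.
Qed.

End lebesgue_rV.

Local Notation normc := ComplexField.Normc.normc.

Section tempered_distributions.
Context {R : realType} {d : nat}.
Local Notation V := 'rV[R]_d.
Local Notation C := R[i].

(* The norm of the library on 'rV[R]_d is the sup norm. *)
Definition enorm (x : V) : R := Num.sqrt (\sum_i x ord0 i ^+ 2).

Definition dotv (x y : V) : R := \sum_i x ord0 i * y ord0 i.

(* Iterated partial derivatives, one entry of s for each differentiation. *)
Definition partials (s : seq 'I_d) (g : V -> R) : V -> R :=
  foldr (fun i h => 'D_(delta_mx ord0 i) h) g s.

Definition smooth (g : V -> R) : Prop :=
  forall s x, differentiable (partials s g) x.

Definition cpartials (s : seq 'I_d) (f : V -> C) (x : V) : C :=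
  partials s (fun y => complex.Re (f y)) x
    +i* partials s (fun y => complex.Im (f y)) x.

Definition csmooth (f : V -> C) : Prop :=
  smooth (fun x => complex.Re (f x)) /\ smooth (fun x => complex.Im (f x)).

Definition schwartz_seminorm (N : nat) (f : V -> C) : \bar R :=
  ereal_sup [set ((1 + enorm x) ^+ N * normc (cpartials s f x))%:E
            | x in [set: V] & s in [set s : seq 'I_d | (size s <= N)%N]].

Definition schwartz : set (V -> C) :=
  [set f | csmooth f /\ forall N, (schwartz_seminorm N f < +oo)%E].

(* S'(R^d). An element is carried by a functional on all functions V -> C, of
   which only the values on Schwartz functions matter. *)
Definition tempered : set ((V -> C) -> C) :=
  [set T | (forall (a : C) u v, schwartz u -> schwartz v ->
              T (fun x => a * u x + v x) = a * T u + T v) /\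
           (exists N (K : R), forall u, schwartz u ->
              ((normc (T u))%:E <= K%:E * schwartz_seminorm N u)%E)].

Definition cintegral (f : V -> C) : C :=
  (\int[lebesgue_rV d]_x complex.Re (f x))
    +i* (\int[lebesgue_rV d]_x complex.Im (f x)).

Definition cintegrable (f : V -> C) : Prop :=
  (lebesgue_rV d).-integrable setT (fun x => (complex.Re (f x))%:E) /\
  (lebesgue_rV d).-integrable setT (fun x => (complex.Im (f x))%:E).

Definition cis (t : R) : C := cos t +i* sin t.

Definition fourier (u : V -> C) (xi : V) : C :=
  ((2 * pi) `^ (- (d%:R / 2)))%:C
    * cintegral (fun x => cis (- dotv x xi) * u x).

Definition invfourier (u : V -> C) (x : V) : C :=
  ((2 * pi) `^ (- (d%:R / 2)))%:C
    * cintegral (fun xi => cis (dotv x xi) * u xi).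

Definition dist_fourier (T : (V -> C) -> C) : (V -> C) -> C :=
  fun u => T (fourier u).

Definition dist_invfourier (T : (V -> C) -> C) : (V -> C) -> C :=
  fun u => T (invfourier u).

Definition dist_mul (m : V -> C) (T : (V -> C) -> C) : (V -> C) -> C :=
  fun u => T (fun x => m x * u x).

Definition represents (g : V -> C) (T : (V -> C) -> C) : Prop :=
  [/\ continuous (fun x => complex.Re (g x)),
      continuous (fun x => complex.Im (g x)) &
      forall u, schwartz u -> cintegrable (fun x => g x * u x) /\
                              T u = cintegral (fun x => g x * u x)].

Definition resolution_generator (theta0 : V -> C) : Prop :=
  [/\ schwartz theta0,
      forall x, enorm x <= 1 -> theta0 x = 1 &
      forall x, 3 / 2 <= enorm x -> theta0 x = 0].

Definition resolution (theta0 : V -> C) (k : nat) (x : V) : C :=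
  if k is m.+1 then theta0 (2 ^- m.+1 *: x) - theta0 (2 ^- m *: x)
  else theta0 x.

Definition lp_dist (theta0 : V -> C) (f : (V -> C) -> C) (k : nat) :
    (V -> C) -> C :=
  dist_invfourier (dist_mul (resolution theta0 k) (dist_fourier f)).

(* By the Paley-Wiener-Schwartz theorem lp_dist theta0 f k is a function: lp_fun
   is the unique continuous function representing it. *)
Definition lp_fun (theta0 : V -> C) (f : (V -> C) -> C) (k : nat) : V -> C :=
  xget (fun=> 0) [set g | represents g (lp_dist theta0 f k)].

Definition dyadic_side (j : int) : R := 2 ^ (- j).

Definition dyadic_cube (j : int) (k : 'rV[int]_d) : set V :=
  [set x | forall i, dyadic_side j * (k ord0 i)%:~R <= x ord0 i
                     < dyadic_side j * ((k ord0 i)%:~R + 1)].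

End tempered_distributions.

Section growth_functions.
Context {R : realType}.

Definition class_G (d : nat) (p : R) (phi : R -> R) : Prop :=
  [/\ forall t, 0 < t -> 0 < phi t,
      forall t s, 0 < t -> t <= s -> phi t <= phi s &
      forall t s, 0 < t -> t <= s ->
        s `^ (- (d%:R / p)) * phi s <= t `^ (- (d%:R / p)) * phi t].

Definition eps_condition (d : nat) (p : R) (phi : R -> R) : Prop :=
  exists eps0 c0 : R, [/\ 0 < eps0, 0 < c0 &
    forall t r, 0 < r -> r <= t ->
      t `^ (eps0 - d%:R / p) * phi t <= c0 * (r `^ (eps0 - d%:R / p) * phi r)].

End growth_functions.

Section spaces.
Context {R : realType} {d : nat}.
Local Notation V := 'rV[R]_d.
Local Notation C := R[i].
Local Notation mu := (@lebesgue_rV R d).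

(* The l_q quasi-norm of (a_j)_(j >= m), for 0 < q <= oo. *)
Definition lq_tail (q : \bar R) (m : nat) (a : nat -> \bar R) : \bar R :=
  (match q with
   | r%:E => (\sum_(m <= j <oo) a j `^ r) `^ r^-1
   | +oo => ereal_sup [set a j | j in [set j | (m <= j)%N]]
   | -oo => 0
   end)%E.

Definition weighted_lp (theta0 : V -> C) (s : R) (f : (V -> C) -> C) (j : nat)
    (x : V) : R :=
  normc ((2 `^ (j%:R * s))%:C * lp_fun theta0 f j x).

(* In both suprema P = (j, k) stands for the cube 2^-j ([0, 1)^d + k), so that
   j_P = j. *)
Definition B_norm (theta0 : V -> C) (s p : R) (q : \bar R) (phi : R -> R)
    (f : (V -> C) -> C) : \bar R :=
  ereal_sup (range (fun P : int * 'rV[int]_d =>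
    ((phi (dyadic_side P.1))^-1)%:E *
    lq_tail q `|Num.max P.1 0|%N (fun j =>
      (\int[mu]_(x in dyadic_cube P.1 P.2)
         ((weighted_lp theta0 s f j x) `^ p)%:E) `^ p^-1)))%E.

Definition F_norm (theta0 : V -> C) (s p : R) (q : \bar R) (phi : R -> R)
    (f : (V -> C) -> C) : \bar R :=
  ereal_sup (range (fun P : int * 'rV[int]_d =>
    ((phi (dyadic_side P.1))^-1)%:E *
    (\int[mu]_(x in dyadic_cube P.1 P.2)
       lq_tail q `|Num.max P.1 0|%N
         (fun j => (weighted_lp theta0 s f j x)%:E) `^ p) `^ p^-1))%E.

Definition B_space (theta0 : V -> C) (s p : R) (q : \bar R) (phi : R -> R) :
    set ((V -> C) -> C) :=
  [set f | tempered f /\ (B_norm theta0 s p q phi f < +oo)%E].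

Definition F_space (theta0 : V -> C) (s p : R) (q : \bar R) (phi : R -> R) :
    set ((V -> C) -> C) :=
  [set f | tempered f /\ (F_norm theta0 s p q phi f < +oo)%E].

End spaces.

(* The inclusion map is continuous for the topologies of the quasi-norms. *)
Definition continuously_embedded (R : realType) (E : zmodType)
    (X : set E) (nX : E -> \bar R) (Y : set E) (nY : E -> \bar R) : Prop :=
  X `<=` Y /\
  forall f, X f -> forall e : R, 0 < e -> exists2 a : R, 0 < a &
    forall g, X g -> (nX (g - f)%R < a%:E)%E -> (nY (g - f)%R < e%:E)%E.

(* Main.v *)
Require Import Defs.
From mathcomp Require Import all_boot all_order all_algebra.
From mathcomp Require Import all_classical all_reals all_analysis.
From mathcomp Require Import measurable_realfun.
From mathcomp Require Import complex.
From mathcomp Require Import ring lra.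

Set Implicit Arguments.
Unset Strict Implicit.
Unset Printing Implicit Defensive.

Import Order.TTheory GRing.Theory Num.Theory.
Import numFieldNormedType.Exports.

Local Open Scope classical_set_scope.
Local Open Scope ring_scope.

(** Both embeddings are inequalities between quasi-norms,
    norm_Y h <= K norm_X h with K independent of h; inclusion and continuity
    follow at once. The inequality is proved for the moduli of the weighted
    pieces w_k = 2^(ks) |g_k|, g_k = lp_fun theta0 h k, and it rests on one fact:
    g_k has its frequencies in the cube |xi_i| <= (3/2) 2^k.

    That fact is exploited by duality. For every small delta there are a smooth
    function beta of mass one, concentrated at distances of order delta from a point x,
    and a rapidly decreasing function v whose decay does not depend on delta,
    having the same Fourier transform on the frequencies of g_k (test_pairs,
    which uses the inversion formula for even functions, cosine_inversion). They
    pair equally with g_k, and delta -> 0 gives the reproducing inequality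
      |g_k(x)| <= C_L 2^(kd) int |g_k(z)| prod_i (1 + 2^k |x_i - z_i|)^(-L) dz
    for every L (reproducing_bound). Since g_k is integrable against all
    Schwartz functions, it is integrable against some polynomial weight
    (represents_growth), and the inequality improves itself to p-th powers:
      |g_k(x)|^p <= C 2^(kd) int |g_k(z)|^p prod_i (1 + 2^k |x_i - z_i|)^(-a) dz
    for all p > 0 and a >= 0 (lp_fun_plancherel_polya). Let P be a dyadic cube of
    side at least 2^(-k). Summing over the translates of P, one bounds the
    supremum of |g_k|^p on P by 2^(kd) times a bound for the p-th power masses of
    the translates (sup_on_cube). As |g_k|^p2 <= (sup |g_k|)^(p2-p1) |g_k|^p1 and
    s1 - d/p1 = s2 - d/p2, the powers of 2^k cancel in the resulting
    Nikolskii inequality (nikolskii_cube).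

    For the B spaces the translates of P all have the same side, hence the same
    factor phi(l(P)); their contributions are added with summable weights and
    the sum over k is taken last (besov_bound).

    For the F spaces the point x of P lies in a dyadic cube of side
    2^(-k) <= l(P), and phi(2^(-k)) <= phi(l(P)); so sup_on_cube bounds
    2^(k s2) |g_k(x)| by an increasing geometric sequence in k. It is also at most
    2^(-k(s1-s2)) G(x), where G is the inner l_r quasi-norm for (s1, r).
    A sequence below both an increasing and a decreasing geometric sequence has
    its l_q quasi-norm, for every q, bounded by the value X^(1-t) G(x)^t at which
    the two cross (interpolated_tail), with t = p1/p2; taking the power p2 leaves
    G(x)^p1, which is integrated over P (lizorkin_bound). *)

(** * Affine changes of variables on the line *)

Section affine_change.
Context {R : realType}.
Notation lam := (@lebesgue_measure R).

Lemma measurable_affine (a b : R) :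
  measurable_fun setT (fun x : measurableTypeR R => a * x + b : measurableTypeR R).
Proof.
apply: continuous_measurable_fun => x; apply: continuousD; last exact: cst_continuous.
by apply: continuousM; [exact: cst_continuous|exact: id].
Qed.

(** The right-hand side is a measure in A that agrees with the left-hand side on
    intervals, so uniqueness of Lebesgue measure applies. *)
Lemma lebesgue_affine (a b : R) : a != 0 ->
  forall A, measurable A ->
  lebesgue_measure A =
  (`|a|%:E * pushforward lam (fun x : measurableTypeR R => (a * x + b)%R) A)%E.
Proof.
move=> a0.
pose p := measure_function_pushforward__canonical__measure_function_Measure
  lam (@measurable_affine a b).
pose m := [the {measure set (measurableTypeR R) -> \bar R} of
  mscale (NngNum (normr_ge0 a)) p].
apply: (@lebesgue_measure_unique R m) => X [[x y] xy <-]; rewrite /m /= /mscale /= /pushforward.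
have [a1|a1] := ltP 0 a.
  rewrite (_ : _ @^-1` _ = `](x - b) / a, (y - b) / a]%classic); last first.
    apply/seteqP; split => z /=; rewrite !in_itv /= ltr_pdivrMr// ler_pdivlMr//; lra.
  rewrite !lebesgue_measure_itv/= !lte_fin ltr_pM2r ?invr_gt0// ltrD2r.
  case: ifP => _; last by rewrite mule0.
  rewrite -!EFinB -EFinM gtr0_norm//; congr (_%:E); field.
  by rewrite gt_eqF.
have {}a1 : a < 0 by rewrite lt_neqAle a0 a1.
rewrite (_ : _ @^-1` _ = `[(y - b) / a, (x - b) / a[%classic); last first.
  by apply/seteqP; split => z /=; rewrite !in_itv /= ler_ndivrMr// ltr_ndivlMr//; lra.
rewrite !lebesgue_measure_itv/= !lte_fin ltr_nM2r ?invr_lt0// ltrD2r.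
case: ifP => _; last by rewrite mule0.
rewrite -!EFinB -EFinM ltr0_norm//; congr (_%:E); field.
by rewrite lt_eqF.
Qed.

Lemma ge0_integral_affine (a b : R) (f : R -> \bar R) : a != 0 ->
  measurable_fun setT f -> (forall x, 0 <= f x)%E ->
  (\int[lam]_x f x = `|a|%:E * \int[lam]_x f (a * x + b)%R)%E.
Proof.
move=> a0 mf f0.
pose p := (measure_function_pushforward__canonical__measure_function_Measure lam (@measurable_affine a b)).
have mE : (\int[lam]_x f x = \int[mscale (NngNum (normr_ge0 a)) p]_x f x)%E.
  by apply: eq_measure_integral => A mA _; exact: lebesgue_affine.
rewrite mE ge0_integral_mscale//=; congr (_ * _)%E.
rewrite (@ge0_integral_pushforward _ _ (measurableTypeR R) (measurableTypeR R) R _ (@measurable_affine a b) lam setT f)//=.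
Qed.

Lemma integral_affine (a b : R) (f : R -> \bar R) : a != 0 ->
  lam.-integrable setT f ->
  lam.-integrable setT (fun x => f (a * x + b)%R) /\
  (\int[lam]_x f x = `|a|%:E * \int[lam]_x f (a * x + b)%R)%E.
Proof.
move=> a0 /integrableP[mf fi].
have mfa : measurable_fun setT (fun x => f (a * x + b)%R).
  apply: (measurableT_comp mf); exact: measurable_affine.
have I2 : lam.-integrable setT (fun x => f (a * x + b)%R).
  apply/integrableP; split => //; move: fi.
  rewrite (ge0_integral_affine b a0)//; last first.
    exact: measurableT_comp.
  rewrite muleC; set I := (\int[_]_x _)%E => h.
  have : (0 <= I)%E by apply: integral_ge0.
  move: h; case: I => [r _ _||] //; first by rewrite ltry.
  by rewrite gt0_mulye ?lte_fin ?normr_gt0.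
split => //.
rewrite integralE [X in _ = (_ * X)%E]integralE.
rewrite (ge0_integral_affine b a0)//; last exact: measurable_funepos.
rewrite (ge0_integral_affine (f := f^\-%E) b a0)//; last exact: measurable_funeneg.
have fp := integrable_pos_fin_num measurableT I2.
have fn := integrable_neg_fin_num measurableT I2.
have -> : (\int[lam]_x f^\+ (a * x + b)%R = \int[lam]_x (fun y => f (a * y + b)%R)^\+ x)%E.
  by apply: eq_integral => x _; rewrite !funeposE.
have -> : (\int[lam]_x f^\- (a * x + b)%R = \int[lam]_x (fun y => f (a * y + b)%R)^\- x)%E.
  by apply: eq_integral => x _; rewrite !funenegE.
by rewrite [RHS]muleBr// fin_num_adde_defr.
Qed.

Lemma Rintegral_affine (a b : R) (f : R -> R) : a != 0 ->
  lam.-integrable setT (EFin \o f) ->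
  \int[lam]_x f x = `|a| * \int[lam]_x f (a * x + b).
Proof.
move=> a0 fi; have [I2 E] := integral_affine b a0 fi.
rewrite /Rintegral /= [X in fine X]E fineM//.
exact: (integrable_fin_num measurableT I2).
Qed.

End affine_change.

(** * Cosine transforms on a segment *)

Section cosine_transform.
Context {R : realType}.
Notation lam := (@lebesgue_measure R).
Implicit Types (m f g : R -> R) (a t x : R).

(** The phase a makes the family stable under differentiation in t and under
    multiplication by t: both shift the phase by pi / 2. The window [-3, 3]
    contains the supports of all amplitudes m below. *)
Definition cosint a m t : R := \int[lam]_(x in `[- 3, 3]) (m x * cos (t * x + a)).

Lemma continuous_segment_integrable f (a b : R) : continuous f ->
  lam.-integrable `[a, b] (EFin \o f).
Proof.
move=> cf; apply: continuous_compact_integrable; first exact: segment_compact.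
exact: continuous_subspaceT.
Qed.

Lemma continuous_cos_affine a t : continuous (fun x => cos (t * x + a)).
Proof.
move=> x; apply: (@continuous_comp _ _ _ (fun x => t * x + a)); last exact: continuous_cos.
apply: continuousD; last exact: cst_continuous.
by apply: continuousM; [exact: cst_continuous|exact: id].
Qed.

Lemma continuous_cos_scale w : continuous (fun t : R => cos (t * w)).
Proof. by have := @continuous_cos_affine 0 w; under eq_fun do rewrite addr0 mulrC. Qed.

Lemma continuous_sin_scale w : continuous (fun t : R => sin (t * w)).
Proof.
move=> t; apply: (@continuous_comp _ _ _ (fun x : R => x * w)); last exact: continuous_sin.
by apply: continuousM; [exact: id|exact: cst_continuous].
Qed.

Lemma derivable_cont f : (forall x, derivable f x 1) -> continuous f.
Proof.
by move=> df x; apply: differentiable_continuous; apply/derivable1_diffP.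
Qed.

Lemma continuous_normr f : continuous f -> continuous (fun x => `|f x|).
Proof.
by move=> cf x; apply: (@continuous_comp _ _ _ f (fun y : R => `|y|)); [exact: cf|exact: norm_continuous].
Qed.

Lemma continuousMr f g : continuous f -> continuous g -> continuous (fun x => f x * g x).
Proof. by move=> cf cg x; apply: continuousM; [exact: cf|exact: cg]. Qed.

Lemma is_derive_cos_affine (a b x : R) :
  is_derive x 1 (fun y : R => cos (y * b + a)) (b * cos (x * b + (a + pi / 2))).
Proof.
rewrite addrA cosDpihalf.
apply: is_derive_eq; rewrite /GRing.scale /=.
by ring.
Qed.

Lemma cosint_is_derive a m t : continuous m ->
  is_derive t 1 (cosint a m) (cosint (a + pi / 2) (fun x => x * m x) t).
Proof.
move=> cm.
pose f t x := m x * cos (t * x + a).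
have df (s x : R) : is_derive s 1 (f ^~ x) (x * m x * cos (s * x + (a + pi / 2))).
  have := is_derive_cos_affine a x s => H.
  rewrite [X in is_derive _ _ _ X](_ : _ = m x *: (x * cos (s * x + (a + pi / 2)))).
    exact: is_deriveZ.
  by rewrite /GRing.scale /=; ring.
have d1E (s x : R) : partial1of2 f s x = x * m x * cos (s * x + (a + pi / 2)).
  by rewrite partial1of2E; apply: derive_val.
have intf s : lam.-integrable `[- 3, 3] (EFin \o f s).
  apply: continuous_segment_integrable; apply: continuousMr => //.
  exact: continuous_cos_affine.
have der (s x : R) : derivable (f ^~ x) s 1 by apply: ex_derive.
have cG : continuous (fun x => `|x * m x|).
  apply: continuous_normr => x; apply: continuousM; [exact: id|exact: cm].
have bd (s x : R) : `|partial1of2 f s x| <= `|x * m x|.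
  by rewrite d1E normrM ler_piMr// cos_max.
have tI : `]t - 1, t + 1[%classic t by rewrite /= in_itv /=; lra.
have der1 := @derivable_under_integral R _ _ lam f `[-3, 3]%classic _ t (t - 1) (t + 1) tI
  (fun s _ => intf s) (fun s x _ _ => der s x) (fun x => `|x * m x|) (fun _ => normr_ge0 _)
  (continuous_segment_integrable (-3) 3 cG) (fun s x _ _ => bd s x).
have der2 := @differentiation_under_integral R _ _ lam f `[-3, 3]%classic _ t (t - 1) (t + 1) tI
  (fun s _ => intf s) (fun s x _ _ => der s x) (fun x => `|x * m x|) (fun _ => normr_ge0 _)
  (continuous_segment_integrable (-3) 3 cG) (fun s x _ _ => bd s x).
apply: DeriveDef; first exact: der1.
rewrite -derive1E; move: der2; rewrite /cosint /f => ->//.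
by apply: eq_Rintegral => x _; rewrite d1E.
Qed.

(** Integration by parts, without boundary terms since m vanishes at both ends:
    smoothness of m becomes decay of its transform. *)
Lemma cosint_mul a m t : (forall x, derivable m x 1) -> continuous (derive1 m) ->
  m (-3) = 0 -> m 3 = 0 ->
  t * cosint a m t = cosint (a + pi / 2) (derive1 m) t.
Proof.
move=> dm cdm m1 m2.
have cm := derivable_cont dm.
rewrite /cosint -RintegralZl//; last first.
  apply: continuous_segment_integrable; apply: continuousMr => //; exact: continuous_cos_affine.
under eq_Rintegral do rewrite mulrCA.
pose G x := sin (t * x + a).
have dG x : is_derive x 1 G (t * cos (t * x + a)).
  by apply: is_derive_eq; rewrite /GRing.scale /=; ring.
have cG : continuous G.
  by apply: derivable_cont => x; apply: ex_derive.
have dm' : derivable_oo_LRcontinuous m (-3) 3.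
  split; [by move=> x _; apply: dm| |].
    by apply: cvg_at_right_filter; exact: cm.
  by apply: cvg_at_left_filter; exact: cm.
have dG' : derivable_oo_LRcontinuous G (-3) 3.
  split; [by move=> x _; apply: ex_derive| |].
    by apply: cvg_at_right_filter; exact: cG.
  by apply: cvg_at_left_filter; exact: cG.
have cg : continuous (fun x => t * cos (t * x + a)).
  by move=> x; apply: continuousM; [exact: cst_continuous|exact: continuous_cos_affine].
have lt33 : (- 3 : R) < 3 by lra.
have dGE : {in `](- 3), 3[, derive1 G =1 (fun x => t * cos (t * x + a))}.
  by move=> x _; rewrite derive1E; apply: derive_val.
have ibp := @Rintegration_by_parts R m G (derive1 m) (fun x => t * cos (t * x + a)) (-3) 3 lt33
  (continuous_subspaceT cdm) dm' (fun x _ => erefl) (continuous_subspaceT cg) dG' dGE.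
rewrite [LHS]ibp.
rewrite m1 m2 !mul0r subrr sub0r.
rewrite -[LHS]mulN1r -RintegralZl//; last first.
  by apply: continuous_segment_integrable; apply: continuousMr.
apply: eq_Rintegral => x _.
by rewrite addrA cosDpihalf /G; ring.
Qed.

Lemma cosint_bound1 a m t : continuous m ->
  `|cosint a m t| <= \int[lam]_(x in `[- 3, 3]) `|m x|.
Proof.
move=> cm.
have i1 : lam.-integrable `[- 3, 3] (EFin \o (fun x => m x * cos (t * x + a))).
  by apply: continuous_segment_integrable; apply: continuousMr => //; exact: continuous_cos_affine.
apply: le_trans (le_normr_Rintegral _ i1) _ => //.
apply: le_Rintegral => //.
- exact: (integrable_norm i1).
- exact/integrable_norm/continuous_segment_integrable.
- by move=> x _; rewrite normrM (le_trans (ler_piMr _ (cos_max _))).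
Qed.

Lemma cosint_bound a m t (M : R) : continuous m ->
  (forall x, `|x| <= 3 -> `|m x| <= M) -> `|cosint a m t| <= 6 * M.
Proof.
move=> cm bm; apply: le_trans (cosint_bound1 _ _ cm) _.
apply: (@le_trans _ _ (\int[lam]_(x in `[- 3, 3]) M)).
  apply: le_Rintegral => //.
  - exact/integrable_norm/continuous_segment_integrable.
  - by apply: continuous_segment_integrable; exact: cst_continuous.
  - by move=> x /=; rewrite in_itv /= => /andP[x1 x2]; rewrite bm// ler_norml x1 x2.
rewrite Rintegral_cst//= lebesgue_measure_itv /= lte_fin ifT; last by lra.
by rewrite /= mulrC le_eqVlt; apply/orP; left; apply/eqP; ring.
Qed.

End cosine_transform.

(** * Smooth functions with bounded derivatives *)

Section smooth_functions.
Context {R : realType}.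
Notation lam := (@lebesgue_measure R).
Implicit Types (m f g : R -> R) (a t x M : R) (n k : nat).

(** One constant serves the function and its n first derivatives, which keeps the
    estimate for products short; bounds are asked only on the window of cosint. *)
Fixpoint bounded_derivs n M f : Prop :=
  [/\ continuous f, forall x, `|x| <= 3 -> `|f x| <= M &
      if n is k.+1 then (forall x, derivable f x 1) /\ bounded_derivs k M (derive1 f) else True].

Definition smooth1 f := forall n x, derivable (derive1n n f) x 1.

Lemma continuous_idM m : continuous m -> continuous (fun x => x * m x).
Proof. by move=> cm x; apply: continuousM; [exact: id|exact: cm]. Qed.

Lemma bounded_derivs_le n M K f : M <= K -> bounded_derivs n M f -> bounded_derivs n K f.
Proof.
move=> MK; elim: n f => [|n IH] f /= [cf bf h]; split => //.
- by move=> x /bf/le_trans; exact.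
- by move=> x /bf/le_trans; exact.
- by case: h => h1 h2; split => //; exact: IH.
Qed.

Lemma bounded_derivs_prev n M f : bounded_derivs n.+1 M f -> bounded_derivs n M f.
Proof.
elim: n f => [|n IH] f; first by case.
by move=> [cf bf [df h]]; split => //; split => //; exact: IH.
Qed.

Lemma bounded_derivsD n A B f g : bounded_derivs n A f -> bounded_derivs n B g -> bounded_derivs n (A + B) (fun x => f x + g x).
Proof.
elim: n f g => [|n IH] f g [cf bf hf] [cg bg hg]; split => //.
- by move=> x; apply: continuousD; [exact: cf|exact: cg].
- by move=> x x3; rewrite (le_trans (ler_normD _ _))// lerD// ?bf// bg.
- by move=> x; apply: continuousD; [exact: cf|exact: cg].
- by move=> x x3; rewrite (le_trans (ler_normD _ _))// lerD// ?bf// bg.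
- case: hf => df hf; case: hg => dg hg; split.
    by move=> x; apply: derivableD.
  rewrite (_ : derive1 _ = fun x => derive1 f x + derive1 g x); first exact: IH.
  by apply/funext => x; rewrite !derive1E (@deriveD _ _ _ f g).
Qed.

Lemma derive1M f g x : derivable f x 1 -> derivable g x 1 ->
  derive1 (fun y => f y * g y) x = derive1 f x * g x + f x * derive1 g x.
Proof.
move=> df dg; rewrite !derive1E.
have -> : 'D_1 (fun y => f y * g y) x = f x *: 'D_1 g x + g x *: 'D_1 f x by exact: (deriveM df dg).
by rewrite /GRing.scale /= addrC [g x * _]mulrC.
Qed.

(** The factor 2 ^+ n is the number of terms in the n-fold product rule. *)
Lemma bounded_derivsM n A B f g : bounded_derivs n A f -> bounded_derivs n B g ->
  bounded_derivs n (2 ^+ n * (A * B)) (fun x => f x * g x).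
Proof.
elim: n f g => [|n IH] f g [cf bf hf] [cg bg hg]; split => //.
- exact: continuousMr.
- by move=> x x3; rewrite expr0 mul1r normrM ler_pM// ?bf// bg.
- exact: continuousMr.
- move=> x x3; rewrite normrM (@le_trans _ _ (A * B))//; first by rewrite ler_pM// ?bf// bg.
  rewrite ler_peMl ?exprn_ege1 ?ler1n//; apply: mulr_ge0.
  + exact: le_trans (bf _ x3).
  + exact: le_trans (bg _ x3).
- case: hf => df hf; case: hg => dg hg; split.
    by move=> x; apply: derivableM.
  rewrite (_ : derive1 _ = fun x => derive1 f x * g x + f x * derive1 g x); last first.
    by apply/funext => x; rewrite derive1M.
  rewrite exprS -mulrA mulr_natl mulr2n.
  by apply: bounded_derivsD; apply: IH => //; apply: bounded_derivs_prev; split.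
Qed.

Lemma smooth1_derive f : smooth1 f -> smooth1 (derive1 f).
Proof. by move=> sf n x; rewrite -derive1Sn; exact: sf. Qed.

Lemma smooth1_cont f : smooth1 f -> continuous f.
Proof. by move=> sf; apply: derivable_cont => x; exact: (sf 0%N). Qed.

Lemma cont_bounded f : continuous f -> exists M, forall x, `|x| <= 3 -> `|f x| <= M.
Proof.
move=> cf.
have cn := continuous_normr cf.
have le33 : (-3 : R) <= 3 by lra.
have [c _ h] := EVT_max le33 (continuous_subspaceT cn).
by exists `|f c| => x; rewrite ler_norml => x3; apply: h; rewrite in_itv.
Qed.

Lemma smooth1_bounded_derivs f n : smooth1 f -> exists M, bounded_derivs n M f.
Proof.
elim: n f => [|n IH] f sf.
  by have [M bM] := cont_bounded (smooth1_cont sf); exists M; split => //; exact: smooth1_cont.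
have [M bM] := cont_bounded (smooth1_cont sf).
have [K bK] := IH _ (smooth1_derive sf).
exists (Num.max M K); split; first exact: smooth1_cont.
  by move=> x /bM/le_trans; apply; rewrite le_max lexx.
split; first exact: (sf 0%N).
by apply: bounded_derivs_le bK; rewrite le_max lexx orbT.
Qed.

Lemma bounded_derivs_smooth1 f : (forall n, exists M, bounded_derivs n M f) -> smooth1 f.
Proof.
move=> h n; have [M] := h n.+1; move: f {h}; elim: n => [|n IH] f [cf bf [df h]] x.
  exact: df.
by rewrite derive1Sn; exact: IH.
Qed.

(** Smoothness is equivalent to having bounded_derivs of every order, which is
    stable under products. *)
Lemma smooth1M f g : smooth1 f -> smooth1 g -> smooth1 (fun x => f x * g x).
Proof.
move=> sf sg; apply: bounded_derivs_smooth1 => n.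
have [A hA] := smooth1_bounded_derivs n sf; have [B hB] := smooth1_bounded_derivs n sg.
by eexists; exact: bounded_derivsM hA hB.
Qed.

Lemma smooth1_cst (c : R) : smooth1 (cst c).
Proof.
have d0 (c0 : R) : derive1 (cst c0) = cst 0 by apply/funext => x; rewrite derive1_cst.
move=> n; have [c' ->] : exists c', derive1n n (cst c) = cst c'.
  elim: n c => [|n IH] c; first by exists c.
  by rewrite derive1Sn d0; exact: IH.
by move=> x; apply: ex_derive.
Qed.

Lemma smooth1_id : smooth1 id.
Proof.
case=> [|n] x; first exact: derivable_id.
rewrite derive1Sn (_ : derive1 id = cst 1); first exact: smooth1_cst.
by apply/funext => y; rewrite derive1_id.
Qed.

Lemma derive1_affine (c b : R) f x : derivable f (c * x + b) 1 ->
  is_derive x 1 (fun y => f (c * y + b)) (c * derive1 f (c * x + b)).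
Proof.
move=> df.
have h : is_derive x 1 (fun y : R => c * y + b) c.
  by apply: is_derive_eq; rewrite /GRing.scale /=; ring.
have hf : is_derive (c * x + b) 1 f (derive1 f (c * x + b)) by rewrite derive1E; apply: derivableP.
by rewrite mulrC; exact: (@is_derive1_comp _ f (fun y => c * y + b) x _ _ hf h).
Qed.

Lemma derive1n_affine (c b : R) f n : smooth1 f ->
  derive1n n (fun y => f (c * y + b)) = (fun y => c ^+ n * derive1n n f (c * y + b)).
Proof.
move=> sf; elim: n => [|n IH]; first by apply/funext => y; rewrite expr0 mul1r.
rewrite derive1nS IH; apply/funext => y.
have H := derive1_affine (sf n (c * y + b)).
rewrite derive1E.
transitivity ('D_1 (c ^+ n *: (fun z => derive1n n f (c * z + b))) y) => //.
rewrite deriveZ; last by apply: ex_derive.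
by rewrite (@derive_val _ _ _ _ _ _ _ H) derive1nS exprSr /GRing.scale /=; ring.
Qed.

Lemma smooth1_affine (c b : R) f : smooth1 f -> smooth1 (fun y => f (c * y + b)).
Proof.
move=> sf n x; rewrite derive1n_affine//.
have H := derive1_affine (sf n (c * x + b)).
exact: (@derivableZ _ _ _ (fun z => derive1n n f (c * z + b))).
Qed.

(** The margin r < 3 is inherited by derivatives and makes all of them vanish at
    the ends of the window. *)
Definition supp3 f := exists2 r : R, r < 3 & forall x, r < `|x| -> f x = 0.

Lemma derive1_near0 f x : (\forall y \near x, f y = 0) -> derive1 f x = 0.
Proof.
move=> h; rewrite derive1E (@near_eq_derive _ _ _ f (cst 0))//.
by rewrite derive_cst.
Qed.

Lemma supp_derive f (r : R) : (forall x, r < `|x| -> f x = 0) ->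
  forall x, r < `|x| -> derive1 f x = 0.
Proof.
move=> h x rx; apply: derive1_near0; near=> y; apply: h; near: y.
have cn : (fun y : R => `|y|) @ x --> `|x| by exact: (@norm_continuous _ _ x).
exact: (cvgr_gt _ cn _ rx).
Unshelve. all: by end_near. Qed.

Lemma supp3_ends f : supp3 f -> f (-3) = 0 /\ f 3 = 0.
Proof.
by move=> [r r3 h]; split; apply: h; rewrite ?normrN ger0_norm//.
Qed.

Lemma supp3_derive f : supp3 f -> supp3 (derive1 f).
Proof. by move=> [r r3 h]; exists r => //; exact: supp_derive. Qed.

Lemma cosint_decay L M a m t : bounded_derivs L M m -> supp3 m ->
  `|t| ^+ L * `|cosint a m t| <= 6 * M.
Proof.
elim: L a m => [|L IH] a m [cm bm hm] sm.
  by rewrite expr0 mul1r cosint_bound.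
case: hm => dm hm.
rewrite exprSr -mulrA -normrM.
have [e1 e2] := supp3_ends sm.
have cdm : continuous (derive1 m) by case: L hm {IH} => [|L] [].
rewrite (cosint_mul a t dm cdm e1 e2).
by apply: IH => //; exact: supp3_derive.
Qed.

(** The constant sees m only through the bounds on its derivatives, so the decay
    is uniform over families of amplitudes with common bounds. *)
Lemma cosint_decay1 L M a m t : bounded_derivs L M m -> supp3 m ->
  (1 + `|t|) ^+ L * `|cosint a m t| <= 2 ^+ L * (6 * M).
Proof.
move=> hm sm.
have [t1|t1] := leP `|t| 1.
  rewrite ler_pM//; first by rewrite lerXn2r// ?nnegrE//; lra.
  by apply: cosint_bound; case: L hm => [|L] [cm bm _].
apply: (@le_trans _ _ ((2 * `|t|) ^+ L * `|cosint a m t|)).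
  by rewrite ler_wpM2r// lerXn2r// ?nnegrE//; lra.
by rewrite exprMn -mulrA ler_wpM2l// cosint_decay.
Qed.

(** Each derivative costs a factor |x| <= 3 in the amplitude. The bound depends on
    the L^1 norm of m alone, and not on how concentrated m is. *)
Lemma cosint_bounded_derivs n M a m : continuous m ->
  (\int[lam]_(x in `[- 3, 3]) `|m x| <= M)%R -> bounded_derivs n (3 ^+ n * M) (cosint a m).
Proof.
elim: n a m M => [|n IH] a m M cm bm.
  split => //; last by move=> x _; rewrite expr0 mul1r (le_trans (cosint_bound1 _ _ cm)).
  by apply: derivable_cont => x; have := cosint_is_derive a x cm => ?; apply: ex_derive.
split.
- by apply: derivable_cont => x; have := cosint_is_derive a x cm => ?; apply: ex_derive.
- move=> x _; apply: le_trans (cosint_bound1 _ _ cm) _; apply: (le_trans bm).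
  rewrite ler_peMl//; last by rewrite exprn_ege1// ler1n.
  by apply: (le_trans _ bm); apply: Rintegral_ge0.
- split; first by move=> x; have := cosint_is_derive a x cm => ?; apply: ex_derive.
  rewrite (_ : derive1 _ = cosint (a + pi / 2) (fun x => x * m x)); last first.
    apply/funext => x; rewrite derive1E; have := cosint_is_derive a x cm => ?; exact: derive_val.
  rewrite exprSr -mulrA; apply: IH; first exact: continuous_idM.
  have cxm : continuous (fun x => x * m x) by exact: continuous_idM.
  apply: (@le_trans _ _ (\int[lam]_(x in `[- 3, 3]) (3 * `|m x|))).
    apply: le_Rintegral => //.
    + exact/integrable_norm/continuous_segment_integrable.
    + apply: continuous_segment_integrable; apply: continuousMr; first exact: cst_continuous.
      exact: continuous_normr.
    + by move=> x /=; rewrite in_itv /= -ler_norml => x3; rewrite normrM ler_wpM2r.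
  rewrite RintegralZl//; first by rewrite ler_pM2l.
  exact/integrable_norm/continuous_segment_integrable.
Qed.

(** The Schwartz class on the line. *)
Definition rapid f := smooth1 f /\
  forall n N, exists C, forall t, (1 + `|t|) ^+ N * `|derive1n n f t| <= C.

(** A derivative in t shifts the phase and multiplies the amplitude by x. *)
Lemma cosint_derive1n n a m : smooth1 m -> supp3 m -> exists a' m',
  [/\ smooth1 m', supp3 m' & derive1n n (cosint a m) = cosint a' m'].
Proof.
elim: n a m => [|n IH] a m sm su; first by exists a, m.
rewrite derive1Sn (_ : derive1 _ = cosint (a + pi / 2) (fun x => x * m x)); last first.
  apply/funext => x; rewrite derive1E; have := cosint_is_derive a x (smooth1_cont sm) => ?; exact: derive_val.
apply: IH; first by apply: smooth1M => //; exact: smooth1_id.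
by case: su => r r3 h; exists r => // x /h ->; rewrite mulr0.
Qed.

Lemma cosint_rapid a m : smooth1 m -> supp3 m -> rapid (cosint a m).
Proof.
move=> sm su; split.
  move=> n x; have [a' [m' [sm' _ ->]]] := cosint_derive1n n a sm su.
  have := cosint_is_derive a' x (smooth1_cont sm') => ?; exact: ex_derive.
move=> n N; have [a' [m' [sm' su' ->]]] := cosint_derive1n n a sm su.
have [M hM] := smooth1_bounded_derivs N sm'.
by exists (2 ^+ N * (6 * M)) => t; exact: cosint_decay1.
Qed.

Lemma supp3_rapid f : smooth1 f -> supp3 f -> rapid f.
Proof.
move=> sf su; split => // n N.
have {}su : supp3 (derive1n n f).
  by elim: n => [//|n IH]; rewrite derive1nS; exact: supp3_derive.
have [M hM] := cont_bounded (derivable_cont (sf n)).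
(* On the support, 1 + |t| <= 4. *)
exists (4 ^+ N * M) => t.
have M0 : 0 <= M by apply: le_trans (hM 0 _); rewrite ?normr0.
have [t3|t3] := leP `|t| 3.
  by rewrite ler_pM ?hM// lerXn2r// ?nnegrE//; lra.
by case: su => r r3 h; rewrite h ?normr0 ?mulr0 ?mulr_ge0// (lt_trans r3).
Qed.

End smooth_functions.

(** * Dominated convergence and product integrals *)

Section real_integrals.
Context d (T : measurableType d) {R : realType} (mu : {measure set T -> \bar R}).

Lemma dominated_Rintegral (f_ : nat -> T -> R) (f g : T -> R) :
  (forall n, measurable_fun setT (f_ n)) -> measurable_fun setT f ->
  (forall x, f_ ^~ x @ \oo --> f x) ->
  mu.-integrable setT (EFin \o g) -> (forall n x, `|f_ n x| <= g x) ->
  \int[mu]_x f_ n x @[n --> \oo] --> \int[mu]_x f x.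
Proof.
move=> mf_ mf ff ig fg.
have [|||||i1 _ i2] := @dominated_convergence _ T R mu setT measurableT
  (fun n x => (f_ n x)%:E) (fun x => (f x)%:E) (EFin \o g).
- by move=> n; exact/measurable_EFinP.
- exact/measurable_EFinP.
- by apply: aeW => x _; apply: cvg_EFin; [exact: nearW|exact: ff].
- by [].
- by apply: aeW => x n _; rewrite lee_fin.
- rewrite /Rintegral; apply: fine_cvg.
  by rewrite fineK//; exact: (integrable_fin_num measurableT i1).
Qed.

Lemma integrable_le (f g : T -> R) : measurable_fun setT f ->
  mu.-integrable setT (EFin \o g) -> (forall x, `|f x| <= g x) ->
  mu.-integrable setT (EFin \o f).
Proof.
move=> mf ig fg; apply: le_integrable ig => //; first exact/measurable_EFinP.
by move=> x _; rewrite lee_fin (le_trans (fg x))// ler_norm.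
Qed.

Lemma integrableZ (f : T -> R) (c : R) : mu.-integrable setT (EFin \o f) ->
  mu.-integrable setT (EFin \o (fun x => c * f x)).
Proof. by move=> h; apply: (integrableZl measurableT c h). Qed.

End real_integrals.

Section product_integrals.
Context d1 d2 (T1 : measurableType d1) (T2 : measurableType d2) {R : realType}.
Variables (m1 : {sigma_finite_measure set T1 -> \bar R})
  (m2 : {sigma_finite_measure set T2 -> \bar R}).

Lemma integrable_prod (f : T1 -> R) (g : T2 -> R) :
  m1.-integrable setT (EFin \o f) -> m2.-integrable setT (EFin \o g) ->
  (m1 \x m2)%E.-integrable setT (EFin \o (fun z => f z.1 * g z.2)) /\
  \int[(m1 \x m2)%E]_z (f z.1 * g z.2) = \int[m1]_x f x * \int[m2]_y g y.
Proof.
move=> fi gi; have [/integrableP[/measurable_EFinP mf fi1] /integrableP[/measurable_EFinP mg gi1]] := (fi, gi).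
have mfg : measurable_fun setT (EFin \o (fun z : T1 * T2 => f z.1 * g z.2)).
  apply/measurable_EFinP/measurable_funM; exact: measurableT_comp.
have ig : (m1 \x m2)%E.-integrable setT (EFin \o (fun z => f z.1 * g z.2)).
  apply/(integrable12ltyP m1 m2 mfg) => /=.
  under eq_integral => x _.
    under eq_integral do rewrite normrM EFinM.
    rewrite ge0_integralZl//; last first.
      by apply/measurable_EFinP; apply: measurableT_comp.
    over.
  rewrite ge0_integralZr//; last 2 first.
  - by apply/measurable_EFinP; apply: measurableT_comp.
  - exact: integral_ge0.
  apply: lte_mul_pinfty => //; first exact: integral_ge0.
  by rewrite ge0_fin_numE//; exact: integral_ge0.
split => //.
rewrite {1}/Rintegral -(integral12_prod_meas1 ig) /fubini_F /=.
have gfin := integrable_fin_num measurableT gi.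
under eq_integral => x _.
  under eq_integral do rewrite EFinM.
  rewrite (integralZl measurableT gi) -(fineK gfin) /=.
  over.
rewrite (integralZr measurableT fi) fineM//.
exact: integrable_fin_num.
Qed.

End product_integrals.

(** * Laplace integrals of cosines *)

Section cosine_inversion.
Context {R : realType}.
Notation lam := (@lebesgue_measure R).
Implicit Types (m f g : R -> R) (t x s : R).

Lemma oneDsqr_ge0 x : 0 <= oneDsqr x.
Proof. by rewrite (le_trans ler01)// oneDsqr_ge1. Qed.

Lemma le_oneDsqr x : oneDsqr x <= (1 + `|x|) ^+ 2.
Proof.
rewrite /oneDsqr sqrrD expr1n mul1r -real_normK ?num_real//.
by rewrite lerD2r lerDl mulrn_wge0.
Qed.

Lemma integral_oneDsqr :
  lam.-integrable setT (EFin \o (fun x => (oneDsqr x)^-1)) /\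
  \int[lam]_x (oneDsqr x)^-1 = pi.
Proof.
have E : (\int[lam]_x ((oneDsqr x)^-1)%:E = pi%:E)%E.
  rewrite (@ge0_symfun_integralT R (fun x => (oneDsqr x)^-1)).
  - rewrite (_ : [set x : R | _] = `[0, +oo[%classic); last first.
      by apply/seteqP; split => x /=; rewrite in_itv /= andbT.
    by rewrite integral0y_oneDsqr -EFinM mulrCA divff ?mulr1// .
  - by move=> x; rewrite invr_ge0 oneDsqr_ge0.
  - by move=> x; exact: continuous_oneDsqrV.
  - by move=> x; rewrite /= /oneDsqr sqrrN.
split; last by rewrite /Rintegral E.
apply/integrableP; split.
  apply/measurable_EFinP; apply: continuous_measurable_fun => x; exact: continuous_oneDsqrV.
under eq_integral => x _ do rewrite /= ger0_norm ?invr_ge0 ?oneDsqr_ge0//.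
by rewrite E ltry.
Qed.

Lemma cvg_expRN0 (F : R -> R) (K : R) : (forall x, `|F x| <= K) ->
  expR (- x) * F x @[x --> +oo] --> (0 : R).
Proof.
move=> FK; apply/cvgr0Pnorm_le => e e0.
have K0 : 0 <= K by apply: le_trans (FK 0).
have h := @cvgr_expR R.
near=> x.
rewrite normrM (@le_trans _ _ (`|expR (- x)| * (K + 1)))//.
  by rewrite ler_wpM2l// (le_trans (FK _))// lerDl.
rewrite -ler_pdivlMr ?ltr_wpDl//.
near: x; move/cvgr0Pnorm_le : h; apply; rewrite divr_gt0// ltr_wpDl//.
Unshelve. all: by end_near. Qed.

Lemma is_derive_expRN x : is_derive x 1 (fun x : R => expR (- x)) (- expR (- x)).
Proof. by apply: is_derive_eq; rewrite /GRing.scale /=; ring. Qed.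

(** On the half-line, exp(-x) f(x) has a primitive exp(-x) F(x) with F bounded;
    parity doubles the result. *)
Lemma laplace_even (f F : R -> R) (K l : R) :
  (forall x, 0 <= f x) -> continuous f -> f =1 f \o -%R ->
  (forall x, `|F x| <= K) ->
  (forall x, is_derive x 1 (fun x => expR (- x) * F x) (expR (- x) * f x)) ->
  F 0 = - l ->
  lam.-integrable setT (EFin \o (fun x => expR (- `|x|) * f x)) /\
  \int[lam]_x (expR (- `|x|) * f x) = 2 * l.
Proof.
move=> f0 cf ef FK dF F0.
have ce : continuous (fun x : R => expR (- `|x|) * f x).
  apply: continuousMr => // x.
  apply: (@continuous_comp _ _ _ (fun x : R => - `|x|) expR); last exact: continuous_expR.
  apply: continuousN; exact: norm_continuous.
have ge x : 0 <= expR (- `|x|) * f x by rewrite mulr_ge0// expR_ge0.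
have E : (\int[lam]_x (expR (- `|x|) * f x)%:E = (2 * l)%:E)%E.
  rewrite (@ge0_symfun_integralT R (fun x => expR (- `|x|) * f x))//; last first.
    by move=> x; rewrite /= normrN; congr (_ * _); exact: ef.
  rewrite (_ : [set x : R | _] = `[0, +oo[%classic); last first.
    by apply/seteqP; split => x /=; rewrite in_itv /= andbT.
  under eq_integral => x.
    rewrite inE /= in_itv /= andbT => x0; rewrite (ger0_norm x0); over.
  have ce' : continuous (fun x : R => expR (- x) * f x).
    apply: continuousMr => // x.
    apply: (@continuous_comp _ _ _ (fun x : R => - x) expR); last exact: continuous_expR.
    by apply: continuousN; exact: id.
  have cF : continuous (fun x => expR (- x) * F x).
    by apply: derivable_cont => x; apply: ex_derive.
  rewrite (@ge0_continuous_FTC2y R (fun x => expR (- x) * f x) (fun x => expR (- x) * F x) 0 0).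
  - by rewrite oppr0 expR0 mul1r F0 -EFinB sub0r opprK -EFinM.
  - by move=> x x0; rewrite mulr_ge0// expR_ge0.
  - exact: continuous_subspaceT.
  - exact: cvg_expRN0 FK.
  - by move=> x _; apply: ex_derive.
  - apply: cvg_at_right_filter; exact: cF.
  - by move=> x _; rewrite derive1E; apply: derive_val.
split; last by rewrite /Rintegral E.
apply/integrableP; split.
  by apply/measurable_EFinP; exact: continuous_measurable_fun.
under eq_integral => x _ do rewrite /= ger0_norm//.
by rewrite E ltry.
Qed.

Lemma integrable_expRN : lam.-integrable setT (EFin \o (fun x => expR (- `|x|))) /\
  \int[lam]_x expR (- `|x|) = 2.
Proof.
have E : (fun x : R => expR (- `|x|)) = (fun x => expR (- `|x|) * cst 1 x).
  by apply/funext => x; rewrite mulr1.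
rewrite E -[2 in X in _ /\ X]mulr1; apply: (@laplace_even (cst 1) (cst (-1)) 1 1) => //=.
- by move=> x; exact: cst_continuous.
- by move=> _; rewrite normrN1.
- by move=> x; have := is_derive_expRN x => ?; apply: is_derive_eq; rewrite /GRing.scale /=; ring.
Qed.

(** laplace_even wants a nonnegative function, hence the detour through
    1 + cos (x s). *)
Lemma cos_laplace s :
  lam.-integrable setT (EFin \o (fun x => expR (- `|x|) * cos (x * s))) /\
  \int[lam]_x (expR (- `|x|) * cos (x * s)) = 2 * (oneDsqr s)^-1.
Proof.
have cc := @continuous_cos_scale R s.
have q0 : oneDsqr s != 0 by rewrite gt_eqF// oneDsqr_gt0.
have := @laplace_even (fun x => 1 + cos (x * s))
  (fun x => (oneDsqr s)^-1 * (s * sin (x * s) - cos (x * s)) - 1)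
  ((oneDsqr s)^-1 * (`|s| + 1) + 1) (1 + (oneDsqr s)^-1).
case=> //=.
- by move=> x; apply: continuousD; [exact: cst_continuous|exact: cc].
- by move=> x; rewrite /comp mulNr cosN.
- move=> x; rewrite (le_trans (ler_normB _ _))// normr1 lerD2r normrM ger0_norm ?invr_ge0 ?oneDsqr_ge0//.
  rewrite ler_wpM2l ?invr_ge0 ?oneDsqr_ge0// (le_trans (ler_normB _ _))//.
  by rewrite lerD ?cos_max// normrM ler_piMr// sin_max.
- move=> x; have := is_derive_expRN x => ?.
  apply: is_derive_eq; rewrite /GRing.scale /=; move: q0; rewrite /oneDsqr => q0; field.
  exact: q0.
- by rewrite mul0r sin0 cos0 mulr0 sub0r; ring.
move=> i1 e1; have [i2 e2] := integrable_expRN.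
have E x : expR (- `|x|) * cos (x * s) = expR (- `|x|) * (1 + cos (x * s)) - expR (- `|x|) by ring.
split; first by under eq_fun do rewrite E; exact: integrableB i1 i2.
under eq_Rintegral do rewrite E.
by rewrite RintegralB// e1 e2; ring.
Qed.

End cosine_inversion.

(** * Inversion of the cosine transform *)

Section inversion.
Context {R : realType}.
Notation lam := (@lebesgue_measure R).
Implicit Types (m f g : R -> R) (a t x s : R).

Lemma cosint_setT a m t : supp3 m ->
  cosint a m t = \int[lam]_x (m x * cos (t * x + a)).
Proof.
move=> [r r3 h]; rewrite /cosint Rintegral_mkcond; apply: eq_Rintegral => x _.
rewrite patchE; case: ifPn => //; rewrite notin_setE /= in_itv /= => xn.
rewrite h ?mul0r//; apply: (lt_trans r3); rewrite ltNge ler_norml; exact/negP.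
Qed.

Lemma rapid_integrable f : rapid f -> lam.-integrable setT (EFin \o f).
Proof.
move=> [sf rf]; have [C hC] := rf 0%N 2%N.
have [io _] := @integral_oneDsqr R.
apply: (@integrable_le _ _ _ lam _ (fun x => C * (oneDsqr x)^-1)).
- by apply: continuous_measurable_fun; exact: smooth1_cont.
- exact: integrableZ.
- move=> x; rewrite ler_pdivlMr ?oneDsqr_gt0// mulrC; apply: (le_trans _ (hC x)).
  by rewrite ler_wpM2r// le_oneDsqr.
Qed.

Lemma integrable_cont_bounded f g (C : R) : lam.-integrable setT (EFin \o f) ->
  continuous g -> (forall x, `|g x| <= C) ->
  lam.-integrable setT (EFin \o (fun x => f x * g x)).
Proof.
move=> fi cg bg.
have [/measurable_EFinP mf _] := integrableP _ _ _ fi.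
apply: (@integrable_le _ _ _ lam _ (fun x => C * `|f x|)).
- by apply: measurable_funM => //; exact: continuous_measurable_fun.
- apply: integrableZ; exact: integrable_norm.
- by move=> x; rewrite normrM mulrC ler_wpM2r.
Qed.

Lemma smooth_supp_integrable m : smooth1 m -> supp3 m ->
  lam.-integrable setT (EFin \o m).
Proof. by move=> sm su; apply/rapid_integrable/supp3_rapid. Qed.

Lemma Rintegral_odd f : lam.-integrable setT (EFin \o f) ->
  (forall x, f (- x) = - f x) -> \int[lam]_x f x = 0.
Proof.
move=> fi fo.
have n1 : (- 1 : R) != 0 by rewrite oppr_eq0 oner_eq0.
have := Rintegral_affine 0 n1 fi.
under [in X in _ = X -> _]eq_Rintegral => x _.
  rewrite mulN1r addr0 fo -mulN1r; over.
by rewrite RintegralZl// normrN1 mul1r mulN1r => h; lra.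
Qed.

(** The addition formula for the cosine; the sine terms integrate to zero because
    m is even. *)
Lemma cosint_shift m t (xi : R) : smooth1 m -> supp3 m -> (forall x, m (- x) = m x) ->
  cosint 0 m t * cos (t * xi) = \int[lam]_x (m x * cos (t * (x - xi))).
Proof.
move=> sm su ev.
have im := smooth_supp_integrable sm su.
have cc : continuous (fun x : R => cos (t * x)).
  by have := @continuous_cos_affine R 0 t; under eq_fun do rewrite addr0.
have cs : continuous (fun x : R => sin (t * x)).
  move=> x; apply: (@continuous_comp _ _ _ (fun x => t * x)); last exact: continuous_sin.
  by apply: continuousM; [exact: cst_continuous|exact: id].
have i1 : lam.-integrable setT (EFin \o (fun x => m x * cos (t * x))).
  by apply: (integrable_cont_bounded im cc) => x; exact: cos_max.
have i2 : lam.-integrable setT (EFin \o (fun x => m x * sin (t * x))).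
  by apply: (integrable_cont_bounded im cs) => x; exact: sin_max.
rewrite cosint_setT//; under eq_Rintegral do rewrite addr0.
under [in RHS]eq_Rintegral => x _.
  rewrite (_ : m x * _ = cos (t * xi) * (m x * cos (t * x)) + sin (t * xi) * (m x * sin (t * x))).
    over.
  by rewrite mulrBr cosB; ring.
rewrite RintegralD//; [|exact: integrableZ|exact: integrableZ].
rewrite !RintegralZl// [X in _ + _ * X]Rintegral_odd//; last first.
  by move=> x; rewrite ev mulrN sinN mulrN.
by rewrite mulr0 addr0 mulrC.
Qed.

(** The Poisson kernel of width e, as the cosine transform of an Abel factor. *)
Lemma abel_cos (e s : R) : 0 < e ->
  lam.-integrable setT (EFin \o (fun t => expR (- `|e * t|) * cos (t * s))) /\
  \int[lam]_t (expR (- `|e * t|) * cos (t * s)) = 2 * (oneDsqr (s / e))^-1 / e.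
Proof.
move=> e0; have [i1 E] := @cos_laplace R (s / e).
have e0' : e != 0 by rewrite gt_eqF.
have fE t : expR (- `|e * t + 0|) * cos ((e * t + 0) * (s / e)) = expR (- `|e * t|) * cos (t * s).
  by rewrite addr0; congr (_ * cos _); field.
have [i2 _] := integral_affine 0 e0' i1.
have E2 := Rintegral_affine 0 e0' i1.
split; first by move: i2; rewrite /comp; under eq_fun do rewrite fE.
move: E2; rewrite E; under [in X in _ = X -> _]eq_Rintegral do rewrite fE.
rewrite gtr0_norm// => ->; by field.
Qed.

(** The Abel factor makes the double integral absolutely convergent, and the
    integrations may be exchanged. *)
Lemma abel_fubini m (xi e : R) : 0 < e -> smooth1 m -> supp3 m ->
  (forall x, m (- x) = m x) ->
  \int[lam]_t (expR (- `|e * t|) * (cosint 0 m t * cos (t * xi))) =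
  \int[lam]_s (m (e * s + xi) * (2 * (oneDsqr s)^-1)).
Proof.
move=> e0 sm su ev.
have im := smooth_supp_integrable sm su.
have e0' : e != 0 by rewrite gt_eqF.
pose f (z : R * R) := (expR (- `|e * z.1|) * m z.2) * cos (z.1 * (z.2 - xi)).
have ie : lam.-integrable setT (EFin \o (fun t => expR (- `|e * t|))).
  have [i _] := abel_cos 0 e0; move: i; rewrite /comp.
  by under eq_fun do rewrite mulr0 cos0 mulr1.
have [ip _] := integrable_prod ie im.
have mc : measurable_fun setT (fun z : R * R => cos (z.1 * (z.2 - xi))).
  apply: (measurableT_comp (continuous_measurable_fun (@continuous_cos R))).
  apply: measurable_funM; first exact: measurable_fst.
  by apply: measurable_funB; [exact: measurable_snd|exact: measurable_cst].
have fi : (lam \x lam)%E.-integrable setT (EFin \o f).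
  apply: (@integrable_le _ _ _ (lam \x lam)%E _ (fun z => `|expR (- `|e * z.1|) * m z.2|)).
  - apply: measurable_funM => //; have [] := integrableP _ _ _ ip.
    by move/measurable_EFinP.
  - exact: integrable_norm.
  - by move=> z; rewrite normrM ler_piMr// cos_max.
have i1 x : lam.-integrable setT (fun y => (f (x, y))%:E).
  apply: (integrable_cont_bounded (f := fun y => expR (- `|e * x|) * m y)
    (g := fun y => cos (x * (y - xi))) (C := 1)).
  - exact: integrableZ.
  - have := @continuous_cos_affine R (- (x * xi)) x.
    by under eq_fun do rewrite -mulrBr.
  - by move=> y; exact: cos_max.
have fE y x : f (x, y) = m y * (expR (- `|e * x|) * cos (x * (y - xi))).
  by rewrite /f /=; ring.
have i2 y : lam.-integrable setT (fun x => (f (x, y))%:E).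
  under eq_fun do rewrite fE.
  apply: (@integrableZ _ _ _ lam (fun x => expR (- `|e * x|) * cos (x * (y - xi)))).
  by have [] := abel_cos (y - xi) e0.
transitivity (\int[lam]_x (\int[lam]_y f (x, y))).
  apply: eq_Rintegral => t _; rewrite cosint_shift// -RintegralZl//; last first.
    have := i1 t; rewrite /f /= => h.
    apply: (integrable_cont_bounded im (g := fun y => cos (t * (y - xi))) (C := 1)).
      have := @continuous_cos_affine R (- (t * xi)) t.
      by under eq_fun do rewrite -mulrBr.
    by move=> y; exact: cos_max.
  by apply: eq_Rintegral => x _; rewrite /f mulrA.
transitivity (\int[lam]_y (\int[lam]_x f (x, y))).
  have FE := Fubini fi; rewrite /= in FE.
  rewrite /Rintegral.
  have e1 x : ((fine (\int[lam]_y (f (x, y))%:E))%:E = \int[lam]_y (f (x, y))%:E)%E.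
    by rewrite fineK//; exact: (integrable_fin_num measurableT (i1 x)).
  have e2 y : ((fine (\int[lam]_x (f (x, y))%:E))%:E = \int[lam]_x (f (x, y))%:E)%E.
    by rewrite fineK//; exact: (integrable_fin_num measurableT (i2 y)).
  under eq_integral do rewrite e1.
  under [in RHS]eq_integral do rewrite e2.
  by rewrite FE.
transitivity (\int[lam]_y (m y * (2 * (oneDsqr ((y - xi) / e))^-1 / e))).
  apply: eq_Rintegral => y _.
  have [j1 j2] := abel_cos (y - xi) e0; rewrite -j2 -RintegralZl//.
  by apply: eq_Rintegral => x _; rewrite fE.
pose q y := 2 * (oneDsqr ((y - xi) / e))^-1 / e.
have cq : continuous q.
  move=> y; apply: (@continuousM _ _ (fun y => 2 * (oneDsqr ((y - xi) / e))^-1)); last exact: cst_continuous.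
  apply: (@continuousM _ _ (cst 2)); first exact: cst_continuous.
  apply: (@continuous_comp _ _ _ (fun y => (y - xi) / e) (fun y => (oneDsqr y)^-1)).
    apply: (@continuousM _ _ (fun y => y - xi)); last exact: cst_continuous.
    by apply: (@continuousD _ _ _ id); [exact: id|exact: cst_continuous].
  exact: continuous_oneDsqrV.
have bq y : `|q y| <= 2 / e.
  rewrite /q ger0_norm; last by rewrite !mulr_ge0 ?invr_ge0 ?oneDsqr_ge0// ltW.
  rewrite ler_pM2r ?invr_gt0// ler_piMr// invf_le1 ?oneDsqr_gt0//; exact: oneDsqr_ge1.
have iq := integrable_cont_bounded im cq bq.
rewrite (Rintegral_affine xi e0' iq) gtr0_norm// -RintegralZl//; last first.
  by have [] := integral_affine xi e0' iq.
apply: eq_Rintegral => s _; rewrite /q addrK [e * s]mulrC mulfK//.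
by field; rewrite e0' gt_eqF ?oneDsqr_gt0.
Qed.

Lemma cvg_scale0 (u : nat -> R) t : u @ \oo --> (0 : R) ->
  (fun n => u n * t) @ \oo --> (0 : R).
Proof.
by move=> h; rewrite -(mul0r t); apply: (@cvgM _ _ _ _ u (fun _ => t)) => //; exact: cvg_cst.
Qed.

(** Both sides of abel_fubini converge by dominated convergence as e tends to 0.
    On the right the Poisson kernel, of total mass 2 * pi, concentrates at xi. *)
Lemma cosine_inversion m (xi : R) : smooth1 m -> supp3 m ->
  (forall x, m (- x) = m x) ->
  \int[lam]_t (cosint 0 m t * cos (t * xi)) = 2 * pi * m xi.
Proof.
move=> sm su ev.
have ir := rapid_integrable (cosint_rapid 0 sm su).
have cc := @continuous_cos_scale R xi.
have ih := integrable_cont_bounded ir cc (fun x => cos_max (x * xi)).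
have [/measurable_EFinP mh _] := integrableP _ _ _ ih.
set h := (fun t => _) in ih mh.
pose e n : R := n.+1%:R^-1.
have e0 n : 0 < e n by rewrite invr_gt0.
have ecvg : e @ \oo --> (0 : R) by exact: cvg_harmonic.
have c1 : \int[lam]_t (expR (- `|e n * t|) * h t) @[n --> \oo] --> \int[lam]_t h t.
  apply: (@dominated_Rintegral _ _ _ lam _ _ (fun t => `|h t|)).
  - move=> n; apply: measurable_funM => //; apply: continuous_measurable_fun => t.
    apply: (@continuous_comp _ _ _ (fun t : R => - `|e n * t|) expR); last exact: continuous_expR.
    apply: continuousN; apply: (@continuous_comp _ _ _ (fun t : R => e n * t) (fun y : R => `|y|)); last exact: norm_continuous.
    by apply: continuousM; [exact: cst_continuous|exact: id].
  - by [].
  - move=> t.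
    suff ce : (fun n => expR (- `|e n * t|)) @ \oo --> (1 : R).
      by rewrite -[X in _ --> X]mul1r; exact: (cvgM ce (cvg_cst (h t))).
    have ct : (fun n => - `|e n * t|) @ \oo --> (0 : R).
      rewrite -[X in _ --> X]oppr0 -[in X in _ --> X](@normr0 _ R).
      exact: (cvgN (cvg_norm (cvg_scale0 t ecvg))).
    by rewrite -[X in _ --> X](@expR0 R); exact: (cvg_comp _ expR ct (@continuous_expR R 0)).
  - exact: integrable_norm.
  - move=> n t; rewrite normrM ler_piMl// (ger0_norm (expR_ge0 _)).
    by rewrite expR_le1 oppr_le0.
have [M hM] := cont_bounded (smooth1_cont sm).
have bm x : `|m x| <= M.
  have [/hM//|x3] := leP `|x| 3.
  have [r r3 su'] := su; rewrite su' ?normr0; last exact: lt_trans x3.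
  by apply: le_trans (hM 0 _); rewrite ?normr0.
have [io iopi] := @integral_oneDsqr R.
have c2 : \int[lam]_s (m (e n * s + xi) * (2 * (oneDsqr s)^-1)) @[n --> \oo] -->
    \int[lam]_s (m xi * (2 * (oneDsqr s)^-1)).
  have mo : measurable_fun setT (fun s : R => 2 * (oneDsqr s)^-1).
    apply: measurable_funM => //; apply: continuous_measurable_fun => x.
    exact: continuous_oneDsqrV.
  apply: (@dominated_Rintegral _ _ _ lam _ _ (fun s => M * (2 * (oneDsqr s)^-1))).
  - move=> n; apply: measurable_funM => //; apply: continuous_measurable_fun => s.
    apply: (@continuous_comp _ _ _ (fun s : R => e n * s + xi) m); last exact: smooth1_cont.
    apply: continuousD; last exact: cst_continuous.
    by apply: continuousM; [exact: cst_continuous|exact: id].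
  - exact: measurable_funM.
  - move=> s.
    have ct : (fun n => e n * s + xi) @ \oo --> xi.
      by rewrite -[X in _ --> X]add0r; exact: (cvgD (cvg_scale0 s ecvg) (cvg_cst xi)).
    have cm : (fun n => m (e n * s + xi)) @ \oo --> m xi.
      exact: (cvg_comp _ m ct (smooth1_cont sm (x := xi))).
    exact: (cvgM cm (cvg_cst (2 * (oneDsqr s)^-1))).
  - by do 2 apply: integrableZ.
  - move=> n s; rewrite normrM [X in _ * X]ger0_norm ?mulr_ge0 ?invr_ge0 ?oneDsqr_ge0//.
    by rewrite ler_wpM2r// mulr_ge0 ?invr_ge0 ?oneDsqr_ge0.
have eE n : \int[lam]_s (m (e n * s + xi) * (2 * (oneDsqr s)^-1)) =
    \int[lam]_t (expR (- `|e n * t|) * h t).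
  by rewrite -abel_fubini.
rewrite (funext eE) in c2.
have -> : \int[lam]_t h t = \int[lam]_s (m xi * (2 * (oneDsqr s)^-1)).
  exact: (cvg_unique (@Rhausdorff R) c1 c2).
rewrite RintegralZl//; last exact: integrableZ.
by rewrite RintegralZl// iopi; ring.
Qed.

End inversion.

(** * Pairs of test functions with equal low frequencies *)

Section test_pairs.
Context {R : realType}.
Notation lam := (@lebesgue_measure R).
Implicit Types (m f g : R -> R) (a t x s : R).

Record bump_function (b : R -> R) : Prop := Bump {
  bump_smooth : smooth1 b;
  bump_even : forall t, b (- t) = b t;
  bump_ge0 : forall t, 0 <= b t;
  bump1 : forall t, `|t| <= 1 -> b t = 1;
  bump0 : forall t, 3 / 2 <= `|t| -> b t = 0 }.

Lemma bump_supp3 b : bump_function b -> supp3 b.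
Proof. by move=> hb; exists (3 / 2); [lra|move=> x /ltW; exact: bump0]. Qed.

Lemma bump_integral_gt0 b : bump_function b -> 0 < \int[lam]_t b t.
Proof.
move=> hb; have ib := smooth_supp_integrable (bump_smooth hb) (bump_supp3 hb).
apply: (@lt_le_trans _ _ 2) => //.
rewrite -lee_fin /Rintegral fineK; last exact: (integrable_fin_num measurableT ib).
have mb : measurable_fun setT (EFin \o b) by have [] := integrableP _ _ _ ib.
have h1 : (\int[lam]_(t in `[(-1)%R, 1%R]) cst 1 t <= \int[lam]_(t in `[(-1)%R, 1%R]) (b t)%:E)%E.
  apply: ge0_le_integral => //.
  - exact: measurable_funTS.
  - by move=> t /=; rewrite in_itv /= -ler_norml => t1; rewrite lee_fin (bump1 hb).
have h2 : (\int[lam]_(t in `[(-1)%R, 1%R]) (b t)%:E <= \int[lam]_t (b t)%:E)%E.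
  apply: ge0_subset_integral => //.
  by move=> t _; rewrite lee_fin bump_ge0.
apply: (le_trans _ (le_trans h1 h2)).
rewrite integral_cst//= mul1e lebesgue_measure_itv /= lte_fin ifT; last by lra.
by rewrite -EFinB lee_fin; lra.
Qed.

(** The function v is beta with its frequencies beyond 5 / 2 removed: the transform
    B of beta is multiplied by a cutoff and transformed back. As beta has mass one,
    the derivatives of B are bounded independently of dl, and therefore so is the
    decay of v. This uniformity is what allows dl to tend to 0 later. *)
Lemma test_pairs b : bump_function b -> exists C : nat -> R, forall dl : R, 0 < dl <= 1 ->
  exists beta v : R -> R,
  [/\ [/\ rapid beta, (forall t, 0 <= beta t), (forall t, 2 * dl < `|t| -> beta t = 0) &
       \int[lam]_t beta t = 1],
      rapid v, (forall L t, (1 + `|t|) ^+ L * `|v t| <= C L) &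
      forall xi, `|xi| <= 3 / 2 ->
        \int[lam]_t (beta t * cos (t * xi)) = \int[lam]_t (v t * cos (t * xi)) /\
        \int[lam]_t (beta t * sin (t * xi)) = \int[lam]_t (v t * sin (t * xi))].
Proof.
move=> hb.
have I0 := bump_integral_gt0 hb; set I := (\int[lam]_t b t) in I0.
have ib := smooth_supp_integrable (bump_smooth hb) (bump_supp3 hb).
(* The cutoff equals 1 up to 5 / 3, beyond the range 3 / 2 of xi, and vanishes from 5 / 2 < 3. *)
pose Theta x := b (3 / 5 * x + 0).
have sT : smooth1 Theta by apply: smooth1_affine; exact: bump_smooth.
have [M hM] : {M : nat -> R | forall L, bounded_derivs L (M L) (fun x => (2 * pi)^-1 * Theta x)}.
  have sT' := smooth1M (@smooth1_cst R (2 * pi)^-1) sT.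
  have h L := cid (smooth1_bounded_derivs L sT').
  by exists (fun L => projT1 (h L)) => L; exact: (projT2 (h L)).
exists (fun L => 2 ^+ L * (6 * (2 ^+ L * (M L * (3 ^+ L * 1))))) => dl /andP[dl0 dl1].
have di0 : dl^-1 != 0 by rewrite invr_eq0 gt_eqF.
pose beta t := (dl * I)^-1 * b (dl^-1 * t + 0).
have sb : smooth1 beta.
  exact: (smooth1M (@smooth1_cst R (dl * I)^-1) (@smooth1_affine R dl^-1 0 b (bump_smooth hb))).
have zb t : 2 * dl < `|t| -> beta t = 0.
  move=> t2; rewrite /beta (bump0 hb) ?mulr0// addr0 normrM normfV (gtr0_norm dl0).
  by rewrite [dl^-1 * _]mulrC ler_pdivlMr//; lra.
have ub : supp3 beta by exists 2 => [|t t2]; [lra|apply: zb; lra].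
have gb t : 0 <= beta t.
  have c0 : 0 <= (dl * I)^-1 by rewrite invr_ge0; apply: mulr_ge0; exact: ltW.
  exact: mulr_ge0 c0 (bump_ge0 hb _).
have eb t : beta (- t) = beta t by rewrite /beta !addr0 mulrN bump_even.
have Ib : \int[lam]_t beta t = 1.
  have [ib' _] := integral_affine 0 di0 ib.
  have := Rintegral_affine 0 di0 ib; rewrite -/I normfV (gtr0_norm dl0) => IE.
  rewrite /beta RintegralZl//.
  by move: IE => /(congr1 (fun x => dl * x)); rewrite mulVKf ?gt_eqF// => <-; rewrite mulVf// mulf_neq0 ?gt_eqF.
pose B := cosint 0 beta.
have sB : smooth1 B by have [] := cosint_rapid 0 sb ub.
have CB L : bounded_derivs L (3 ^+ L * 1) B.
  apply: cosint_bounded_derivs; first exact: smooth1_cont.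
  have ibb := smooth_supp_integrable sb ub.
  rewrite -Ib; under eq_Rintegral do rewrite ger0_norm//.
  rewrite /Rintegral fine_le//.
  - apply: (integrable_fin_num (mu := lam)) => //; exact: integrableS ibb.
  - exact: (integrable_fin_num measurableT ibb).
  - apply: ge0_subset_integral => //; first by have [] := integrableP _ _ _ ibb.
    by move=> t _; rewrite lee_fin.
pose m x := ((2 * pi)^-1 * Theta x) * B x.
have sm : smooth1 m.
  exact: (smooth1M (smooth1M (@smooth1_cst R (2 * pi)^-1) sT) sB).
have um : supp3 m.
  exists (5 / 2) => [|x x2]; first lra.
  by rewrite /m /Theta (bump0 hb) ?mulr0 ?mul0r// addr0 normrM ger0_norm; lra.
have em x : m (- x) = m x.
  rewrite /m (_ : Theta _ = Theta x); last by rewrite /Theta !addr0 mulrN bump_even.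
  by congr (_ * _); apply: eq_Rintegral => y _; rewrite !addr0 mulNr cosN.
have rv := cosint_rapid 0 sm um.
exists beta, (cosint 0 m); split => //.
- by split => //; exact: supp3_rapid.
- move=> L t; apply: cosint_decay1 => //; exact: bounded_derivsM.
move=> xi xi2; split; last first.
  have cs := @continuous_sin_scale R xi.
  rewrite !Rintegral_odd//.
  - apply: (integrable_cont_bounded (rapid_integrable rv) cs (C := 1)) => t; exact: sin_max.
  - move=> t; rewrite mulNr sinN mulrN; congr (- (_ * _)).
    by apply: eq_Rintegral => y _; rewrite !addr0 mulNr cosN.
  - apply: (integrable_cont_bounded (smooth_supp_integrable sb ub) cs (C := 1)) => t; exact: sin_max.
  - by move=> t; rewrite mulNr sinN mulrN eb.
rewrite cosine_inversion// /m /Theta (bump1 hb); last first.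
  by rewrite addr0 normrM ger0_norm//; lra.
rewrite mulr1 mulrA divff ?mul1r; last by rewrite mulf_neq0// gt_eqF// pi_gt0.
rewrite /B cosint_setT//; apply: eq_Rintegral => t _.
by rewrite addr0 [xi * t]mulrC.
Qed.

End test_pairs.

(** * Integration of product functions on row vectors *)

Section rV_measure.
Context {R : realType}.
Notation lam := (@lebesgue_measure R).

(** An open set is the union of those boxes with rational centre and radius
    1 / (k + 1) that it contains, and there are countably many of them. *)
Lemma open_rV_measurable n (U : set 'rV[R]_n) : open U -> measurable U.
Proof.
move=> oU.
pose box (q : 'rV[rat]_n * nat) : set 'rV[R]_n :=
  [set v | forall i, `|v ord0 i - ratr (q.1 ord0 i)| < q.2.+1%:R^-1].
pose F (i : nat) : set 'rV[R]_n :=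
  if unpickle i is Some q then (if `[< box q `<=` U >] then box q else set0) else set0.
rewrite (_ : U = \bigcup_i F i); last first.
  apply/seteqP; split => [v Uv|v [i _]]; last first.
    by rewrite /F; case: unpickle => // q; case: ifPn => // /asboolP; exact.
  have /nbhs_ballP[e /= e0 he] := open_nbhs_nbhs (conj oU Uv).
  have [k ke] : exists k : nat, k.+1%:R^-1 < e / 2.
    have e2 : 0 < e / 2 by rewrite divr_gt0.
    by have [k hk] := ltr_add_invr e2; exists k; rewrite add0r in hk.
  have hq i : exists q : rat, `|v ord0 i - ratr q| < k.+1%:R^-1.
    have := @rat_in_itvoo R (v ord0 i) (v ord0 i + k.+1%:R^-1).
    case=> [|q]; first by rewrite ltrDl invr_gt0.
    rewrite in_itv /= => /andP[q1 q2]; exists q.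
    have k0 : 0 < k.+1%:R^-1 :> R by rewrite invr_gt0.
    rewrite ltr_norml; move: q1 q2 k0; set c := k.+1%:R^-1; set u := ratr q; set w := v ord0 i.
    by move=> q1 q2 k0; apply/andP; split; lra.
  have [q hq'] := choice hq.
  pose p := (\row_i q i, k).
  exists (pickle p) => //; rewrite /F pickleK ifT; last first.
    apply/asboolP => w hw; apply: he; rewrite /ball /=.
    split=> // i j; rewrite (ord1 i) /ball /=.
    have := hw j; have := hq' j; rewrite /p /= mxE => h1 h2.
    rewrite (_ : v ord0 j - w ord0 j = (v ord0 j - ratr (q j)) - (w ord0 j - ratr (q j))); last by ring.
    rewrite (le_lt_trans (ler_normB _ _))//; move: h1 h2 ke.
    set c := _^-1; set x := `|_|; set y := `|_|; move=> h1 h2 ke; lra.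
  by move=> i /=; rewrite mxE.
apply: bigcupT_measurable => i; rewrite /F.
case: unpickle => [q|]; last exact: measurable0.
case: ifPn => _; last exact: measurable0.
rewrite (_ : box q = \bigcap_(i : 'I_n) ((fun v : 'rV[R]_n => v ord0 i) @^-1`
   [set t | `|t - ratr (q.1 ord0 i)| < q.2.+1%:R^-1])); last first.
  by apply/seteqP; split => [v h j _|v h j]; exact: h.
apply: fin_bigcap_measurable => // j _.
rewrite -[X in measurable X]setTI; apply: (@measurable_rV_coord _ R) => //.
rewrite (_ : [set _ | _] = ball (ratr (q.1 ord0 j) : R) q.2.+1%:R^-1); first exact: measurable_ball.
by apply/seteqP; split => t; rewrite /ball /= distrC.
Qed.

Lemma continuous_rV_measurable n (f : 'rV[R]_n -> R) : continuous f ->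
  measurable_fun setT f.
Proof.
move=> /continuousP cf; apply: (measurability _ (RGenOpens.measurableE R)).
move=> _ [_ [a [b ->] <-]]; rewrite setTI; apply: open_rV_measurable.
exact/cf/interval_open.
Qed.

End rV_measure.

Local Open Scope complex_scope.

Section complex_integrals.
Context {R : realType}.
Notation lam := (@lebesgue_measure R).
Local Notation Re := complex.Re.
Local Notation Im := complex.Im.

(** cintegral over an arbitrary measure space: the induction on the dimension passes
    through products. *)
Definition cint d (T : measurableType d) (mu : {measure set T -> \bar R})
    (f : T -> R[i]) : R[i] :=
  (\int[mu]_x Re (f x)) +i* (\int[mu]_x Im (f x)).

Definition cintable d (T : measurableType d) (mu : {measure set T -> \bar R})
    (f : T -> R[i]) : Prop :=
  mu.-integrable setT (fun x => (Re (f x))%:E) /\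
  mu.-integrable setT (fun x => (Im (f x))%:E).

Lemma ReM (x y : R[i]) : Re (x * y) = Re x * Re y - Im x * Im y.
Proof. by case: x y => [a b] [c e]. Qed.

Lemma ImM (x y : R[i]) : Im (x * y) = Re x * Im y + Im x * Re y.
Proof. by case: x y => [a b] [c e]. Qed.

Lemma cint_prod d1 d2 (T1 : measurableType d1) (T2 : measurableType d2)
    (m1 : {sigma_finite_measure set T1 -> \bar R})
    (m2 : {sigma_finite_measure set T2 -> \bar R})
    (f : T1 -> R[i]) (g : T2 -> R[i]) :
  cintable m1 f -> cintable m2 g ->
  cintable (m1 \x m2)%E (fun z => f z.1 * g z.2) /\
  cint (m1 \x m2)%E (fun z => f z.1 * g z.2) = cint m1 f * cint m2 g.
Proof.
move=> [fr fi] [gr gi].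
have [i1 e1] := integrable_prod fr gr.
have [i2 e2] := integrable_prod fi gi.
have [i3 e3] := integrable_prod fr gi.
have [i4 e4] := integrable_prod fi gr.
split.
  split; under eq_fun do rewrite (ReM, ImM).
    exact: integrableB i1 i2.
  exact: integrableD i3 i4.
have h1 : \int[(m1 \x m2)%E]_z Re (f z.1 * g z.2) =
    (\int[m1]_x Re (f x)) * (\int[m2]_x Re (g x)) - (\int[m1]_x Im (f x)) * (\int[m2]_x Im (g x)).
  by under eq_Rintegral do rewrite ReM; rewrite RintegralB// e1 e2.
have h2 : \int[(m1 \x m2)%E]_z Im (f z.1 * g z.2) =
    (\int[m1]_x Re (f x)) * (\int[m2]_x Im (g x)) + (\int[m1]_x Im (f x)) * (\int[m2]_x Re (g x)).
  by under eq_Rintegral do rewrite ImM; rewrite RintegralD// e3 e4.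
by rewrite /cint h1 h2.
Qed.

Definition tensor n (f : 'I_n -> R -> R[i]) (x : 'rV[R]_n) : R[i] :=
  \prod_i f i (x ord0 i).

Lemma measurable_tensor n (f : 'I_n -> R -> R[i]) :
  (forall i, measurable_fun setT (fun t => Re (f i t)) /\
             measurable_fun setT (fun t => Im (f i t))) ->
  measurable_fun setT (fun x => Re (tensor f x)) /\
  measurable_fun setT (fun x => Im (tensor f x)).
Proof.
move=> mf; rewrite /tensor.
elim: (index_enum _) => [|i s [IH1 IH2]].
  by split; under eq_fun do rewrite big_nil; exact: measurable_cst.
have [m1 m2] := mf i.
have c1 : measurable_fun setT (fun x : 'rV[R]_n => Re (f i (x ord0 i))).
  exact: (measurableT_comp m1 (measurable_rV_coord i)).
have c2 : measurable_fun setT (fun x : 'rV[R]_n => Im (f i (x ord0 i))).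
  exact: (measurableT_comp m2 (measurable_rV_coord i)).
split; under eq_fun do rewrite big_cons (ReM, ImM).
  by apply: measurable_funB; exact: measurable_funM.
by apply: measurable_funD; exact: measurable_funM.
Qed.

(** Induction on the dimension: Fubini splits off the first coordinate, since the
    measure on row vectors is the image of a product measure under rV_cons. *)
Lemma cint_tensor n (f : 'I_n -> R -> R[i]) :
  (forall i, cintable lam (f i)) ->
  cintable (lebesgue_rV n) (tensor f) /\
  cint (lebesgue_rV n) (tensor f) = \prod_i cint lam (f i).
Proof.
elim: n f => [|n IH] f fi.
  have E x : tensor f x = 1 by rewrite /tensor big_ord0.
  have T1 : lebesgue_rV 0 [set: 'rV[R]_0] = 1%E by rewrite /= diracE mem_set.
  have I1 : (\int[lebesgue_rV 0]_x cst 1%:E x = 1%:E :> \bar R)%E.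
    transitivity (1%:E * lebesgue_rV 0 [set: 'rV[R]_0])%E; first exact: integral_cst.
    by rewrite T1 mule1.
  have I0 : (\int[lebesgue_rV 0]_x cst 0%:E x = 0%:E :> \bar R)%E.
    exact: integral0.
  have EE : tensor f = cst 1 by apply/funext.
  rewrite EE; split.
    split; last exact: integrable0.
    apply/integrableP; split; first exact: (measurable_cst (1%:E : \bar R)).
    rewrite (eq_integral (cst 1%:E)) ?I1 ?ltry//.
    by move=> x _ /=; rewrite normr1.
  by rewrite big_ord0 /cint /Rintegral /= [X in fine X +i* _]I1 [X in _ +i* fine X]I0.
have mf i : measurable_fun setT (fun t => Re (f i t)) /\ measurable_fun setT (fun t => Im (f i t)).
  have [/integrableP[m1 _] /integrableP[m2 _]] := fi i.
  by split; apply/measurable_EFinP.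
have [mr mi] := measurable_tensor mf.
have [[ir ii] e] := IH _ (fun i => fi (lift ord0 i)).
have [[jr ji] e'] := cint_prod (fi ord0) (conj ir ii).
have E z : tensor f (rV_cons z) = f ord0 z.1 * tensor (fun i => f (lift ord0 i)) z.2.
  rewrite /tensor big_ord_recl /rV_cons mxE unlift_none; congr (_ * _).
  by apply: eq_bigr => i _; rewrite mxE liftK.
have pr (g : 'rV[R]_n.+1 -> R) (h : measurableTypeR R * 'rV[R]_n -> R) :
    measurable_fun setT g -> (lam \x lebesgue_rV n)%E.-integrable setT (EFin \o h) ->
    (forall z, g (rV_cons z) = h z) ->
    (lebesgue_rV n.+1).-integrable setT (EFin \o g) /\
    \int[lebesgue_rV n.+1]_x g x = \int[(lam \x lebesgue_rV n)%E]_z h z.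
  move=> mg ih gh.
  have mg' : measurable_fun setT (EFin \o g) by exact/measurable_EFinP.
  have ih' : (lam \x lebesgue_rV n)%E.-integrable (@rV_cons R n @^-1` setT) ((EFin \o g) \o @rV_cons R n).
    rewrite preimage_setT; apply: eq_integrable ih => // z _ /=.
    by rewrite gh.
  split.
    have := @integrable_pushforward _ _ _ _ R _ (@measurable_rV_cons R n) (lam \x lebesgue_rV n)%E _ _ mg' ih' measurableT.
    exact.
  rewrite /Rintegral; congr fine.
  have := @integral_pushforward _ _ _ _ R _ (@measurable_rV_cons R n) (lam \x lebesgue_rV n)%E _ _ mg' ih' measurableT.
  rewrite preimage_setT => PE; apply: (etrans PE).
  by apply: eq_integral => z _ /=; rewrite gh.
have [k1 l1] := pr _ (fun z => Re (f ord0 z.1 * tensor (fun i => f (lift ord0 i)) z.2)) mr jr (fun z => congr1 (fun w : R[i] => Re w) (E z)).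
have [k2 l2] := pr _ (fun z => Im (f ord0 z.1 * tensor (fun i => f (lift ord0 i)) z.2)) mi ji (fun z => congr1 (fun w : R[i] => Im w) (E z)).
split; first by split.
rewrite /cint [X in X +i* _]l1 [X in _ +i* X]l2 big_ord_recl -e.
exact: e'.
Qed.

End complex_integrals.

(** * Product functions are Schwartz functions *)

Section tensor_schwartz.
Context {R : realType} {d : nat}.
Notation lam := (@lebesgue_measure R).
Local Notation V := 'rV[R]_d.
Implicit Types (f h : 'I_d -> R -> R).

Definition tensorR f (x : V) : R := \prod_i f i (x ord0 i).

Lemma tensorR_complex f x : (tensorR f x)%:C = tensor (fun i t => (f i t)%:C) x.
Proof. by rewrite /tensorR /tensor rmorph_prod. Qed.

Lemma integral_tensorR f : (forall i, lam.-integrable setT (EFin \o f i)) ->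
  (lebesgue_rV d).-integrable setT (EFin \o tensorR f) /\
  \int[lebesgue_rV d]_x tensorR f x = \prod_i \int[lam]_t f i t.
Proof.
move=> fi.
have ci i : cintable lam (fun t => (f i t)%:C) by split; [exact: fi|exact: integrable0].
have [[i1 _] e] := cint_tensor ci.
have E x : complex.Re (tensor (fun i t => (f i t)%:C) x) = tensorR f x by rewrite -tensorR_complex.
split.
  by apply: eq_integrable i1 => // x _; rewrite /= E.
move: e => /(congr1 (fun w : R[i] => complex.Re w)) /=.
under eq_Rintegral do rewrite E; move=> ->.
have -> : \prod_i cint lam (fun t => (f i t)%:C) = (\prod_i \int[lam]_t f i t)%:C.
  rewrite rmorph_prod; apply: eq_bigr => i _; rewrite /cint /=.
  by congr (_ +i* _); rewrite /Rintegral integral0.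
by [].
Qed.

Lemma differentiable_tensorR f x : (forall i, smooth1 (f i)) ->
  differentiable (tensorR f) x.
Proof.
move=> sf.
have H (s : seq 'I_d) : differentiable (fun x : V => \prod_(i <- s) f i (x ord0 i)) x.
  elim: s => [|i s IH].
    rewrite (_ : (fun _ => _) = cst 1); first exact: differentiable_cst.
    by apply/funext => y; rewrite big_nil.
  rewrite (_ : (fun _ => _) = (fun y : V => f i (y ord0 i)) * (fun y : V => \prod_(i <- s) f i (y ord0 i))).
    apply: differentiableM => //.
    apply: (@differentiable_comp _ _ _ _ (fun y : V => y ord0 i) (f i)).
      exact: differentiable_coord.
    by apply/derivable1_diffP; exact: (sf i 0%N).
  by apply/funext => y; rewrite big_cons.
exact: H.
Qed.

(** Along a coordinate line a product function is a constant times one of its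
    factors. *)
Lemma derive_tensorR f x i : (forall i, smooth1 (f i)) ->
  'D_(delta_mx ord0 i) (tensorR f) x =
  tensorR (fun j => if j == i then derive1 (f j) else f j) x.
Proof.
move=> sf; pose c := \prod_(j | j != i) f j (x ord0 j).
have E (t : R) : tensorR f (t *: delta_mx ord0 i + x) = c * f i (t + x ord0 i).
  rewrite /tensorR (bigD1 i)//= mulrC; congr (_ * f i _).
    apply: eq_bigr => j ji; rewrite !mxE eqxx /= (negbTE ji).
    by rewrite mulr0 add0r.
  by rewrite !mxE !eqxx mulr1.
have -> : tensorR (fun j => if j == i then derive1 (f j) else f j) x = c * derive1 (f i) (x ord0 i).
  rewrite /tensorR (bigD1 i)//= eqxx mulrC; congr (_ * _).
  by apply: eq_bigr => j /negbTE ->.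
rewrite /derive derive1E /derive.
have -> : (fun t : R => t^-1 *: ((tensorR f \o shift x) (t *: delta_mx ord0 i) - tensorR f x)) =
    (fun t => c *: (t^-1 *: ((f i \o shift (x ord0 i)) (t *: 1) - f i (x ord0 i)))).
  apply/funext => t; rewrite /= E.
  have := E 0; rewrite scale0r add0r add0r => ->.
  by rewrite /GRing.scale /= mulr1; ring.
apply/cvg_lim => //.
apply: cvgZr.
exact: (sf i 0%N (x ord0 i)).
Qed.

Lemma smooth1_derive1n (g : R -> R) n : smooth1 g -> smooth1 (derive1n n g).
Proof.
move=> sg; elim: n => [|n IH]; first exact: sg.
rewrite derive1nS; exact: (smooth1_derive IH).
Qed.

Lemma partials_tensorR f s : (forall i, smooth1 (f i)) ->
  partials s (tensorR f) = tensorR (fun i => derive1n (count_mem i s) (f i)).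
Proof.
move=> sf; elim: s => [//|j s IH] /=.
rewrite IH; apply/funext => x; rewrite derive_tensorR; last first.
  by move=> i; exact: smooth1_derive1n.
apply: eq_bigr => i _; have [->|ij] := eqVneq i j.
  by rewrite add1n derive1nS.
by rewrite add0n.
Qed.

Lemma partials_cst0 s : partials s (fun _ : V => 0 : R) = (fun _ => 0).
Proof.
elim: s => [//|i s IH] /=; rewrite IH; apply/funext => x.
exact: derive_cst.
Qed.

Lemma enorm_le_prod (x : V) : 1 + enorm x <= \prod_i (1 + `|x ord0 i|).
Proof.
have h1 (s : seq 'I_d) : 1 + \sum_(i <- s) `|x ord0 i| <= \prod_(i <- s) (1 + `|x ord0 i|).
  elim: s => [|i s IH]; first by rewrite !big_nil addr0.
  rewrite !big_cons; set a := `|_|; set b := \sum_(_ <- _) _ in IH *.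
  have a0 : 0 <= a by exact: normr_ge0.
  have b0 : 0 <= b by rewrite /b sumr_ge0.
  apply: (@le_trans _ _ ((1 + a) * (1 + b))); last by rewrite ler_wpM2l// addr_ge0.
  by have := mulr_ge0 a0 b0; lra.
apply: le_trans (h1 _); rewrite lerD2l /enorm.
have S0 : 0 <= \sum_i `|x ord0 i| by rewrite sumr_ge0.
rewrite -(ger0_norm S0) -sqrtr_sqr ler_wsqrtr//.
have h2 (s : seq 'I_d) : \sum_(i <- s) x ord0 i ^+ 2 <= (\sum_(i <- s) `|x ord0 i|) ^+ 2.
  elim: s => [|i s IH]; first by rewrite !big_nil expr0n.
  rewrite !big_cons; set a := x ord0 i; set b := \sum_(_ <- _) `|_| in IH *.
  have a0 : 0 <= `|a| by [].
  have b0 : 0 <= b by rewrite /b sumr_ge0.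
  rewrite -[a ^+ 2]real_normK ?num_real// sqrrD.
  by have := mulr_ge0 a0 b0; rewrite -mulr_natr; lra.
exact: h2.
Qed.

Lemma enorm_ge0 (x : V) : 0 <= enorm x. Proof. exact: sqrtr_ge0. Qed.

Lemma normc_real (a : R) : ComplexField.Normc.normc (a +i* 0) = `|a|.
Proof. by rewrite /= expr0n /= addr0 sqrtr_sqr. Qed.

(** A partial derivative of order at most N only involves derivatives of order at
    most N of each factor; the sum of their bounds serves all of them. *)
Lemma schwartz_tensorR f : (forall i, rapid (f i)) ->
  schwartz (fun x : V => (tensorR f x)%:C).
Proof.
move=> rf; have sf i : smooth1 (f i) by have [] := rf i.
split.
  split => s x /=; first by rewrite partials_tensorR//; apply: differentiable_tensorR => i; exact: smooth1_derive1n.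
  by rewrite partials_cst0; exact: differentiable_cst.
move=> N.
have [C hC] : {C : 'I_d -> nat -> R | forall i n t, (1 + `|t|) ^+ N * `|derive1n n (f i) t| <= C i n}.
  have h i n := cid ((rf i).2 n N).
  by exists (fun i n => projT1 (h i n)) => i n; exact: (projT2 (h i n)).
have C0 i n : 0 <= C i n by apply: le_trans (hC i n 0); rewrite mulr_ge0// exprn_ge0// addr_ge0.
pose K := \prod_i \sum_(n < N.+1) C i n.
apply: (@le_lt_trans _ _ K%:E); last exact: ltry.
apply: ub_ereal_sup => _ [x _ [s /= sN <-]].
rewrite lee_fin /cpartials /= partials_tensorR// partials_cst0 expr0n /= addr0 sqrtr_sqr.
apply: (@le_trans _ _ ((\prod_i (1 + `|x ord0 i|)) ^+ N * `|tensorR (fun i => derive1n (count_mem i s) (f i)) x|)).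
  rewrite ler_wpM2r// lerXn2r ?nnegrE ?enorm_le_prod// ?prodr_ge0//.
  - by rewrite addr_ge0// enorm_ge0.
rewrite /tensorR normr_prod -prodrXl -big_split /=.
apply: ler_prod => i _; apply/andP; split.
  by rewrite mulr_ge0// exprn_ge0// addr_ge0.
apply: le_trans (hC i (count_mem i s) _) _.
have cN : (count_mem i s < N.+1)%N by rewrite ltnS (leq_trans _ sN)// count_size.
rewrite (bigD1 (Ordinal cN))//= lerDl sumr_ge0//.
Qed.

End tensor_schwartz.

(** * A bump function from the resolution of unity *)

Section theta_bump.
Context {R : realType} {d : nat}.
Notation lam := (@lebesgue_measure R).
Local Notation V := 'rV[R]_d.

Lemma rapid_affine (c b : R) f : c != 0 -> rapid f -> rapid (fun t => f (c * t + b)).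
Proof.
move=> c0 [sf rf]; split; first exact: smooth1_affine.
move=> n N; have [C hC] := rf n N.
have cn : 0 < `|c| by rewrite normr_gt0.
pose K := 1 + (1 + `|b|) / `|c|.
have K1 : 1 <= K by rewrite lerDl divr_ge0// addr_ge0.
exists (K ^+ N * (`|c| ^+ n * C)) => t.
rewrite derive1n_affine// normrM normrX.
set D := `|derive1n n f _|.
(* K is chosen so that 1 + |t| <= K (1 + |c t + b|). *)
apply: (@le_trans _ _ ((K * (1 + `|c * t + b|)) ^+ N * (`|c| ^+ n * D))).
  apply: ler_wpM2r; first by apply: mulr_ge0; [exact: exprn_ge0|exact: normr_ge0].
  have K0 : 0 <= K by apply: le_trans K1.
  apply: lerXn2r; rewrite ?nnegrE; first exact: addr_ge0.
    by apply: mulr_ge0 => //; exact: addr_ge0.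
  have h : `|t| <= (`|c * t + b| + `|b|) / `|c|.
    by rewrite ler_pdivlMr// -normrM mulrC -[X in `|X|](addrK b) ler_normB.
  apply: (@le_trans _ _ (1 + (`|c * t + b| + `|b|) / `|c|)); first by rewrite lerD2l.
  rewrite /K; set a := `|c * t + b|; set be := `|b|; set i := `|c|^-1.
  have a0 : 0 <= a by exact: normr_ge0.
  have b0 : 0 <= be by exact: normr_ge0.
  have i0 : 0 <= i by rewrite /i invr_ge0.
  have := mulr_ge0 (mulr_ge0 a0 b0) i0; have := mulr_ge0 b0 i0; have := mulr_ge0 a0 i0.
  by clearbody a be i; move=> *; nra.
rewrite exprMn -!mulrA; apply: ler_wpM2l; first by rewrite exprn_ge0//; apply: le_trans K1.
by rewrite mulrCA ler_wpM2l ?exprn_ge0// hC.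
Qed.

Lemma derive1_line (G : V -> R) (e : V) t :
  derive1 (fun s : R => G (s *: e)) t = 'D_e G (t *: e) /\
  (derivable G (t *: e) e -> derivable (fun s : R => G (s *: e)) t 1).
Proof.
have E : (fun h : R => h^-1 *: (((fun s : R => G (s *: e)) \o shift t) (h *: 1) - G (t *: e))) =
    (fun h : R => h^-1 *: ((G \o shift (t *: e)) (h *: e) - G (t *: e))).
  by apply/funext => h; rewrite /= -scalerDl /GRing.scale /= mulr1.
split; last by rewrite /derivable E.
by rewrite derive1E /derive E.
Qed.

Lemma smooth1_line (G : V -> R) (i : 'I_d) : smooth G ->
  smooth1 (fun s : R => G (s *: delta_mx ord0 i)).
Proof.
move=> sG n.
have E : derive1n n (fun s : R => G (s *: delta_mx ord0 i)) =
    (fun s => partials (nseq n i) G (s *: delta_mx ord0 i)).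
  elim: n => [//|n IH]; rewrite derive1nS IH; apply/funext => s.
  by have [-> _] := derive1_line (partials (nseq n i) G) (delta_mx ord0 i) s.
move=> x; rewrite E.
have [_] := derive1_line (partials (nseq n i) G) (delta_mx ord0 i) x; apply.
by apply: diff_derivable; exact: sG.
Qed.

Lemma coord_le_enorm (x : V) i : `|x ord0 i| <= enorm x.
Proof.
rewrite -sqrtr_sqr /enorm ler_wsqrtr// (bigD1 i)//= lerDl sumr_ge0// => j _.
exact: sqr_ge0.
Qed.

Lemma enorm_line (t : R) (i : 'I_d) : enorm (t *: delta_mx ord0 i : V) = `|t|.
Proof.
rewrite /enorm (bigD1 i)//= big1 ?addr0; first by rewrite !mxE !eqxx mulr1 sqrtr_sqr.
by move=> j ji; rewrite !mxE eqxx (negbTE ji) mulr0 expr0n.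
Qed.

(** The restriction of theta0 to a coordinate axis, multiplied by its reflection to
    become even and squared to become nonnegative. *)
Lemma bump_theta (theta0 : V -> R[i]) (i : 'I_d) : resolution_generator theta0 ->
  exists b : R -> R, bump_function b.
Proof.
move=> [[[sre _] _] th1 th0].
pose T (t : R) := complex.Re (theta0 (t *: delta_mx ord0 i)).
have sT : smooth1 T by exact: (@smooth1_line (fun x => complex.Re (theta0 x)) i sre).
have T1 t : `|t| <= 1 -> T t = 1 by move=> h; rewrite /T th1// enorm_line.
have T0 t : 3 / 2 <= `|t| -> T t = 0 by move=> h; rewrite /T th0// enorm_line.
pose c t := T t * T (- 1 * t + 0).
have sc : smooth1 c by exact: (smooth1M sT (@smooth1_affine R (-1) 0 T sT)).
have ec t : c (- t) = c t by rewrite /c !addr0 !mulN1r opprK mulrC.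
exists (fun t => c t * c t); split.
- exact: (smooth1M sc sc).
- by move=> t; rewrite !ec.
- by move=> t; rewrite -expr2 sqr_ge0.
- by move=> t t1; rewrite /c !T1 ?mulr1// addr0 mulN1r normrN.
- by move=> t t1; rewrite /c T0 ?mul0r.
Qed.

(** The support is placed in a cube, the shape to which product functions are
    adapted. *)
Lemma resolution0 (theta0 : V -> R[i]) k (xi : V) i : resolution_generator theta0 ->
  3 / 2 * 2 ^+ k < `|xi ord0 i| -> resolution theta0 k xi = 0.
Proof.
move=> [_ _ th0] h.
have H j : (j <= k)%N -> theta0 (2 ^- j *: xi) = 0.
  move=> jk; apply: th0; apply: (le_trans _ (coord_le_enorm _ i)).
  rewrite mxE normrM ger0_norm ?invr_ge0 ?exprn_ge0// [(2 ^+ j)^-1 * _]mulrC ler_pdivlMr ?exprn_gt0//.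
  apply: (le_trans _ (ltW h)); rewrite ler_wpM2l// ler_weXn2l// ler1n//.
case: k h H => [|k] h H /=; first by have := H 0%N (leqnn _); rewrite expr0 invr1 scale1r.
by rewrite !H// subr0.
Qed.

Lemma cisD (a b : R) : cis (a + b) = cis a * cis b.
Proof. by rewrite /cis cosD sinD; apply/eqP; rewrite eq_complex /= addrC; apply/andP; split; apply/eqP; ring. Qed.

Lemma cis_sum (I : Type) (s : seq I) (F : I -> R) :
  cis (\sum_(i <- s) F i) = \prod_(i <- s) cis (F i).
Proof.
elim: s => [|i s IH]; first by rewrite !big_nil /cis cos0 sin0.
by rewrite !big_cons cisD IH.
Qed.

Lemma cint_cis (f : R -> R) (w : R) : lam.-integrable setT (EFin \o f) ->
  cintable lam (fun t => cis (w * t) * (f t)%:C) /\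
  cint lam (fun t => cis (w * t) * (f t)%:C) =
    (\int[lam]_t (f t * cos (t * w))) +i* (\int[lam]_t (f t * sin (t * w))).
Proof.
move=> fi.
have cc := @continuous_cos_scale R w.
have cs := @continuous_sin_scale R w.
have E1 t : complex.Re (cis (w * t) * (f t)%:C) = f t * cos (t * w).
  by rewrite /cis /= mulr0 subr0 mulrC [w * t]mulrC.
have E2 t : complex.Im (cis (w * t) * (f t)%:C) = f t * sin (t * w).
  by rewrite /cis /= mulr0 add0r mulrC [w * t]mulrC.
split.
  split; under eq_fun do rewrite (E1, E2).
    by apply: (integrable_cont_bounded fi cc (C := 1)) => t; exact: cos_max.
  by apply: (integrable_cont_bounded fi cs (C := 1)) => t; exact: sin_max.
rewrite /cint; under eq_Rintegral do rewrite E1.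
by under [X in _ +i* X = _]eq_Rintegral do rewrite E2.
Qed.

Lemma invfourier_tensorR (f : 'I_d -> R -> R) (xi : V) :
  (forall i, lam.-integrable setT (EFin \o f i)) ->
  invfourier (fun x => (tensorR f x)%:C) xi =
  ((2 * pi) `^ (- (d%:R / 2)))%:C *
  \prod_i ((\int[lam]_t (f i t * cos (t * xi ord0 i))) +i* (\int[lam]_t (f i t * sin (t * xi ord0 i)))).
Proof.
move=> fi; rewrite /invfourier; congr (_ * _).
have := cint_tensor (fun i => (cint_cis (xi ord0 i) (fi i)).1) => -[_ e].
rewrite -(eq_bigr _ (fun i _ => (cint_cis (xi ord0 i) (fi i)).2)) -e.
rewrite /cint /cintegral.
have E x : cis (dotv xi x) * (tensorR f x)%:C =
    tensor (fun i t => cis (xi ord0 i * t) * (f i t)%:C) x.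
  by rewrite tensorR_complex /tensor big_split /= /dotv cis_sum.
under eq_Rintegral do rewrite E.
by under [X in _ +i* X = _]eq_Rintegral do rewrite E.
Qed.

End theta_bump.

Section integrable_arith.
Context d (T : measurableType d) {R : realType} (mu : {measure set T -> \bar R}).

Lemma Rintegrable_add (f g : T -> R) : mu.-integrable setT (EFin \o f) ->
  mu.-integrable setT (EFin \o g) ->
  mu.-integrable setT (EFin \o (fun x => f x + g x)).
Proof. by move=> fi gi; exact: (integrableD measurableT fi gi). Qed.

Lemma Rintegrable_sub (f g : T -> R) : mu.-integrable setT (EFin \o f) ->
  mu.-integrable setT (EFin \o g) ->
  mu.-integrable setT (EFin \o (fun x => f x - g x)).
Proof. by move=> fi gi; exact: (integrableB measurableT fi gi). Qed.

End integrable_arith.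

(** * Weights, and testing at a point *)

Section key_inequality.
Context {R : realType} {d : nat}.
Notation lam := (@lebesgue_measure R).
Local Notation V := 'rV[R]_d.
Local Notation mu := (@lebesgue_rV R d).

(** A product in place of a power of 1 + kap |x - z|: its integrals factor over the
    coordinates. *)
Definition weight (kap : R) (x z : V) : R := \prod_i (1 + kap * `|x ord0 i - z ord0 i|).

Lemma measurable_tensorR (f : 'I_d -> R -> R) :
  (forall i, measurable_fun setT (f i)) -> measurable_fun setT (tensorR f).
Proof.
move=> mf; rewrite /tensorR; elim: (index_enum _) => [|i s IH].
  by under eq_fun do rewrite big_nil; exact: measurable_cst.
under eq_fun do rewrite big_cons.
apply: measurable_funM => //.
exact: (measurableT_comp (mf i) (measurable_rV_coord i)).
Qed.

Lemma measurable_weight kap x : measurable_fun setT (weight kap x).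
Proof.
apply: (@measurable_tensorR (fun i t => 1 + kap * `|x ord0 i - t|)) => i.
apply: measurable_funD; first exact: measurable_cst.
apply: measurable_funM; first exact: measurable_cst.
apply: measurableT_comp => //; apply: measurable_funB => //; exact: measurable_cst.
Qed.

Lemma weight_ge1 kap x z : 0 <= kap -> 1 <= weight kap x z.
Proof.
move=> k0; rewrite /weight; elim: (index_enum _) => [|i s IH]; first by rewrite big_nil.
rewrite big_cons; apply: (@le_trans _ _ (1 * 1)); first by rewrite mulr1.
by apply: ler_pM => //; rewrite lerDl mulr_ge0.
Qed.

Definition profile (f : R -> R) (kap : R) (x : V) : V -> R :=
  tensorR (fun i t => f (kap * t + (- (kap * x ord0 i)))).

(** If some |xi_i| exceeds (3 / 2) 2 ^ k, the multiplier vanishes; otherwise all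
    rescaled frequencies lie in the range where beta and v have the same transforms. *)
Lemma profile_transform theta0 (beta v : R -> R) (k : nat) (x xi : V) :
  resolution_generator theta0 -> rapid beta -> rapid v ->
  (forall w, `|w| <= 3 / 2 ->
        \int[lam]_t (beta t * cos (t * w)) = \int[lam]_t (v t * cos (t * w)) /\
        \int[lam]_t (beta t * sin (t * w)) = \int[lam]_t (v t * sin (t * w))) ->
  resolution theta0 k xi * invfourier (fun z => (profile beta (2 ^+ k) x z)%:C) xi =
  resolution theta0 k xi * invfourier (fun z => (profile v (2 ^+ k) x z)%:C) xi.
Proof.
move=> hth rb rv E.
have k0 : 0 < 2 ^+ k :> R by rewrite exprn_gt0.
set kap : R := 2 ^+ k in k0 *.
have kn : kap != 0 by rewrite gt_eqF.
have [[i hi]|hxi] := pselect (exists i, 3 / 2 * kap < `|xi ord0 i|).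
  by rewrite (resolution0 hth hi) !mul0r.
congr (_ * _).
have ir (f : R -> R) (b : R) : rapid f -> lam.-integrable setT (EFin \o (fun t => f (kap * t + b))).
  by move=> rf; exact/rapid_integrable/rapid_affine.
rewrite /profile !invfourier_tensorR; try by move=> i; exact: ir.
congr (_ * _); apply: eq_bigr => i _.
set w := xi ord0 i; set b := - (kap * x ord0 i).
have hw : `|w / kap| <= 3 / 2.
  rewrite normrM normfV (gtr0_norm k0) ler_pdivrMr// leNgt; apply/negP => h.
  by apply: hxi; exists i.
have cc := @continuous_cos_scale R.
have cs := @continuous_sin_scale R.
have I1 (f : R -> R) e : rapid f -> lam.-integrable setT (EFin \o (fun s => f s * cos (s * e))).
  by move=> rf; apply: (integrable_cont_bounded (rapid_integrable rf) (cc e) (C := 1)) => t; exact: cos_max.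
have I2 (f : R -> R) e : rapid f -> lam.-integrable setT (EFin \o (fun s => f s * sin (s * e))).
  by move=> rf; apply: (integrable_cont_bounded (rapid_integrable rf) (cs e) (C := 1)) => t; exact: sin_max.
have C1 (f : R -> R) : rapid f ->
    \int[lam]_t (f (kap * t + b) * cos (t * w)) =
    kap^-1 * (cos (b * (w / kap)) * \int[lam]_s (f s * cos (s * (w / kap)))
            + sin (b * (w / kap)) * \int[lam]_s (f s * sin (s * (w / kap)))).
  move=> rf.
  rewrite -!RintegralZl//; [|exact: I2|exact: I1].
  rewrite -RintegralD//; [|exact/integrableZ/I1|exact/integrableZ/I2].
  have ii : lam.-integrable setT (EFin \o (fun s => cos (b * (w / kap)) * (f s * cos (s * (w / kap)))
     + sin (b * (w / kap)) * (f s * sin (s * (w / kap))))).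
    by apply: Rintegrable_add; [exact/integrableZ/I1|exact/integrableZ/I2].
  rewrite (Rintegral_affine b kn ii) (gtr0_norm k0) mulKf//.
  apply: eq_Rintegral => t _.
  rewrite (_ : t * w = (kap * t + b) * (w / kap) - b * (w / kap)); last by field.
  by rewrite cosB; ring.
have C2 (f : R -> R) : rapid f ->
    \int[lam]_t (f (kap * t + b) * sin (t * w)) =
    kap^-1 * (cos (b * (w / kap)) * \int[lam]_s (f s * sin (s * (w / kap)))
            - sin (b * (w / kap)) * \int[lam]_s (f s * cos (s * (w / kap)))).
  move=> rf.
  rewrite -!RintegralZl//; [|exact: I1|exact: I2].
  rewrite -RintegralB//; [|exact/integrableZ/I2|exact/integrableZ/I1].
  have ii : lam.-integrable setT (EFin \o (fun s => cos (b * (w / kap)) * (f s * sin (s * (w / kap)))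
     - sin (b * (w / kap)) * (f s * cos (s * (w / kap))))).
    by apply: Rintegrable_sub; [exact/integrableZ/I2|exact/integrableZ/I1].
  rewrite (Rintegral_affine b kn ii) (gtr0_norm k0) mulKf//.
  apply: eq_Rintegral => t _.
  rewrite (_ : t * w = (kap * t + b) * (w / kap) - b * (w / kap)); last by field.
  by rewrite sinB; ring.
have [E1 E2] := E _ hw.
by rewrite !C1// !C2// E1 E2.
Qed.

Lemma integral_profile (f : R -> R) kap x : 0 < kap ->
  lam.-integrable setT (EFin \o f) ->
  mu.-integrable setT (EFin \o profile f kap x) /\
  \int[mu]_z profile f kap x z = kap ^- d * (\int[lam]_t f t) ^+ d.
Proof.
move=> k0 fi; have kn : kap != 0 by rewrite gt_eqF.
have H i : lam.-integrable setT (EFin \o (fun t => f (kap * t + (- (kap * x ord0 i))))).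
  by have [] := integral_affine (- (kap * x ord0 i)) kn fi.
have [i1 e] := integral_tensorR H; split; first exact: i1.
rewrite /profile e; transitivity (\prod_(i < d) (kap^-1 * \int[lam]_t f t)); last first.
  by rewrite prodr_const card_ord exprMn exprVn.
apply: eq_bigr => i _.
by rewrite (Rintegral_affine (- (kap * x ord0 i)) kn fi) (gtr0_norm k0) mulKf.
Qed.

Definition decay (kap a : R) (x z : V) : R := (weight kap x z) `^ (- a).

Lemma decay_ge0 kap a x z : 0 <= decay kap a x z.
Proof. exact: powR_ge0. Qed.

Lemma decay_nat kap (L : nat) x z : 0 <= kap ->
  decay kap L%:R x z = (weight kap x z) ^- L.
Proof.
by move=> k0; rewrite /decay powRN powR_mulrn// (le_trans ler01)// weight_ge1.
Qed.

Lemma measurable_decay kap a x : measurable_fun setT (decay kap a x).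
Proof. exact: (measurableT_comp (measurable_powR (- a)) (measurable_weight _ _)). Qed.

Lemma profile_le v kap x L (C : R) z : 0 < kap ->
  (forall t, (1 + `|t|) ^+ L * `|v t| <= C) ->
  `|profile v kap x z| <= C ^+ d * decay kap L%:R x z.
Proof.
move=> k0 hv; rewrite (decay_nat _ _ _ (ltW k0)) /profile /tensorR /weight normr_prod -prodrXl -prodfV.
have -> : C ^+ d = \prod_(i < d) C by rewrite prodr_const card_ord.
rewrite -big_split /=; apply: ler_prod => i _; rewrite normr_ge0 /=.
have p0 : 0 < 1 + kap * `|x ord0 i - z ord0 i|.
  by rewrite ltr_pwDl// mulr_ge0// ltW.
rewrite ler_pdivlMr ?exprn_gt0// [`|v _| * _]mulrC; apply: (le_trans _ (hv (kap * z ord0 i - kap * x ord0 i))).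
apply: ler_wpM2r => //; apply: lerXn2r; rewrite ?nnegrE; [exact: ltW|exact: addr_ge0|].
by rewrite lerD2l -mulrBr normrM (gtr0_norm k0) distrC.
Qed.

(** As dl tends to 0, the integral of h against the profile beta, divided by the
    mass kap ^- d of the latter, tends to h x by continuity, while the decay of
    v bounds the integral independently of dl. *)
Lemma test_pair_bound (h : V -> R) (kap : R) (x : V) (C : nat -> R) :
  continuous h -> 0 < kap ->
  (forall dl : R, 0 < dl <= 1 -> exists beta v : R -> R,
    [/\ [/\ rapid beta, (forall t, 0 <= beta t), (forall t, 2 * dl < `|t| -> beta t = 0) &
       \int[lam]_t beta t = 1],
      (forall L t, (1 + `|t|) ^+ L * `|v t| <= C L),
      mu.-integrable setT (EFin \o (fun z => h z * profile beta kap x z)),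
      mu.-integrable setT (EFin \o (fun z => h z * profile v kap x z)) &
      \int[mu]_z (h z * profile beta kap x z) = \int[mu]_z (h z * profile v kap x z)]) ->
  forall L, (`|h x|%:E <= (C L ^+ d * kap ^+ d)%:E *
     \int[mu]_z (`|h z| * decay kap L%:R x z)%:E)%E.
Proof.
move=> ch k0 H L.
have C0 : 0 <= C L.
  have [|beta [v [_ hv _ _ _]]] := H 1; first by rewrite ltr01 lexx.
  by apply: le_trans (hv L 0); rewrite mulr_ge0// exprn_ge0// addr_ge0.
apply/lee_addgt0Pr => e e0.
have /cvgrPdist_le/(_ e e0)/nbhs_ballP[r /= r0 hr] := ch x.
(* The profile lives within distance 2 * dl / kap <= r / 2 of x. *)
have [|beta [v [[rb b0 sb b1] hv ib iv E]]] := H (Num.min 1 (r * kap / 4)).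
  by rewrite lt_min ltr01 divr_gt0 ?mulr_gt0// ge_min lexx.
set dl := Num.min _ _ in sb.
have dlr : dl <= r * kap / 4 by rewrite /dl ge_min lexx orbT.
have [iU eU] := integral_profile x k0 (rapid_integrable rb).
rewrite b1 expr1n mulr1 in eU.
set U := profile beta kap x in ib E iU eU.
have U0 z : 0 <= U z by apply: prodr_ge0 => i _; exact: b0.
(* Where U is nonzero, z lies in the ball around x given by the continuity of h. *)
have near z : `|h x - h z| * U z <= e * U z.
  have [[i hi]|hz] := pselect (exists i, 2 * dl < `|kap * z ord0 i + (- (kap * x ord0 i))|).
    rewrite (_ : U z = 0) ?mulr0// /U /profile /tensorR (bigD1 i)//= sb ?mul0r//.
  apply: ler_wpM2r => //; apply: hr; split => // i j; rewrite (ord1 i) /ball /=.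
  have : `|kap * z ord0 j + (- (kap * x ord0 j))| <= 2 * dl.
    by rewrite leNgt; apply/negP => hj; apply: hz; exists j.
  rewrite -mulrBr normrM (gtr0_norm k0) distrC => hj.
  rewrite -(ltr_pM2l k0); apply: (le_lt_trans hj).
  apply: (@le_lt_trans _ _ (2 * (r * kap / 4))); first by rewrite ler_pM2l.
  have := mulr_gt0 r0 k0; rewrite [kap * r]mulrC; set q := r * kap; lra.
have i1 : mu.-integrable setT (EFin \o (fun z => h x * U z)) by exact: integrableZ.
have i2 : mu.-integrable setT (EFin \o (fun z => h x * U z - h z * U z)).
  exact: Rintegrable_sub.
have s1 : `|h x * kap ^- d - \int[mu]_z (h z * U z)| <= e * kap ^- d.
  rewrite -eU -!RintegralZl// -RintegralB//.
  apply: le_trans (le_normr_Rintegral _ i2) _ => //.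
  apply: le_Rintegral => //.
  - exact: integrable_norm.
  - exact: integrableZ.
  - by move=> z _; rewrite -mulrBl normrM (ger0_norm (U0 z)).
have s2 : (`|\int[mu]_z (h z * U z)|%:E <= (C L ^+ d)%:E *
     \int[mu]_z (`|h z| * decay kap L%:R x z)%:E)%E.
  rewrite E -ge0_integralZl//; last 3 first.
  - apply/measurable_EFinP; apply: measurable_funM.
      by apply: measurableT_comp => //; exact: continuous_rV_measurable.
    exact: measurable_decay.
  - by move=> z _; rewrite lee_fin mulr_ge0// decay_ge0.
  - by rewrite lee_fin exprn_ge0.
  rewrite (EFin_normr_Rintegral measurableT iv); apply: le_trans.
    apply: (le_abse_integral _ _ (measurable_int _ iv)) => //.
  apply: ge0_le_integral => //.
  - by apply: measurableT_comp => //; exact: measurable_int iv.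
  - apply/measurable_EFinP; apply: measurable_funM; first exact: measurable_cst.
    by apply: measurable_funM; [apply: measurableT_comp => //; exact: continuous_rV_measurable|exact: measurable_decay].
  - move=> z _; rewrite lee_fin normrM mulrCA ler_wpM2l//.
    exact: profile_le.
rewrite -(@lee_pmul2l _ (kap ^- d)%:E); last 2 first.
- by [].
- by rewrite lte_fin invr_gt0 exprn_gt0.
rewrite ge0_muleDr; last 2 first.
- apply: mule_ge0; first by rewrite lee_fin mulr_ge0 ?exprn_ge0 ?(ltW k0).
  by apply: integral_ge0 => z _; rewrite lee_fin mulr_ge0// decay_ge0.
- by rewrite lee_fin ltW.
rewrite muleA -!EFinM mulrCA mulVf ?mulr1; last by rewrite expf_neq0// gt_eqF.
apply: (@le_trans _ _ ((`|\int[mu]_z (h z * U z)| + e * kap ^- d)%:E)).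
  have kd : 0 <= kap ^- d by rewrite invr_ge0 exprn_ge0// ltW.
  rewrite lee_fin; set I := \int[mu]_z _ in s1 *.
  have -> : kap ^- d * `|h x| = `|I + (h x * kap ^- d - I)|.
    by rewrite addrC subrK normrM (ger0_norm kd) mulrC.
  by rewrite (le_trans (ler_normD _ _))// lerD2l.
by rewrite EFinD [e * _]mulrC; apply: leeD.
Qed.

End key_inequality.

(** * The reproducing inequality *)

Section reproducing.
Context {R : realType} {d : nat}.
Local Notation V := 'rV[R]_d.
Local Notation mu := (@lebesgue_rV R d).
Local Notation normc := ComplexField.Normc.normc.

Lemma normc_sqrtE (w : R[i]) : normc w = Num.sqrt (complex.Re w ^+ 2 + complex.Im w ^+ 2).
Proof. by case: w. Qed.

Lemma normc_ge0 (w : R[i]) : 0 <= normc w.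
Proof. by rewrite normc_sqrtE sqrtr_ge0. Qed.

Lemma Re_le_normc (w : R[i]) : `|complex.Re w| <= normc w.
Proof. by rewrite normc_sqrtE -sqrtr_sqr ler_wsqrtr// lerDl sqr_ge0. Qed.

Lemma Im_le_normc (w : R[i]) : `|complex.Im w| <= normc w.
Proof. by rewrite normc_sqrtE -sqrtr_sqr ler_wsqrtr// lerDr sqr_ge0. Qed.

Lemma normc_le (w : R[i]) : normc w <= `|complex.Re w| + `|complex.Im w|.
Proof.
have h : 0 <= `|complex.Re w| + `|complex.Im w| by rewrite addr_ge0.
rewrite -(ger0_norm h) -sqrtr_sqr normc_sqrtE ler_wsqrtr//.
rewrite sqrrD !real_normK ?num_real// -addrA lerD2l lerDr.
by rewrite mulrn_wge0// mulr_ge0.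
Qed.

Definition ccontinuous (g : V -> R[i]) :=
  continuous (fun x => complex.Re (g x)) /\ continuous (fun x => complex.Im (g x)).

Lemma measurable_normc (g : V -> R[i]) : ccontinuous g ->
  measurable_fun setT (fun x => normc (g x)).
Proof.
move=> [c1 c2]; apply: continuous_rV_measurable => x.
under eq_fun do rewrite normc_sqrtE.
apply: (@continuous_comp _ _ _ (fun x => complex.Re (g x) ^+ 2 + complex.Im (g x) ^+ 2) (@Num.sqrt R)); last exact: sqrt_continuous.
by apply: continuousD; [have := c1 x|have := c2 x] => h; apply: (continuousM h h).
Qed.

Lemma le_weighted_integral (h1 h2 : V -> R) kap L x :
  measurable_fun setT h1 -> measurable_fun setT h2 ->
  (forall z, 0 <= h1 z <= h2 z) ->
  (\int[mu]_z (h1 z * decay kap L x z)%:E <= \int[mu]_z (h2 z * decay kap L x z)%:E)%E.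
Proof.
move=> m1 m2 h; apply: ge0_le_integral => //.
- by move=> z _; rewrite lee_fin mulr_ge0 ?decay_ge0//; have /andP[] := h z.
- by apply/measurable_EFinP; apply: measurable_funM => //; exact: measurable_decay.
- by apply/measurable_EFinP; apply: measurable_funM => //; exact: measurable_decay.
- by move=> z _; rewrite lee_fin ler_wpM2r ?decay_ge0//; have /andP[] := h z.
Qed.

(** The multiplier erases the difference between the transforms of the two test
    functions, so f is evaluated at one and the same function and g has equal
    integrals against both. Real and imaginary parts are treated separately. *)
Lemma reproducing_bound (theta0 : V -> R[i]) : (0 < d)%N ->
  resolution_generator theta0 ->
  exists C : nat -> R, (forall L, 0 <= C L) /\
  forall k f g, represents g (lp_dist theta0 f k) -> forall L x,
  ((normc (g x))%:E <= (C L * (2 ^+ k) ^+ d)%:E *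
     \int[mu]_z (normc (g z) * decay (2 ^+ k) L%:R x z)%:E)%E.
Proof.
move=> hd hth.
have [b hb] := bump_theta (Ordinal hd) hth.
have [C0 hC] := test_pairs hb.
have C00 L : 0 <= C0 L.
  have [|beta [v [_ _ hv _]]] := hC 1; first by rewrite ltr01 lexx.
  by apply: le_trans (hv L 0); rewrite mulr_ge0// exprn_ge0// addr_ge0.
exists (fun L => 2 * C0 L ^+ d); split; first by move=> L; rewrite mulr_ge0// exprn_ge0.
move=> k f g [cr ci hg] L x.
have k0 : 0 < 2 ^+ k :> R by rewrite exprn_gt0.
set kap : R := 2 ^+ k in k0 *.
have mg := measurable_normc (conj cr ci).
have main (p : R[i] -> R) : continuous (fun z => p (g z)) ->
    (forall w, `|p w| <= normc w) ->
    (forall (U : V -> R), schwartz (fun z => (U z)%:C) ->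
       mu.-integrable setT (EFin \o (fun z => p (g z) * U z)) /\
       \int[mu]_z (p (g z) * U z) = p (lp_dist theta0 f k (fun z => (U z)%:C))) ->
    (`|p (g x)|%:E <= (C0 L ^+ d * kap ^+ d)%:E *
       \int[mu]_z (normc (g z) * decay kap L%:R x z)%:E)%E.
  move=> cp np hp.
  have H (dl : R) : 0 < dl <= 1 -> exists beta v : R -> R,
    [/\ [/\ rapid beta, (forall t, 0 <= beta t), (forall t, 2 * dl < `|t| -> beta t = 0) &
       \int[@lebesgue_measure R]_t beta t = 1],
      (forall L t, (1 + `|t|) ^+ L * `|v t| <= C0 L),
      mu.-integrable setT (EFin \o (fun z => p (g z) * profile beta kap x z)),
      mu.-integrable setT (EFin \o (fun z => p (g z) * profile v kap x z)) &
      \int[mu]_z (p (g z) * profile beta kap x z) = \int[mu]_z (p (g z) * profile v kap x z)].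
    move=> hdl; have [beta [v [[rb b0 sb b1] rv hv E]]] := hC dl hdl.
    have S (q : R -> R) : rapid q -> schwartz (fun z : V => (profile q kap x z)%:C).
      by move=> rq; apply: schwartz_tensorR => i; apply: rapid_affine => //; rewrite gt_eqF.
    have [i1 e1] := hp _ (S _ rb); have [i2 e2] := hp _ (S _ rv).
    exists beta, v; split => //.
    apply: (etrans e1); apply: (etrans _ (esym e2)).
    apply: (congr1 p); apply: (congr1 f); apply: (congr1 fourier).
    by apply/funext => xi; apply: profile_transform.
  apply: le_trans (test_pair_bound cp k0 H L) _.
  apply: lee_wpmul2l; first by rewrite lee_fin mulr_ge0// ?exprn_ge0// ltW.
  apply: le_weighted_integral => //.
    by apply: measurableT_comp => //; exact: continuous_rV_measurable.
  by move=> z; rewrite normr_ge0 np.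
have EU (p : R[i] -> R) U : (p = fun w => complex.Re w) \/ (p = fun w => complex.Im w) ->
   forall z, p (g z) * U z = p (g z * (U z)%:C).
  by move=> [->|->] z; case: (g z) => a c /=; rewrite mulr0 ?subr0 ?add0r.
have h1 : (`|complex.Re (g x)|%:E <= (C0 L ^+ d * kap ^+ d)%:E *
       \int[mu]_z (normc (g z) * decay kap L%:R x z)%:E)%E.
  apply: (main (fun w => complex.Re w)) => //; first exact: Re_le_normc.
  move=> U sU; have [[i1 i2] ->] := hg _ sU.
  have E := EU _ U (or_introl erefl).
  by split; [apply: eq_integrable i1 => // z _ /=|apply: eq_Rintegral => z _]; rewrite E.
have h2 : (`|complex.Im (g x)|%:E <= (C0 L ^+ d * kap ^+ d)%:E *
       \int[mu]_z (normc (g z) * decay kap L%:R x z)%:E)%E.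
  apply: (main (fun w => complex.Im w)) => //; first exact: Im_le_normc.
  move=> U sU; have [[i1 i2] ->] := hg _ sU.
  have E := EU _ U (or_intror erefl).
  by split; [apply: eq_integrable i2 => // z _ /=|apply: eq_Rintegral => z _]; rewrite E.
apply: (@le_trans _ _ ((`|complex.Re (g x)|)%:E + (`|complex.Im (g x)|)%:E)%E).
  by rewrite -EFinD lee_fin normc_le.
apply: le_trans (leeD h1 h2) _.
have c0 : 0 <= C0 L ^+ d * kap ^+ d by rewrite mulr_ge0 ?exprn_ge0 ?(ltW k0).
rewrite (_ : 2 * C0 L ^+ d * kap ^+ d = C0 L ^+ d * kap ^+ d + C0 L ^+ d * kap ^+ d); last by ring.
by rewrite EFinD ge0_muleDl// lee_fin.
Qed.

End reproducing.

(** * Slowly decaying Schwartz functions *)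

Section slow_rapid_functions.
Context {R : realType}.
Notation lam := (@lebesgue_measure R).

Lemma supp_derive1n (f : R -> R) (r : R) n : (forall x, r < `|x| -> f x = 0) ->
  forall x, r < `|x| -> derive1n n f x = 0.
Proof.
move=> h; elim: n => [//|n IH] x; rewrite derive1nS; exact: supp_derive.
Qed.

Section mollified.
Variables (r b : R -> R).
Hypotheses (mr : measurable_fun setT r) (r0 : forall s, 0 <= r s)
  (rd : forall M, exists C, forall s, r s * (1 + `|s|) ^+ M <= C)
  (sb : smooth1 b) (ub : forall x, 3 / 2 < `|x| -> b x = 0).

Let rb : rapid b.
Proof. by apply: supp3_rapid => //; exists (3 / 2) => //; lra. Qed.

Lemma integrable_weighted (M : nat) (K : R) :
  lam.-integrable setT (EFin \o (fun s => K * (r s * (1 + `|s|) ^+ M))).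
Proof.
apply: integrableZ.
have [C hC] := rd (M + 2); have [io _] := @integral_oneDsqr R.
have mw : measurable_fun setT (fun s : R => (1 + `|s|) ^+ M).
  apply: (@measurable_funX _ _ _ _ (fun s : R => 1 + `|s|)).
  apply: continuous_measurable_fun => s.
  by apply: continuousD; [exact: cst_continuous|exact: norm_continuous].
apply: (@integrable_le _ _ _ lam _ (fun s => C * (oneDsqr s)^-1)).
- exact: measurable_funM.
- exact: integrableZ.
- move=> s; have p0 : 0 <= 1 + `|s| by rewrite addr_ge0.
  rewrite ger0_norm ?mulr_ge0 ?exprn_ge0//.
  rewrite ler_pdivlMr ?oneDsqr_gt0//; apply: le_trans (hC s).
  rewrite exprD -!mulrA; apply: ler_wpM2l => //.
  by apply: ler_wpM2l; [exact: exprn_ge0|exact: le_oneDsqr].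
Qed.

(** The n derivatives fall on b, so that r need only be measurable. *)
Definition mollify n (t : R) : R := \int[lam]_s (r s * derive1n n b (t - s)).

Let bn n : exists2 B, 0 <= B & forall t, `|derive1n n b t| <= B.
Proof.
have [C hC] := rb.2 n 0%N; exists C; first by apply: le_trans (hC 0); rewrite expr0 mul1r.
by move=> t; have := hC t; rewrite expr0 mul1r.
Qed.

Let mbn n (t : R) : measurable_fun setT (fun s : R => derive1n n b (t - s)).
Proof.
apply: continuous_measurable_fun => s.
apply: (@continuous_comp _ _ _ (fun s : R => t - s) (derive1n n b)).
  by apply: continuousB; [exact: cst_continuous|exact: id].
by apply: derivable_cont; exact: sb.
Qed.

Let ibn n (t : R) : lam.-integrable setT (EFin \o (fun s : R => r s * derive1n n b (t - s))).
Proof.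
have [B B0 hB] := bn n.
apply: (@integrable_le _ _ _ lam _ (fun s => B * (r s * (1 + `|s|) ^+ 0))).
- by apply: measurable_funM => //; exact: mbn.
- exact: integrable_weighted.
- by move=> s; rewrite expr0 mulr1 normrM ger0_norm// mulrC ler_wpM2r.
Qed.

Lemma mollify_derive n (t : R) : is_derive t 1 (mollify n) (mollify n.+1 t).
Proof.
pose f t s := r s * derive1n n b (t - s).
have df (u s : R) : is_derive u 1 (f ^~ s) (r s * derive1n n.+1 b (u - s)).
  have H := @derive1_affine R 1 (- s) (derive1n n b) u (@sb n (1 * u + - s)).
  rewrite !mul1r -derive1nS in H.
  have E : (fun y => derive1n n b (1 * y + - s)) = (fun y => derive1n n b (y - s)).
    by apply/funext => y; rewrite mul1r.
  rewrite E in H.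
  exact: (@is_deriveZ _ _ _ (fun y => derive1n n b (y - s)) (r s) u 1 _ H).
have d1E (u s : R) : partial1of2 f u s = r s * derive1n n.+1 b (u - s).
  by rewrite partial1of2E; apply: derive_val.
have [B B0 hB] := bn n.+1.
pose G s := B * (r s * (1 + `|s|) ^+ 0).
have G0 s : 0 <= G s by rewrite /G expr0 mulr1 mulr_ge0.
have bd (u s : R) : `|partial1of2 f u s| <= G s.
  by rewrite d1E /G expr0 mulr1 normrM ger0_norm// mulrC ler_wpM2r.
have tI : `]t - 1, t + 1[%classic t by rewrite /= in_itv /=; lra.
have der (u s : R) : derivable (f ^~ s) u 1 by apply: ex_derive.
have iG := integrable_weighted 0 B.
have der1 := @derivable_under_integral R _ _ lam f setT measurableT t (t - 1) (t + 1) tI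
  (fun u _ => ibn n u) (fun u s _ _ => der u s) G G0 iG (fun u s _ _ => bd u s).
have der2 := @differentiation_under_integral R _ _ lam f setT measurableT t (t - 1) (t + 1) tI
  (fun u _ => ibn n u) (fun u s _ _ => der u s) G G0 iG (fun u s _ _ => bd u s).
apply: DeriveDef; first exact: der1.
rewrite -derive1E; move: der2; rewrite /mollify /f => ->.
by apply: eq_Rintegral => s _; rewrite d1E.
Qed.

Lemma mollify_derive1n n : derive1n n (mollify 0) = mollify n.
Proof.
elim: n => [//|n IH]; rewrite derive1nS IH; apply/funext => t.
by have := mollify_derive n t => ?; rewrite derive1E; exact: derive_val.
Qed.

Lemma mollify_rapid : rapid (mollify 0).
Proof.
split => [n t|n M].
  by rewrite mollify_derive1n; have := mollify_derive n t => ?; exact: ex_derive.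
have [B B0 hB] := bn n.
exists (\int[lam]_s (B * (5 / 2) ^+ M * (r s * (1 + `|s|) ^+ M))) => t.
have p0 s : 0 <= 1 + `|s| :> R by rewrite addr_ge0.
rewrite mollify_derive1n -[(1 + _) ^+ M]ger0_norm ?exprn_ge0// -normrM -RintegralZl//.
have i1 : lam.-integrable setT (EFin \o (fun s => (1 + `|t|) ^+ M * (r s * derive1n n b (t - s)))).
  exact: integrableZ.
apply: le_trans (le_normr_Rintegral _ i1) _ => //.
apply: le_Rintegral => //.
- exact: integrable_norm.
- exact: integrable_weighted.
- move=> s _; rewrite !normrM (ger0_norm (r0 s)) ger0_norm ?exprn_ge0//.
  have [ts|ts] := ltP (3 / 2) `|t - s|.
    rewrite (supp_derive1n n ub ts) normr0 !mulr0.
    by rewrite !mulr_ge0// exprn_ge0.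
  have h : (1 + `|t|) ^+ M <= (5 / 2) ^+ M * (1 + `|s|) ^+ M.
    rewrite -exprMn; apply: lerXn2r; rewrite ?nnegrE; [exact: p0|by apply: mulr_ge0|].
    have := ler_normD (t - s) s; rewrite subrK; have : 0 <= `|s| by [].
    move: ts; set x := `|_|; set y := `|_|; set z := `|_|; lra.
  rewrite [B * _]mulrC -mulrA [X in _ <= X](_ : _ = ((5 / 2) ^+ M * (1 + `|s|) ^+ M) * (r s * B)); last by ring.
  by apply: ler_pM; rewrite ?exprn_ge0 ?mulr_ge0// ler_wpM2l.
Qed.

Lemma mollify_ge (c t : R) : (forall s, 0 <= b s) -> (forall s, `|s| <= 1 -> b s = 1) ->
  0 <= c -> (forall s, `|t - s| <= 1 -> c <= r s) -> c <= mollify 0 t.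
Proof.
move=> b0 b1 c0 h.
have i0 := ibn 0 t.
rewrite -lee_fin /mollify /Rintegral fineK; last exact: (integrable_fin_num measurableT i0).
have h1 : (\int[lam]_(s in `[(t - 1)%R, (t + 1)%R]) cst c%:E s <=
    \int[lam]_(s in `[(t - 1)%R, (t + 1)%R]) (r s * derive1n 0 b (t - s))%:E)%E.
  apply: ge0_le_integral => //.
  - by apply: measurable_funTS; exact: measurable_int i0.
  - move=> s /=; rewrite in_itv /= => /andP[s1 s2].
    have ts : `|t - s| <= 1 by rewrite ler_norml; lra.
    by rewrite lee_fin b1// mulr1 h.
have h2 : (\int[lam]_(s in `[(t - 1)%R, (t + 1)%R]) (r s * derive1n 0 b (t - s))%:E <=
    \int[lam]_s (r s * derive1n 0 b (t - s))%:E)%E.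
  apply: ge0_subset_integral => //; first exact: measurable_int i0.
  by move=> s _; rewrite lee_fin mulr_ge0.
apply: (le_trans _ (le_trans h1 h2)).
rewrite integral_cst//= lebesgue_measure_itv /= lte_fin ifT; last by lra.
by rewrite -EFinB -EFinM lee_fin; nra.
Qed.

Lemma mollify_ge0 t : (forall s, 0 <= b s) -> 0 <= mollify 0 t.
Proof. by move=> b0; apply: Rintegral_ge0 => s _; rewrite mulr_ge0. Qed.

End mollified.

(** Take r(s) = (1 + |s|)^(-eta(|s|)), where the exponent eta tends to infinity as
    slowly as the thresholds a prescribe, and mollify. Points within distance 1 of t
    satisfy |s| <= |t| + 1, which costs the factor 2. *)
Lemma slow_rapid (b : R -> R) (a : nat -> R) : bump_function b ->
  (forall N, a N <= a N.+1) -> (forall N, N%:R <= a N) ->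
  exists rho : R -> R, [/\ rapid rho, forall t, 0 <= rho t &
    forall N t, `|t| + 1 <= a N -> ((2 * (1 + `|t|)) ^+ N)^-1 <= rho t].
Proof.
move=> hb aS aN.
have ale m n : (m <= n)%N -> a m <= a n.
  by move=> mn; apply: (@homo_leq _ a (fun x y => x <= y)) => //; exact: le_trans.
have ex u : exists N, u <= a N.
  have [N hN] : exists N : nat, u <= N%:R.
    exists (Num.bound `|u|); apply: (le_trans (ler_norm u)); apply: ltW; exact: (archi_boundP (normr_ge0 u)).
  by exists N; exact: le_trans (aN N).
pose eta u := ex_minn (ex u).
have eta1 u : u <= a (eta u) by rewrite /eta; case: ex_minnP.
have eta2 u N : u <= a N -> (eta u <= N)%N by rewrite /eta; case: ex_minnP => m _; exact.
(* eta u is the least N whose threshold a N is at least u. *)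
pose r (s : R) := ((1 + `|s|) ^+ eta `|s|)^-1.
have q1 (s : R) : 1 <= 1 + `|s| by rewrite lerDl.
have q0 (s : R) : 0 < 1 + `|s| by rewrite ltr_pwDl.
have r0 s : 0 <= r s by rewrite invr_ge0 exprn_ge0// ltW.
have mr : measurable_fun setT r.
  pose R0 (u : R) := ((1 + Num.max u 0) ^+ eta u)^-1.
  have -> : r = R0 \o (fun s : R => `|s|).
    by apply/funext => s; rewrite /r /R0 /= max_l.
  apply: measurableT_comp => //; apply: nonincreasing_measurable => // u v uv.
  have m0 (w : R) : 0 <= Num.max w 0 by rewrite le_max lexx orbT.
  rewrite /R0 lef_pV2 ?posrE ?exprn_gt0 ?ltr_pwDl//.
  apply: (@le_trans _ _ ((1 + Num.max v 0) ^+ eta u)).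
    apply: lerXn2r; rewrite ?nnegrE ?addr_ge0// lerD2l.
    by rewrite ge_max !le_max uv lexx !orbT.
  apply: ler_weXn2l; first by rewrite lerDl.
  by apply: eta2; apply: le_trans (eta1 v).
have rd M : exists C, forall s, r s * (1 + `|s|) ^+ M <= C.
  exists ((1 + a M) ^+ M) => s.
  have aM : 0 <= a M by apply: le_trans (aN M).
  (* If eta |s| < M, then |s| <= a M and the left-hand side is bounded by a constant. *)
have [Me|eM] := leqP M (eta `|s|).
    apply: (@le_trans _ _ 1); last by rewrite exprn_ege1// lerDl.
    by rewrite /r mulrC ler_pdivrMr ?exprn_gt0// mul1r ler_weXn2l.
  rewrite -[X in _ <= X]mul1r; apply: ler_pM; [exact: r0|by apply: exprn_ge0; exact: ltW| |].
    by rewrite /r invf_le1 ?exprn_gt0// exprn_ege1.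
  apply: lerXn2r; rewrite ?nnegrE; [exact: ltW|exact: addr_ge0|rewrite lerD2l].
  by apply: (le_trans (eta1 _)); apply: ale; exact: ltnW.
have ub x : 3 / 2 < `|x| -> b x = 0 by move=> /ltW; exact: bump0.
have sb := bump_smooth hb.
exists (mollify r b 0); split.
- exact: mollify_rapid.
- by move=> t; apply: mollify_ge0 => // s; exact: bump_ge0.
move=> N t tN; apply: (mollify_ge mr r0 rd sb ub (bump_ge0 hb) (bump1 hb)).
  by rewrite invr_ge0 exprn_ge0// mulr_ge0// ltW.
move=> s ts.
have st : `|s| <= `|t| + 1.
  have := ler_normD t (s - t); rewrite addrC subrK distrC => h.
  by apply: (le_trans h); rewrite lerD2l.
rewrite /r lef_pV2 ?posrE ?exprn_gt0 ?mulr_gt0//.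
apply: (@le_trans _ _ ((1 + `|s|) ^+ N)).
  by apply: ler_weXn2l => //; apply: eta2; exact: le_trans st tN.
apply: lerXn2r; rewrite ?nnegrE; [exact: ltW|by rewrite mulr_ge0// ltW|].
by have : 0 <= `|t| by []; move: st; set x := `|_|; set y := `|_|; lra.
Qed.

End slow_rapid_functions.

(** * Polynomial growth of functions that represent functionals *)

Section growth.
Context {R : realType} {d : nat}.
Local Notation V := 'rV[R]_d.
Local Notation mu := (@lebesgue_rV R d).
Local Notation normc := ComplexField.Normc.normc.

Definition centered_cube (n : nat) : set V := [set z | forall i, `|z ord0 i| + 1 <= n%:R].

Lemma measurable_centered_cube n : measurable (centered_cube n).
Proof.
rewrite (_ : centered_cube n = \bigcap_(i : 'I_d) ((fun v : V => v ord0 i) @^-1`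
   [set t | `|t| + 1 <= n%:R])); last first.
  by apply/seteqP; split => [v h j _|v h j]; exact: h.
apply: fin_bigcap_measurable => // j _.
rewrite -[X in measurable X]setTI; apply: (@measurable_rV_coord _ R) => //.
rewrite (_ : [set _ | _] = `[(- (n%:R - 1))%R, (n%:R - 1)%R]%classic); first exact: measurable_itv.
apply/seteqP; split => t /=; rewrite in_itv /= -ler_norml; lra.
Qed.

Lemma centered_cube_nd : nondecreasing_seq centered_cube.
Proof.
move=> m n mn; apply/subsetPset => z h i; apply: (le_trans (h i)).
by rewrite ler_nat.
Qed.

Lemma bigcup_centered_cube : \bigcup_n centered_cube n = setT.
Proof.
apply/seteqP; split => // z _.
have h0 : 0 <= \sum_i (`|z ord0 i| + 1) by rewrite sumr_ge0// => i _; rewrite addr_ge0.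
exists (Num.bound (\sum_i (`|z ord0 i| + 1))) => // i.
apply: (le_trans _ (ltW (archi_boundP h0))).
by rewrite (bigD1 i)//= lerDl sumr_ge0// => j _; rewrite addr_ge0.
Qed.

(** If every weighted integral were infinite, one could choose radii a N for which
    the N-th weighted integral over the cube of size a N is large. A Schwartz
    function that dominates the N-th weight on that cube, for each N, then has an
    infinite integral against |g|, which contradicts the integrability of g
    against Schwartz functions. *)
Lemma represents_growth (g : V -> R[i]) T (b : R -> R) : bump_function b ->
  represents g T -> exists N : nat,
  (\int[mu]_z (normc (g z) * decay 1 N%:R 0 z)%:E < +oo)%E.
Proof.
move=> hb [cr ci hg]; apply: contrapT => hn.
have mg := measurable_normc (conj cr ci).
pose F N z := (normc (g z) * decay 1 N%:R 0 z)%:E.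
have F0 N z : (0 <= F N z)%E by rewrite lee_fin mulr_ge0 ?normc_ge0 ?decay_ge0.
have mF N : measurable_fun setT (F N).
  by apply/measurable_EFinP/measurable_funM => //; exact: measurable_decay.
have Foo N : (\int[mu]_z F N z = +oo)%E.
  apply: contrapT => h; apply: hn; exists N.
  by rewrite ltey; apply/eqP.
have ex (N n0 : nat) : exists n : nat, (n0 <= n)%N /\
    ((N%:R * 2 ^+ (N * d))%:E <= \int[mu]_(z in centered_cube n) F N z)%E.
  have := @ge0_nondecreasing_set_cvg_integral _ _ _ centered_cube (F N) mu centered_cube_nd measurable_centered_cube
    (fun i => measurable_funTS (mF N)) (fun i x _ => F0 N x).
  rewrite bigcup_centered_cube Foo => /cvgey_ge h.
  have [m _ hm] := h (N%:R * 2 ^+ (N * d)).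
  exists (maxn n0 m); rewrite leq_maxl; split => //.
  by apply: hm; rewrite /= leq_maxr.
have [sel hsel] : {sel : nat -> nat -> nat | forall N n0, (n0 <= sel N n0)%N /\
    ((N%:R * 2 ^+ (N * d))%:E <= \int[mu]_(z in centered_cube (sel N n0)) F N z)%E}.
  have h N n0 := cid (ex N n0).
  by exists (fun N n0 => projT1 (h N n0)) => N n0; exact: (projT2 (h N n0)).
(* The thresholds must increase, so each radius is selected above the previous one. *)
pose a := fix a (N : nat) : nat := if N is m.+1 then sel m.+1 (a m).+1 else sel 0%N 0%N.
have aS N : (a N < a N.+1)%N by rewrite /=; have [] := hsel N.+1 (a N).+1.
have aN N : (N <= a N)%N by elim: N => // N IH; exact: leq_ltn_trans IH (aS N).
have aI N : ((N%:R * 2 ^+ (N * d))%:E <= \int[mu]_(z in centered_cube (a N)) F N z)%E.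
  by case: N => [|N]; [have [] := hsel 0%N 0%N|have [] := hsel N.+1 (a N).+1].
have [rho [rr r0 hr]] : exists rho : R -> R, [/\ rapid rho, forall t, 0 <= rho t &
    forall N t, `|t| + 1 <= (a N)%:R -> ((2 * (1 + `|t|)) ^+ N)^-1 <= rho t].
  apply: (slow_rapid hb) => N; first by rewrite ler_nat ltnW.
  by rewrite ler_nat.
pose U := @tensorR R d (fun _ => rho).
have U0 z : 0 <= U z by apply: prodr_ge0.
have [[i1 i2] _] := hg _ (schwartz_tensorR (fun _ : 'I_d => rr)).
have mU : measurable_fun setT U.
  by apply: measurable_tensorR => i; apply: continuous_measurable_fun; apply: smooth1_cont; have [] := rr.
have j1 : mu.-integrable setT (EFin \o (fun z => complex.Re (g z) * U z)).
  apply: eq_integrable i1 => // z _ /=; case: (g z) => x y /=.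
  by rewrite mulr0 subr0.
have j2 : mu.-integrable setT (EFin \o (fun z => complex.Im (g z) * U z)).
  apply: eq_integrable i2 => // z _ /=; case: (g z) => x y /=.
  by rewrite mulr0 add0r.
have iU : mu.-integrable setT (EFin \o (fun z => normc (g z) * U z)).
  apply: (@integrable_le _ _ _ mu _ (fun z => `|complex.Re (g z) * U z| + `|complex.Im (g z) * U z|)).
  - exact: measurable_funM.
  - by apply: Rintegrable_add; exact: integrable_norm.
  - move=> z; rewrite !normrM (ger0_norm (normc_ge0 _)) -mulrDl.
    by rewrite ler_wpM2r// normc_le.
have Ifin := integrable_fin_num measurableT iU.
set I := (\int[mu]_z _)%E in Ifin.
(* On the N-th cube, U is at least 2 ^- (N d) times the N-th decay; the radii compensate this. *)
have main N : (N%:R%:E <= I)%E.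
  have h1 : (\int[mu]_(z in centered_cube (a N)) ((2 ^- (N * d))%:E * F N z) <=
      \int[mu]_(z in centered_cube (a N)) (normc (g z) * U z)%:E)%E.
    apply: ge0_le_integral => //.
    - exact: measurable_centered_cube.
    - by move=> z _; apply: mule_ge0 => //; rewrite lee_fin invr_ge0 exprn_ge0.
    - by apply: measurable_funTS; apply: emeasurable_funM => //; exact: measurable_cst.
    - by apply: measurable_funTS; apply: measurable_int iU.
    - move=> z hz; rewrite -EFinM lee_fin mulrCA ler_wpM2l ?normc_ge0//.
      rewrite decay_nat// /U /tensorR /weight.
      have -> : 2 ^- (N * d) = \prod_(i < d) (2 ^- N) :> R.
        by rewrite prodr_const card_ord exprM exprVn.
      rewrite -prodrXl -prodfV -big_split /=; apply: ler_prod => i _.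
      have p0 : 0 <= 1 + 1 * `|(0 : V) ord0 i - z ord0 i| by rewrite addr_ge0// mul1r.
      rewrite -invfM -exprMn; apply/andP; split.
        by rewrite invr_ge0 exprn_ge0// mulr_ge0.
      by apply: (le_trans _ (hr N _ (hz i))); rewrite mul1r mxE sub0r normrN.
  have h2 : (\int[mu]_(z in centered_cube (a N)) (normc (g z) * U z)%:E <= I)%E.
    apply: ge0_subset_integral => //.
    - exact: measurable_centered_cube.
    - exact: measurable_int iU.
    - by move=> z _; rewrite lee_fin mulr_ge0// normc_ge0.
  apply: (le_trans _ (le_trans h1 h2)).
  have kk : (0 <= (2 ^- (N * d) : R)%:E)%E by rewrite lee_fin invr_ge0 exprn_ge0.
  have -> : (\int[mu]_(z in centered_cube (a N)) ((2 ^- (N * d))%:E * F N z) =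
      (2 ^- (N * d))%:E * \int[mu]_(z in centered_cube (a N)) F N z)%E.
    apply: ge0_integralZl => //; first exact: measurable_centered_cube.
    exact: measurable_funTS.
  apply: (@le_trans _ _ ((2 ^- (N * d))%:E * (N%:R * 2 ^+ (N * d))%:E)%E).
    by rewrite -EFinM mulrCA mulVf ?mulr1// expf_neq0.
  by apply: lee_wpmul2l => //; rewrite lee_fin invr_ge0 exprn_ge0.
have I0 : 0 <= fine I by apply: fine_ge0; apply: integral_ge0 => z _; rewrite lee_fin mulr_ge0// normc_ge0.
have := main (Num.bound (fine I)); rewrite -(fineK Ifin) lee_fin => h.
by have := archi_boundP I0; rewrite ltNge h.
Qed.

End growth.

(** * Algebra of the weights *)

Section weights.
Context {R : realType} {d : nat}.
Notation lam := (@lebesgue_measure R).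
Local Notation V := 'rV[R]_d.
Local Notation mu := (@lebesgue_rV R d).
Implicit Types (x y z : V) (kap a b : R).

Lemma weightxx kap x : weight kap x x = 1.
Proof. by rewrite /weight big1// => i _; rewrite subrr normr0 mulr0 addr0. Qed.

Lemma weight_gt0 kap x z : 0 <= kap -> 0 < weight kap x z.
Proof. by move=> k0; rewrite (lt_le_trans ltr01)// weight_ge1. Qed.

(** Peetre's inequality, one coordinate at a time. *)
Lemma weight_tri kap x y z : 0 <= kap -> weight kap x z <= weight kap x y * weight kap y z.
Proof.
move=> k0; rewrite /weight -big_split /=; apply: ler_prod => i _.
rewrite addr_ge0 ?mulr_ge0//=.
have := ler_distD (y ord0 i) (x ord0 i) (z ord0 i).
set A := `|_|; set B := `|_|; set D := `|_| => h.
have B0 : 0 <= B by exact: normr_ge0.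
have D0 : 0 <= D by exact: normr_ge0.
have := mulr_ge0 (mulr_ge0 k0 B0) (mulr_ge0 k0 D0).
have := ler_wpM2l k0 h; rewrite mulrDr; set u := kap * A; set v := kap * B; set w := kap * D.
by move=> *; lra.
Qed.

Lemma weight_le kap kap' x z : 0 <= kap -> kap <= kap' -> weight kap x z <= weight kap' x z.
Proof.
move=> k0 kk; apply: ler_prod => i _; rewrite addr_ge0 ?mulr_ge0//=.
by rewrite lerD2l ler_wpM2r.
Qed.

Lemma decay_gt0 kap a x z : 0 <= kap -> 0 < decay kap a x z.
Proof. by move=> k0; rewrite powR_gt0// weight_gt0. Qed.

Lemma decayxx kap a x : decay kap a x x = 1.
Proof. by rewrite /decay weightxx powR1. Qed.

Lemma decay_le kap a b x z : 0 <= kap -> a <= b -> decay kap b x z <= decay kap a x z.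
Proof. by move=> k0 ab; rewrite /decay ler_powR ?weight_ge1// lerN2. Qed.

Lemma decay_kap kap kap' a x z : 0 <= kap -> kap <= kap' -> 0 <= a ->
  decay kap' a x z <= decay kap a x z.
Proof.
move=> k0 kk a0; have k'0 : 0 <= kap' by exact: le_trans kk.
rewrite /decay !powRN lef_pV2 ?posrE ?powR_gt0 ?weight_gt0//.
by rewrite ge0_ler_powR ?nnegrE ?(ltW (weight_gt0 _ _ _))// weight_le.
Qed.

Lemma decay_tri kap a x y z : 0 <= kap -> 0 <= a ->
  decay kap a x y * decay kap a y z <= decay kap a x z.
Proof.
move=> k0 a0; have w0 u v := ltW (weight_gt0 u v k0).
rewrite /decay -powRM// !powRN lef_pV2 ?posrE ?powR_gt0 ?mulr_gt0 ?weight_gt0//.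
by rewrite ge0_ler_powR ?nnegrE ?mulr_ge0// weight_tri.
Qed.

Lemma decay_powR kap a p x z : (decay kap a x z) `^ p = decay kap (a * p) x z.
Proof. by rewrite /decay -powRrM mulNr. Qed.

Definition decay_mass : R := (\int[lam]_t ((1 + `|t|) ^- 2)) ^+ d.

Lemma decay2_integral kap x : 0 < kap ->
  mu.-integrable setT (EFin \o decay kap 2 x) /\
  \int[mu]_z decay kap 2 x z = kap ^- d * decay_mass.
Proof.
move=> k0; have [io _] := @integral_oneDsqr R.
have p0 (t : R) : 0 < 1 + `|t| by rewrite ltr_pwDl.
have fi : lam.-integrable setT (EFin \o (fun t : R => (1 + `|t|) ^- 2)).
  apply: (@integrable_le _ _ _ lam _ (fun t => (oneDsqr t)^-1)) => //.
  - rewrite (_ : (fun t => _) = (fun t : R => (1 + `|t|) `^ (- 2%:R))); last first.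
      by apply/funext => t; rewrite powRN powR_mulrn// ltW.
    apply: (measurableT_comp (measurable_powR (- 2%:R))).
    apply: continuous_measurable_fun => t.
    by apply: continuousD; [exact: cst_continuous|exact: norm_continuous].
  - move=> t; rewrite ger0_norm ?invr_ge0 ?exprn_ge0 ?(ltW (p0 _))//.
    by rewrite lef_pV2 ?posrE ?exprn_gt0 ?oneDsqr_gt0// le_oneDsqr.
have E : decay kap 2%:R x = profile (fun t : R => (1 + `|t|) ^- 2) kap x.
  apply/funext => z; rewrite (decay_nat 2 x z (ltW k0)).
  rewrite /weight /profile /tensorR -prodrXl -prodfV; apply: eq_bigr => i _.
  by rewrite -mulrBr normrM (gtr0_norm k0) distrC.
by rewrite E; exact: integral_profile.
Qed.

Lemma decay_mass_ge0 : 0 <= decay_mass.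
Proof. by apply: exprn_ge0; apply: Rintegral_ge0 => t _; rewrite invr_ge0 exprn_ge0// addr_ge0. Qed.

End weights.

(** * Plancherel-Polya inequalities *)

Section plancherel_polya.
Context {R : realType} {d : nat}.
Local Notation V := 'rV[R]_d.
Local Notation mu := (@lebesgue_rV R d).
(** G stands for the modulus of a piece, kap for 2 ^ k, and H is the reproducing
    inequality. *)
Variables (G : V -> R) (kap : R) (C : nat -> R).
Hypotheses (mG : measurable_fun setT G) (G0 : forall z, 0 <= G z) (kap1 : 1 <= kap)
  (C0 : forall L, 0 < C L)
  (H : forall L x, ((G x)%:E <= (C L * kap ^+ d)%:E *
     \int[mu]_z (G z * decay kap L%:R x z)%:E)%E).

Definition wmean (a p : R) (x : V) : \bar R :=
  ((kap ^+ d)%:E * \int[mu]_z (G z `^ p * decay kap a x z)%:E)%E.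

Let k0 : 0 <= kap. Proof. exact: le_trans kap1. Qed.
Let kd0 : 0 <= kap ^+ d. Proof. exact: exprn_ge0. Qed.

Let mpow p : measurable_fun setT (fun z => G z `^ p).
Proof. exact: (measurableT_comp (measurable_powR p)). Qed.

Let mint a p x : measurable_fun setT (fun z => (G z `^ p * decay kap a x z)%:E).
Proof.
apply/measurable_EFinP/measurable_funM; first exact: mpow.
exact: measurable_decay.
Qed.

Let int_ge0 a p x : (0 <= \int[mu]_z (G z `^ p * decay kap a x z)%:E)%E.
Proof. by apply: integral_ge0 => z _; rewrite lee_fin mulr_ge0 ?powR_ge0 ?decay_ge0. Qed.

Lemma wmean_ge0 a p x : (0 <= wmean a p x)%E.
Proof. by apply: mule_ge0. Qed.

Lemma wmean_le a b p x : a <= b -> (wmean b p x <= wmean a p x)%E.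
Proof.
move=> ab; apply: lee_wpmul2l; first by rewrite lee_fin.
apply: ge0_le_integral => //.
- by move=> z _; rewrite lee_fin mulr_ge0 ?powR_ge0 ?decay_ge0.
- by move=> z _; rewrite lee_fin ler_wpM2l ?powR_ge0// decay_le.
Qed.

Lemma scaled_integral_le (t c : R) (g1 g2 : V -> R) :
  measurable_fun setT g1 -> measurable_fun setT g2 -> 0 <= t -> 0 <= c ->
  (forall z, 0 <= g1 z) -> (forall z, 0 <= g2 z) -> (forall z, t * g1 z <= c * g2 z) ->
  (t%:E * \int[mu]_z (g1 z)%:E <= c%:E * \int[mu]_z (g2 z)%:E)%E.
Proof.
move=> m1 m2 t0 c0 g10 g20 h.
rewrite -!ge0_integralZl//; try (by move=> z _; rewrite lee_fin); try exact/measurable_EFinP.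
apply: ge0_le_integral => //.
- by move=> z _; rewrite -EFinM lee_fin mulr_ge0.
- by apply: measurable_funeM; exact/measurable_EFinP.
- by apply: measurable_funeM; exact/measurable_EFinP.
- by move=> z _; rewrite -!EFinM lee_fin.
Qed.

Lemma powR_split (t p : R) : 0 <= t -> t != 0 -> t = t `^ (1 - p) * t `^ p.
Proof. by move=> t0 tn; rewrite -powRD ?subrK ?powRr1// tn implybT. Qed.

(** Let S be the supremum of G(y) against the decay around x. Writing
    G = G^(1-p) G^p in the reproducing inequality bounds S by S^(1-p) times the
    weighted mean of G^p, and S, being finite, can be cancelled. *)
Lemma maximal_bound (p : R) (N : nat) (x : V) (M : R) : 0 < p <= 1 ->
  (forall y, G y * decay kap N%:R x y <= M) ->
  ((G x `^ p)%:E <= (C N)%:E * wmean (N%:R * p) p x)%E.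
Proof.
move=> /andP[p0 p1] hM.
pose A := range (fun y => G y * decay kap N%:R x y).
have hA : has_sup A.
  by split; [exists (G x * decay kap N%:R x x); exists x|exists M => _ [y _ <-]].
pose S := sup A.
have hS y : G y * decay kap N%:R x y <= S by apply: (ub_le_sup hA.2); exists y.
have GS : G x <= S by have := hS x; rewrite decayxx mulr1.
have S0 : 0 <= S by exact: le_trans GS.
have [S00|Sn0] := eqVneq S 0.
  have -> : G x = 0 by apply/eqP; rewrite eq_le G0 -S00 GS.
  rewrite powR0 ?gt_eqF//; apply: mule_ge0; [by rewrite lee_fin ltW|exact: wmean_ge0].
have {}S0 : 0 < S by rewrite lt_neqAle eq_sym Sn0.
have := wmean_ge0 (N%:R * p) p x.
case EJ : (wmean (N%:R * p) p x) => [j||]// j0; last by rewrite gt0_muley ?leey// lte_fin.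
rewrite lee_fin in j0.
have key y : G y * decay kap N%:R x y <= C N * (S `^ (1 - p) * j).
  rewrite -lee_fin mulrA [X in (_ <= X)%E]EFinM -EJ /wmean muleA -EFinM.
  apply: (@le_trans _ _ ((decay kap N%:R x y * (C N * kap ^+ d))%:E *
     \int[mu]_z (G z * decay kap N%:R y z)%:E)%E).
    rewrite mulrC EFinM [X in (_ <= X * _)%E]EFinM -muleA.
    by apply: lee_wpmul2l; [rewrite lee_fin decay_ge0|exact: H].
  apply: scaled_integral_le.
  - by apply: measurable_funM => //; exact: measurable_decay.
  - by apply: measurable_funM; [exact: mpow|exact: measurable_decay].
  - by rewrite !mulr_ge0 ?decay_ge0// ltW.
  - by rewrite !mulr_ge0 ?powR_ge0// ltW.
  - by move=> z; rewrite mulr_ge0 ?decay_ge0.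
  - by move=> z; rewrite mulr_ge0 ?powR_ge0 ?decay_ge0.
  - move=> z.
    have h1 : G z * (decay kap N%:R x y * decay kap N%:R y z) <= G z * decay kap N%:R x z.
      by rewrite ler_wpM2l// decay_tri.
    have h2 : G z * decay kap N%:R x z <= S `^ (1 - p) * (G z `^ p * decay kap (N%:R * p) x z).
      have t0 : 0 <= G z * decay kap N%:R x z by rewrite mulr_ge0 ?decay_ge0.
      rewrite -decay_powR -powRM ?decay_ge0//.
      have [->|tn0] := eqVneq (G z * decay kap N%:R x z) 0; first by rewrite mulr_ge0 ?powR_ge0.
      rewrite {1}(powR_split p t0 tn0).
      apply: ler_wpM2r; first exact: powR_ge0.
      by rewrite ge0_ler_powR ?nnegrE ?subr_ge0 ?(ltW S0).
    rewrite (_ : _ * _ * _ = C N * kap ^+ d * (G z * (decay kap N%:R x y * decay kap N%:R y z))); last by ring.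
    rewrite [X in _ <= X](_ : _ = C N * kap ^+ d * (S `^ (1 - p) * (G z `^ p * decay kap (N%:R * p) x z))); last by ring.
    by rewrite ler_wpM2l ?mulr_ge0 ?(ltW (C0 _))// (le_trans h1).
have SS : S <= C N * (S `^ (1 - p) * j).
  by apply: (ge_sup hA.1) => _ [y _ <-]; exact: key.
rewrite -EFinM lee_fin; apply: (@le_trans _ _ (S `^ p)).
  by rewrite ge0_ler_powR ?nnegrE ?(ltW p0) ?(ltW S0).
have Sp : 0 < S `^ (1 - p) by rewrite powR_gt0.
rewrite -(ler_pM2l Sp) mulrCA; apply: le_trans SS.
by rewrite -powR_split ?(ltW S0) ?gt_eqF.
Qed.

(** Integrability against a weight becomes pointwise growth by the reproducing
    inequality. *)
Lemma polynomial_growth : (exists N : nat, (\int[mu]_z (G z * decay 1 N%:R 0 z)%:E < +oo)%E) ->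
  exists N0 : nat, forall N, (N0 <= N)%N -> forall x, exists M, forall y,
    G y * decay kap N%:R x y <= M.
Proof.
move=> [N0 hN0]; exists N0 => N NN x.
set I := (\int[mu]_z _)%E in hN0.
have I0 : (0 <= I)%E by apply: integral_ge0 => z _; rewrite lee_fin mulr_ge0 ?decay_ge0.
have If : I \is a fin_num by rewrite ge0_fin_numE.
have w0 : 0 < decay 1 N0%:R 0 x by exact: decay_gt0.
exists (C N0 * kap ^+ d / decay 1 N0%:R 0 x * fine I) => y.
apply: (@le_trans _ _ (G y * decay kap N0%:R x y)).
  by rewrite ler_wpM2l// decay_le// ler_nat.
rewrite -lee_fin [X in (_ <= X)%E]EFinM fineK//.
apply: (@le_trans _ _ ((decay kap N0%:R x y * (C N0 * kap ^+ d))%:E *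
     \int[mu]_z (G z * decay kap N0%:R y z)%:E)%E).
  rewrite mulrC EFinM [X in (_ <= X * _)%E]EFinM -muleA.
  by apply: lee_wpmul2l; [rewrite lee_fin decay_ge0|exact: H].
apply: scaled_integral_le.
- by apply: measurable_funM => //; exact: measurable_decay.
- by apply: measurable_funM => //; exact: measurable_decay.
- by rewrite !mulr_ge0 ?decay_ge0// ltW.
- by rewrite !mulr_ge0 ?invr_ge0// ltW.
- by move=> z; rewrite mulr_ge0 ?decay_ge0.
- by move=> z; rewrite mulr_ge0 ?decay_ge0.
- move=> z.
  have h1 : decay kap N0%:R x y * decay kap N0%:R y z <= decay 1 N0%:R 0 z / decay 1 N0%:R 0 x.
    rewrite ler_pdivlMr//; apply: (@le_trans _ _ (decay 1 N0%:R 0 x * decay 1 N0%:R x z)).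
      rewrite mulrC ler_wpM2l ?(ltW w0)//.
      by apply: (le_trans (decay_tri _ _ _ _ _)) => //; exact: decay_kap.
    exact: decay_tri.
  rewrite (_ : _ * _ * _ = C N0 * kap ^+ d * G z * (decay kap N0%:R x y * decay kap N0%:R y z)); last by ring.
  rewrite [X in _ <= X](_ : _ = C N0 * kap ^+ d * G z * (decay 1 N0%:R 0 z / decay 1 N0%:R 0 x)); last by ring.
  by rewrite ler_wpM2l ?mulr_ge0 ?(ltW (C0 _)).
Qed.

(** The supremum in maximal_bound is known to be finite only for large N. The
    estimate obtained for such an N0 shows that, when the weighted mean at N is
    finite, so is the supremum at N, and maximal_bound applies again with N. *)
Lemma plancherel_polya_le1 (p : R) (N : nat) (x : V) : 0 < p <= 1 ->
  (exists N : nat, (\int[mu]_z (G z * decay 1 N%:R 0 z)%:E < +oo)%E) ->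
  ((G x `^ p)%:E <= (C N)%:E * wmean (N%:R * p) p x)%E.
Proof.
move=> hp /polynomial_growth[N1 hN1]; have /andP[p0 p1] := hp.
have := wmean_ge0 (N%:R * p) p x.
case EJ : (wmean (N%:R * p) p x) => [j||]// j0; last by rewrite gt0_muley ?leey// lte_fin.
rewrite lee_fin in j0; rewrite -EJ.
pose N0 := maxn N N1.
have b1 y : ((G y `^ p)%:E <= (C N0)%:E * wmean (N0%:R * p) p y)%E.
  by have [M hM] := hN1 N0 (leq_maxr _ _) y; exact: maximal_bound hM.
have Cj0 : 0 <= C N0 * j by rewrite mulr_ge0// ltW.
apply: (@maximal_bound p N x ((C N0 * j) `^ p^-1)) => // y.
have t0 : 0 <= G y * decay kap N%:R x y by rewrite mulr_ge0 ?decay_ge0.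
rewrite -(powRr1 t0) -[X in _ `^ X <= _](mulfV (lt0r_neq0 p0)) powRrM.
rewrite ge0_ler_powR ?nnegrE ?invr_ge0 ?powR_ge0 ?(ltW p0)//.
rewrite powRM ?decay_ge0// decay_powR -lee_fin [X in (_ <= X)%E]EFinM -EJ /wmean muleA -EFinM.
apply: (@le_trans _ _ ((decay kap (N%:R * p) x y * (C N0 * kap ^+ d))%:E *
     \int[mu]_z (G z `^ p * decay kap (N0%:R * p) y z)%:E)%E).
  rewrite [G y `^ p * _]mulrC EFinM [X in (_ <= X * _)%E]EFinM -muleA.
  apply: lee_wpmul2l; first by rewrite lee_fin decay_ge0.
  by rewrite EFinM -muleA; exact: b1.
apply: scaled_integral_le.
- by apply: measurable_funM; [exact: mpow|exact: measurable_decay].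
- by apply: measurable_funM; [exact: mpow|exact: measurable_decay].
- by rewrite !mulr_ge0 ?decay_ge0// ltW.
- by rewrite !mulr_ge0// ltW.
- by move=> z; rewrite mulr_ge0 ?powR_ge0 ?decay_ge0.
- by move=> z; rewrite mulr_ge0 ?powR_ge0 ?decay_ge0.
- move=> z.
  have h1 : decay kap (N%:R * p) x y * decay kap (N0%:R * p) y z <= decay kap (N%:R * p) x z.
    apply: (@le_trans _ _ (decay kap (N%:R * p) x y * decay kap (N%:R * p) y z)).
      by rewrite ler_wpM2l ?decay_ge0// decay_le// ler_pM2r// ler_nat leq_maxl.
    by apply: decay_tri => //; rewrite mulr_ge0// ltW.
  rewrite (_ : _ * _ * _ = C N0 * kap ^+ d * G z `^ p * (decay kap (N%:R * p) x y * decay kap (N0%:R * p) y z)); last by ring.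
  rewrite [X in _ <= X]mulrA.
  by rewrite ler_wpM2l ?mulr_ge0 ?powR_ge0 ?(ltW (C0 _)).
Qed.

(** For every lam > 0, G <= lam^(1-p) G^p + lam, and the second term has a finite
    weighted integral. The choice of lam^p as the weighted mean of G^p balances the
    two terms; e is added because that mean may vanish. *)
Lemma plancherel_polya_ge1 (p : R) (L : nat) (x : V) : 1 <= p -> (2 <= L)%N ->
  ((G x `^ p)%:E <= ((C L * (1 + @decay_mass R d)) `^ p)%:E * wmean L%:R p x)%E.
Proof.
move=> p1 L2; have p0 : 0 < p by exact: lt_le_trans p1.
have k1 : 0 < kap by exact: lt_le_trans kap1.
set c0 := decay_mass; have c00 : 0 <= c0 by exact: decay_mass_ge0.
have D0 : 0 < C L * (1 + c0) by rewrite mulr_gt0// ltr_pwDl.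
have Dp : 0 < (C L * (1 + c0)) `^ p by rewrite powR_gt0.
have := wmean_ge0 L%:R p x.
case EJ : (wmean L%:R p x) => [j||]// j0; last by rewrite gt0_muley ?leey// lte_fin.
rewrite lee_fin in j0.
apply/lee_addgt0Pr => e e0.
pose lam := (j + e / (C L * (1 + c0)) `^ p) `^ p^-1.
have je0 : 0 < j + e / (C L * (1 + c0)) `^ p by rewrite ltr_wpDl// divr_gt0.
have lam0 : 0 < lam by rewrite powR_gt0.
have lamp : lam `^ p = j + e / (C L * (1 + c0)) `^ p.
  by rewrite -powRrM mulVf ?gt_eqF// powRr1// ltW.
suff hG : G x <= C L * (1 + c0) * lam.
  rewrite -EFinM -EFinD lee_fin.
  apply: (@le_trans _ _ ((C L * (1 + c0) * lam) `^ p)).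
    by rewrite ge0_ler_powR ?nnegrE ?mulr_ge0 ?(ltW p0) ?(ltW D0) ?(ltW lam0) ?(ltW (C0 _))// addr_ge0.
  rewrite powRM ?(ltW D0) ?(ltW lam0)// lamp mulrDr lerD2l.
  by rewrite mulrCA divff ?mulr1 ?gt_eqF.
have young z : G z <= lam `^ (1 - p) * G z `^ p + lam.
  (* The term lam alone suffices if G z <= lam, the other one if G z > lam. *)
  have [Gl|lG] := leP (G z) lam; first by rewrite (le_trans Gl)// lerDr mulr_ge0 ?powR_ge0.
  have Gz : 0 < G z by exact: lt_trans lG.
  apply: (@le_trans _ _ (lam `^ (1 - p) * G z `^ p)); last by rewrite lerDl ltW.
  rewrite {1}(powR_split p (ltW Gz)) ?gt_eqF//.
  apply: ler_wpM2r; first exact: powR_ge0.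
  rewrite -(opprB p 1) !powRN lef_pV2 ?posrE ?powR_gt0//.
  by rewrite ge0_ler_powR ?nnegrE ?subr_ge0 ?(ltW Gz) ?(ltW lam0)// ltW.
have [i2 e2] := @decay2_integral R d kap x k1.
rewrite -lee_fin; apply: (le_trans (H L x)).
apply: (@le_trans _ _ ((C L * kap ^+ d)%:E * (\int[mu]_z (lam `^ (1 - p) * (G z `^ p * decay kap L%:R x z))%:E
     + \int[mu]_z (lam * decay kap 2 x z)%:E))%E).
  apply: lee_wpmul2l; first by rewrite lee_fin mulr_ge0// ltW.
  rewrite -ge0_integralD//; last 4 first.
  - by move=> z _; rewrite lee_fin !mulr_ge0 ?powR_ge0 ?decay_ge0.
  - apply/measurable_EFinP; apply: measurable_funM; first exact: measurable_cst.
    by apply: measurable_funM; [exact: mpow|exact: measurable_decay].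
  - by move=> z _; rewrite lee_fin mulr_ge0 ?decay_ge0// ltW.
  - by apply/measurable_EFinP; apply: measurable_funM; [exact: measurable_cst|exact: measurable_decay].
  apply: ge0_le_integral => //.
  - by move=> z _; rewrite lee_fin mulr_ge0 ?decay_ge0.
  - by apply/measurable_EFinP; apply: measurable_funM => //; exact: measurable_decay.
  - apply/measurable_EFinP; apply: measurable_funD.
      apply: measurable_funM; first exact: measurable_cst.
      by apply: measurable_funM; [exact: mpow|exact: measurable_decay].
    by apply: measurable_funM; [exact: measurable_cst|exact: measurable_decay].
  - move=> z _; rewrite -EFinD lee_fin.
    apply: (@le_trans _ _ ((lam `^ (1 - p) * G z `^ p + lam) * decay kap L%:R x z)).
      by rewrite ler_wpM2r ?decay_ge0.
    rewrite mulrDl -mulrA lerD2l ler_wpM2l ?(ltW lam0)//.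
    by apply: decay_le => //; rewrite ler_nat.
have -> : (\int[mu]_z (lam `^ (1 - p) * (G z `^ p * decay kap L%:R x z))%:E =
    (lam `^ (1 - p))%:E * \int[mu]_z (G z `^ p * decay kap L%:R x z)%:E)%E.
  under eq_integral do rewrite EFinM.
  apply: ge0_integralZl => //; last by rewrite lee_fin powR_ge0.
  by move=> z _; rewrite lee_fin mulr_ge0 ?powR_ge0 ?decay_ge0.
have -> : (\int[mu]_z (lam * decay kap 2 x z)%:E = (lam * (kap ^- d * c0))%:E)%E.
  rewrite -e2 -RintegralZl// /Rintegral fineK//.
  exact: (integrable_fin_num measurableT (integrableZ lam i2)).
have -> : (\int[mu]_z (G z `^ p * decay kap L%:R x z)%:E = (kap ^- d * j)%:E)%E.
  rewrite EFinM -EJ /wmean muleA -EFinM mulVf ?mul1e// expf_neq0// gt_eqF//.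
rewrite -!EFinM lee_fin.
have kk : kap ^+ d * kap ^- d = 1 by rewrite mulfV// expf_neq0// gt_eqF.
rewrite (_ : C L * kap ^+ d * _ = C L * (kap ^+ d * kap ^- d) * (lam `^ (1 - p) * j + lam * c0)); last by ring.
rewrite kk mulr1 -mulrA ler_pM2l// mulrDl mul1r [c0 * _]mulrC lerD2r.
apply: (@le_trans _ _ (lam `^ (1 - p) * lam `^ p)).
  by rewrite ler_wpM2l ?powR_ge0// lamp lerDl divr_ge0// ltW.
by rewrite -powR_split ?(ltW lam0) ?gt_eqF.
Qed.

End plancherel_polya.

(** * The Plancherel-Polya inequality for the pieces of a functional *)

Section local_pp.
Context {R : realType} {d : nat}.
Local Notation V := 'rV[R]_d.
Local Notation mu := (@lebesgue_rV R d).
Local Notation normc := ComplexField.Normc.normc.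

(** The default value of xget is the zero function, for which every estimate below
    is trivial. *)
Lemma lp_fun_cases (theta0 : V -> R[i]) f k :
  represents (lp_fun theta0 f k) (lp_dist theta0 f k) \/ lp_fun theta0 f k = (fun=> 0).
Proof.
rewrite /lp_fun; case: xgetP => [y _ h|h]; first by left.
by right.
Qed.

Lemma lp_fun_continuous (theta0 : V -> R[i]) f k : ccontinuous (lp_fun theta0 f k).
Proof.
have [[]//|->] := lp_fun_cases theta0 f k.
by split => /=; exact: cst_continuous.
Qed.

Lemma lp_fun_plancherel_polya (theta0 : V -> R[i]) (p a : R) : (0 < d)%N -> resolution_generator theta0 ->
  0 < p -> 0 <= a -> exists2 K : R, 0 < K & forall f k x,
  (((normc (lp_fun theta0 f k x)) `^ p)%:E <=
    K%:E * ((2 ^+ k) ^+ d)%:E *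
      \int[mu]_z (normc (lp_fun theta0 f k z) `^ p * decay (2 ^+ k) a x z)%:E)%E.
Proof.
move=> hd hth p0 a0.
have [C' [C'0 hC']] := reproducing_bound hd hth.
pose C L := C' L + 1.
have C0 L : 0 < C L by rewrite ltr_wpDl.
have [b hb] := bump_theta (Ordinal hd) hth.
have kap1 k : 1 <= 2 ^+ k :> R by rewrite exprn_ege1// ler1n.
have [N hN] : exists N : nat, a <= N%:R * p.
  exists (Num.bound (a / p)); rewrite -ler_pdivrMr//.
  by apply: ltW; apply: archi_boundP; rewrite divr_ge0// ltW.
have [L L2 hL] : exists2 L : nat, (2 <= L)%N & a <= L%:R.
  exists (maxn 2 (Num.bound a)); first exact: leq_maxl.
  apply: (le_trans (ltW (archi_boundP a0))); by rewrite ler_nat leq_maxr.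
pose K := Num.max (C N) ((C L * (1 + @decay_mass R d)) `^ p).
have K0 : 0 < K by rewrite lt_max C0.
exists K => // f k x.
have [hg|->] := lp_fun_cases theta0 f k; last first.
  rewrite normc_sqrtE /= expr0n /= addr0 sqrtr0 powR0 ?gt_eqF//.
  apply: mule_ge0; last by apply: integral_ge0 => z _; rewrite lee_fin mulr_ge0 ?powR_ge0 ?decay_ge0.
  by rewrite -EFinM lee_fin mulr_ge0 ?exprn_ge0 ?(ltW K0).
set g := lp_fun theta0 f k in hg *.
have [cr ci _] := hg; have mg := measurable_normc (conj cr ci).
pose G z := normc (g z).
have G0 z : 0 <= G z by exact: normc_ge0.
have kd : 0 <= (2 ^+ k) ^+ d :> R by rewrite !exprn_ge0.
have H M y : ((G y)%:E <= (C M * (2 ^+ k) ^+ d)%:E *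
     \int[mu]_z (G z * decay (2 ^+ k) M%:R y z)%:E)%E.
  apply: (le_trans (hC' k f g hg M y)); apply: lee_wpmul2r.
    by apply: integral_ge0 => z _; rewrite lee_fin; apply: mulr_ge0; [exact: G0|exact: decay_ge0].
  by rewrite lee_fin ler_wpM2r// lerDl.
rewrite -muleA -[X in (_ <= K%:E * X)%E]/(wmean G (2 ^+ k) a p x).
have [p1|p1] := leP p 1.
  apply: (le_trans (@plancherel_polya_le1 _ _ G (2 ^+ k) C mg G0 (kap1 k) C0 H p N x _ _)).
  - by rewrite p0.
  - exact: represents_growth hb hg.
  apply: lee_pmul.
  - by rewrite lee_fin ltW.
  - by apply: wmean_ge0.
  - by rewrite lee_fin le_max lexx.
  - exact: wmean_le.
apply: (le_trans (@plancherel_polya_ge1 _ _ G (2 ^+ k) C mg G0 (kap1 k) C0 H p L x (ltW p1) L2)).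
apply: lee_pmul.
- by rewrite lee_fin powR_ge0.
- by apply: wmean_ge0.
- by rewrite lee_fin le_max lexx orbT.
- exact: wmean_le.
Qed.

End local_pp.

(** * Dyadic cubes and their translates *)

Section dyadic.
Context {R : realType} {d : nat}.
Local Notation V := 'rV[R]_d.
Local Notation Z := 'rV[int]_d.
Local Notation mu := (@lebesgue_rV R d).

Lemma dyadic_side_gt0 (j : int) : 0 < dyadic_side j :> R.
Proof. by rewrite exprz_gt0. Qed.

Lemma measurable_dyadic_cube j (n : Z) : measurable (dyadic_cube j n : set V).
Proof.
rewrite (_ : dyadic_cube j n = \bigcap_(i : 'I_d) ((fun v : V => v ord0 i) @^-1`
   `[dyadic_side j * (n ord0 i)%:~R, dyadic_side j * ((n ord0 i)%:~R + 1)[%classic)); last first.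
  by apply/seteqP; split => [v h i _|v h i]; have := h i; rewrite /= in_itv /= => H; apply: H.
apply: fin_bigcap_measurable => // i _.
rewrite -[X in measurable X]setTI; apply: (@measurable_rV_coord _ R) => //.
Qed.

Lemma dyadic_cube_cover j (x : V) : exists n : Z, dyadic_cube j n x.
Proof.
have s0 := dyadic_side_gt0 j.
exists (\row_i Num.floor (x ord0 i / dyadic_side j)) => i; rewrite mxE.
have := floor_le (x ord0 i / dyadic_side j); have := floorD1_gt (x ord0 i / dyadic_side j).
rewrite ltr_pdivrMr// ler_pdivlMr// intrD => h1 h2.
by rewrite mulrC h2 mulrC h1.
Qed.

Lemma dyadic_cube_inj j (n n' : Z) (x : V) : dyadic_cube j n x -> dyadic_cube j n' x -> n = n'.
Proof.
have s0 := dyadic_side_gt0 j.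
move=> h h'; apply/rowP => i.
have /andP[h1 h2] := h i; have /andP[h1' h2'] := h' i.
have H (a b : int) : dyadic_side j * a%:~R <= x ord0 i -> x ord0 i < dyadic_side j * (b%:~R + 1) -> (a <= b)%R.
  move=> ha hb; have := le_lt_trans ha hb; rewrite ltr_pM2l//.
  by rewrite -[1]/(1%:~R) -intrD ltr_int ltzD1.
by apply/eqP; rewrite eq_le !H.
Qed.

(** The growth in m that is tolerated for the mass of the m-th translate. *)
Definition shift_weight (m : Z) : R := \prod_i (1 + `|(m ord0 i)%:~R|).

Lemma shift_weight_ge1 m : 1 <= shift_weight m.
Proof.
rewrite /shift_weight; elim: (index_enum _) => [|i s IH]; first by rewrite big_nil.
rewrite big_cons; apply: (@le_trans _ _ (1 * 1)); first by rewrite mulr1.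
by apply: ler_pM => //; rewrite lerDl.
Qed.

(** The shifts are enumerated by natural numbers, so that countable additivity can
    be used; numbers that encode no shift contribute the empty set. *)
Definition translate (j : int) (n : Z) (i : nat) : set V :=
  if pickle_inv i is Some m then dyadic_cube j (n + m) else set0.

Lemma measurable_translate j n i : measurable (translate j n i).
Proof. by rewrite /translate; case: pickle_inv => [m|//]; exact: measurable_dyadic_cube. Qed.

Lemma trivIset_translate j n : trivIset setT (translate j n).
Proof.
move=> i i' _ _ [x []]; rewrite /translate.
case E : (pickle_inv i) => [m|//]; case E' : (pickle_inv i') => [m'|//] h h'.
have /addrI mm := dyadic_cube_inj h h'.
have := @pickle_invK Z i; have := @pickle_invK Z i'; rewrite E E' /= mm => -> <-//.
Qed.

Lemma bigcup_translate j n : \bigcup_i translate j n i = setT.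
Proof.
apply/seteqP; split => // x _; have [m hm] := dyadic_cube_cover j x.
by exists (pickle (m - n)) => //; rewrite /translate pickleK_inv addrC subrK.
Qed.

Lemma integral_translates (F : V -> R) j n : measurable_fun setT F -> (forall z, 0 <= F z) ->
  (\int[mu]_z (F z)%:E = \sum_(i <oo) \int[mu]_(z in translate j n i) (F z)%:E)%E.
Proof.
move=> mF F0; rewrite -(bigcup_translate j n) ge0_integral_bigcup//.
- exact: measurable_translate.
- by rewrite bigcup_translate; exact/measurable_EFinP.
- by move=> x _; rewrite lee_fin.
- exact: trivIset_translate.
Qed.

End dyadic.

Section cube_sums.
Context {R : realType} {d : nat}.
Local Notation V := 'rV[R]_d.
Local Notation Z := 'rV[int]_d.
Local Notation mu := (@lebesgue_rV R d).

Lemma shift_weight_gt0 (m : Z) : 0 < shift_weight m :> R.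
Proof. exact: lt_le_trans (shift_weight_ge1 m). Qed.

Lemma shift_weight0 : shift_weight (0 : Z) = 1 :> R.
Proof. by rewrite /shift_weight big1// => i _; rewrite mxE normr0 addr0. Qed.

(** The inverse square of shift_weight, in the enumeration of translate. *)
Definition summable_weight (i : nat) : R := if pickle_inv i is Some m then (@shift_weight R d m) ^- 2 else 0.

Lemma summable_weight_ge0 i : 0 <= summable_weight i.
Proof. by rewrite /summable_weight; case: pickle_inv => // m; rewrite invr_ge0 exprn_ge0// ltW// shift_weight_gt0. Qed.

Lemma mu_unit_cube (n : Z) : mu (dyadic_cube 0 n) = 1%E.
Proof.
have -> : dyadic_cube 0 n = [set v : V | forall i, `[(n ord0 i)%:~R, (n ord0 i)%:~R + 1[%classic (v ord0 i)].
  by apply/seteqP; split => v h i; have := h i; rewrite /= in_itv /= /dyadic_side oppr0 expr0z !mul1r.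
pose A (i : 'I_d) : set R := `[(n ord0 i)%:~R, (n ord0 i)%:~R + 1[%classic.
have mA i : measurable (A i) by exact: measurable_itv.
apply: (etrans (lebesgue_rV_box mA)).
rewrite big1// => i _.
by rewrite /A lebesgue_measure_itv /= lte_fin ltrDl ltr01 -EFinB addrAC subrr add0r.
Qed.

(** Comparison with an integral: the unit cubes tile the space, and the decay is
    bounded below on the m-th of them by a multiple of shift_weight m ^- 2. *)
Lemma sum_summable_weight_fin : (\sum_(i <oo) (summable_weight i)%:E < +oo)%E.
Proof.
have [iw _] := @decay2_integral R d 1 0 ltr01.
have mw := @measurable_decay R d 1 2 0.
have w0 z : 0 <= @decay R d 1 2 0 z by exact: decay_ge0.
have iwfin : (\int[mu]_z (decay 1 2 0 z)%:E < +oo)%E.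
  by have /integrableP[_] := iw; under eq_integral do rewrite /= ger0_norm//.
pose c : R := (2 ^+ d) ^+ 2.
have c0 : 0 < c by rewrite !exprn_gt0.
apply: (@le_lt_trans _ _ (c%:E * \int[mu]_z (decay 1 2 0 z)%:E)%E); last first.
  by apply: lte_mul_pinfty => //; rewrite lee_fin ltW.
rewrite (integral_translates 0 0 mw w0) -nneseriesZl; last first.
  by move=> i _; apply: integral_ge0 => z _; rewrite lee_fin.
apply: lee_nneseries => [i _ _|i _]; first by rewrite lee_fin summable_weight_ge0.
rewrite /summable_weight /translate; case: pickle_inv => [m|]; last by rewrite integral_set0 mule0.
rewrite add0r.
have o0 := shift_weight_gt0 m.
apply: (@le_trans _ _ (c%:E * \int[mu]_(z in dyadic_cube 0 m) cst ((2 ^+ d * shift_weight m) ^- 2)%:E z)%E).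
  set r := (2 ^+ d * shift_weight m) ^- 2.
  have -> : (\int[mu]_(z in dyadic_cube 0 m) cst r%:E z = r%:E)%E.
    apply: (etrans (integral_cst mu (measurable_dyadic_cube 0 m) r%:E)).
    by apply: (etrans (congr1 (fun t => r%:E * t)%E (mu_unit_cube m))); rewrite mule1.
  rewrite -EFinM lee_fin /r exprMn (invfM _ (shift_weight m ^+ 2)) -/c mulrA.
  by rewrite mulfV ?mul1r// gt_eqF.
apply: lee_wpmul2l; first by rewrite lee_fin ltW.
apply: ge0_le_integral => //.
- exact: measurable_dyadic_cube.
- by move=> z _; rewrite lee_fin invr_ge0 exprn_ge0// mulr_ge0 ?exprn_ge0// ltW.
- by apply: measurable_funTS; exact/measurable_EFinP.
- move=> z hz; rewrite lee_fin decay_nat// lef_pV2 ?posrE ?exprn_gt0 ?mulr_gt0 ?weight_gt0 ?exprn_gt0//.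
  apply: lerXn2r; rewrite ?nnegrE; [exact/ltW/weight_gt0|by rewrite mulr_ge0 ?exprn_ge0// ltW|].
  have -> : 2 ^+ d = \prod_(i < d) 2 :> R by rewrite prodr_const card_ord.
  rewrite /weight /shift_weight -big_split /=; apply: ler_prod => l _.
  rewrite addr_ge0 ?mulr_ge0//= mul1r mxE sub0r normrN.
  have := hz l; rewrite /dyadic_side oppr0 expr0z !mul1r => /andP[h1 h2].
  have h3 : `|z ord0 l| <= `|(m ord0 l)%:~R| + 1.
    rewrite -(subrK (m ord0 l)%:~R (z ord0 l)) addrC (le_trans (ler_normD _ _))// lerD2l.
    by rewrite ger0_norm; lra.
  by have : 0 <= `|(m ord0 l)%:~R| :> R by []; move: h3; set A := `|_|; set B := `|_|; lra.
Qed.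

Definition total_weight : R := fine (\sum_(i <oo) (summable_weight i)%:E)%E.

Lemma total_weightE : (\sum_(i <oo) (summable_weight i)%:E = total_weight%:E)%E.
Proof.
rewrite /total_weight fineK// ge0_fin_numE ?sum_summable_weight_fin//.
by apply: nneseries_ge0 => i _ _; rewrite lee_fin summable_weight_ge0.
Qed.

Lemma total_weight_gt0 : 0 < total_weight.
Proof.
rewrite -lte_fin -total_weightE.
have h : (\sum_(0 <= i < (pickle (0%R : Z)).+1) (summable_weight i)%:E <= \sum_(i <oo) (summable_weight i)%:E)%E.
  by apply: nneseries_lim_ge => i _ _; rewrite lee_fin summable_weight_ge0.
apply: (lt_le_trans _ h).
rewrite big_nat_recr//= {2}/summable_weight pickleK_inv shift_weight0 expr1n invr1.
rewrite sumEFin -EFinD lte_fin ltr_wpDl//.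
by apply: sumr_ge0 => i _; exact: summable_weight_ge0.
Qed.

(** If m_i is nonzero, the i-th coordinates of x and z differ by at least
    (|m_i| - 1) times the side. *)
Lemma decay_cube kap a (j : int) (n m : Z) (x z : V) : 0 <= a -> 0 <= kap ->
  1 <= kap * dyadic_side j -> dyadic_cube j n x -> dyadic_cube j (n + m) z ->
  decay kap a x z <= (2 ^+ d) `^ a * (shift_weight m) `^ (- a).
Proof.
move=> a0 k0 ks hx hz.
have o0 := shift_weight_gt0 m.
have h : shift_weight m <= 2 ^+ d * weight kap x z.
  have -> : 2 ^+ d = \prod_(i < d) 2 :> R by rewrite prodr_const card_ord.
  rewrite /weight /shift_weight -big_split /=; apply: ler_prod => i _.
  rewrite addr_ge0//=.
  have s0 := @dyadic_side_gt0 R j.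
  set w := `|x ord0 i - z ord0 i|.
  have w0 : 0 <= w by exact: normr_ge0.
  have [->|mi] := eqVneq (m ord0 i) 0.
    by rewrite normr0 addr0; have := mulr_ge0 k0 w0; set u := kap * w; lra.
  have hw : dyadic_side j * (`|(m ord0 i)%:~R| - 1) <= w.
    have := hx i; have := hz i; rewrite mxE intrD.
    set M : R := (m ord0 i)%:~R; set N : R := (n ord0 i)%:~R; set s := dyadic_side j in s0 *.
    rewrite /w; set X := x ord0 i; set Y := z ord0 i.
    rewrite !mulrDr !mulr1 => /andP[h1 h2] /andP[h3 h4].
    have [M0|M0] := leP 0 M.
      rewrite (ger0_norm M0) distrC; apply: (le_trans _ (ler_norm _)).
      by move: h1 h2 h3 h4; set p := s * N; set q := s * M; lra.
    rewrite (ltr0_norm M0); apply: (le_trans _ (ler_norm _)).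
    rewrite mulrN mulrN1.
    by move: h1 h2 h3 h4; set p := s * N; set q := s * M; lra.
  have M1 : 1 <= `|(m ord0 i)%:~R| :> R.
    by rewrite -intr_norm -[1]/(1%:~R) ler_int -gtz0_ge1 normr_gt0.
  have h5 : `|(m ord0 i)%:~R| - 1 <= kap * w.
    apply: (le_trans _ (ler_wpM2l k0 hw)); rewrite mulrA.
    by rewrite ler_peMl// subr_ge0.
  by move: M1 h5; set A := `|_|; set B := kap * w; lra.
have w0 := @weight_gt0 R d kap x z k0.
rewrite /decay !powRN -[(2 ^+ d) `^ a]invrK -invfM lef_pV2 ?posrE ?mulr_gt0 ?invr_gt0 ?powR_gt0 ?exprn_gt0//.
rewrite ler_pdivrMl ?powR_gt0 ?exprn_gt0// -powRM ?exprn_ge0 ?(ltW w0)//.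
by rewrite ge0_ler_powR ?nnegrE ?mulr_ge0 ?exprn_ge0 ?(ltW w0) ?(ltW o0).
Qed.

(** The exponent b + 2 beats the growth of the masses and leaves the summable
    weights. *)
Lemma integral_decay_cube (F : V -> R) kap b y (j : int) (n : Z) (x : V) :
  measurable_fun setT F -> (forall z, 0 <= F z) -> 0 <= kap ->
  1 <= kap * dyadic_side j -> 0 <= b -> 0 <= y -> dyadic_cube j n x ->
  (forall m, (\int[mu]_(z in dyadic_cube j (n + m)) (F z)%:E <= (y * (shift_weight m) `^ b)%:E)%E) ->
  (\int[mu]_z (F z * decay kap (b + 2) x z)%:E <= ((2 ^+ d) `^ (b + 2) * y * total_weight)%:E)%E.
Proof.
move=> mF F0 k0 ks b0 y0 hx hy.
have mFw : measurable_fun setT (fun z => F z * decay kap (b + 2) x z).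
  by apply: measurable_funM => //; exact: measurable_decay.
have Fw0 z : 0 <= F z * decay kap (b + 2) x z by rewrite mulr_ge0 ?decay_ge0.
rewrite (integral_translates j n mFw Fw0).
have b2 : 0 <= b + 2 by rewrite addr_ge0.
set K := (2 ^+ d) `^ (b + 2).
have K0 : 0 <= K by exact: powR_ge0.
rewrite EFinM -total_weightE -nneseriesZl; last by move=> i _; rewrite lee_fin summable_weight_ge0.
apply: lee_nneseries => [i _ _|i _]; first by apply: integral_ge0 => z _; rewrite lee_fin.
rewrite /translate /summable_weight; case: pickle_inv => [m|]; last by rewrite integral_set0 mule0.
have o0 := shift_weight_gt0 m.
apply: (@le_trans _ _ (\int[mu]_(z in dyadic_cube j (n + m)) ((K * (shift_weight m) `^ (- (b + 2)))%:E * (F z)%:E))%E).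
  apply: ge0_le_integral => //.
  - exact: measurable_dyadic_cube.
  - by move=> z _; rewrite lee_fin.
  - by apply: measurable_funTS; exact/measurable_EFinP.
  - by apply: measurable_funTS; apply: measurable_funeM; exact/measurable_EFinP.
  - move=> z hz; rewrite -EFinM lee_fin mulrC ler_wpM2r//.
    exact: (decay_cube b2 k0 ks hx hz).
rewrite ge0_integralZl//.
- rewrite -EFinM; apply: (@le_trans _ _ ((K * (shift_weight m) `^ (- (b + 2)))%:E * (y * shift_weight m `^ b)%:E)%E).
    by apply: lee_wpmul2l; [rewrite lee_fin mulr_ge0 ?powR_ge0|exact: hy].
  rewrite -EFinM lee_fin.
  rewrite (_ : K * _ * _ = K * y * (shift_weight m `^ (- (b + 2)) * shift_weight m `^ b)); last by ring.
  rewrite ler_wpM2l ?mulr_ge0// -powRD; last by rewrite (gt_eqF o0) implybT.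
  by rewrite opprD addrAC addNr add0r powRN powR_mulrn// ltW.
- exact: measurable_dyadic_cube.
- by apply: measurable_funTS; exact/measurable_EFinP.
- by move=> z _; rewrite lee_fin.
- by rewrite lee_fin mulr_ge0 ?powR_ge0.
Qed.

End cube_sums.

(** * Nikolskii inequality on dyadic cubes *)

Section nikolskii.
Context {R : realType} {d : nat}.
Local Notation V := 'rV[R]_d.
Local Notation Z := 'rV[int]_d.
Local Notation mu := (@lebesgue_rV R d).
Local Notation normc := ComplexField.Normc.normc.
Variables (theta0 : V -> R[i]).
Hypotheses (hd : (0 < d)%N) (hth : resolution_generator theta0).

Lemma weighted_lpE s f k (x : V) :
  weighted_lp theta0 s f k x = 2 `^ (k%:R * s) * normc (lp_fun theta0 f k x).
Proof.
rewrite /weighted_lp ComplexField.Normc.normcM; congr (_ * _).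
by rewrite normc_real ger0_norm// powR_ge0.
Qed.

Lemma weighted_lp_ge0 s f k (x : V) : 0 <= weighted_lp theta0 s f k x.
Proof. by rewrite weighted_lpE mulr_ge0 ?powR_ge0// normc_ge0. Qed.

Lemma measurable_weighted_lp s f k : measurable_fun setT (fun x : V => weighted_lp theta0 s f k x).
Proof.
under eq_fun do rewrite weighted_lpE.
apply: measurable_funM; first exact: measurable_cst.
exact: measurable_normc (lp_fun_continuous _ _ _).
Qed.

Lemma measurable_weighted_lp_powR s f k p :
  measurable_fun setT (fun x : V => weighted_lp theta0 s f k x `^ p).
Proof. exact: (measurableT_comp (measurable_powR p) (measurable_weighted_lp _ _ _)). Qed.

Lemma weighted_lp_shift s1 s2 f k (x : V) :
  weighted_lp theta0 s2 f k x = 2 `^ (k%:R * (s2 - s1)) * weighted_lp theta0 s1 f k x.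
Proof.
rewrite !weighted_lpE mulrA -powRD; last by rewrite pnatr_eq0 implybT.
by rewrite -mulrDr subrK.
Qed.

(** The Plancherel-Polya inequality with an exponent large enough to sum the masses
    of all translates. *)
Lemma sup_on_cube (p b : R) : 0 < p -> 0 <= b -> exists2 K : R, 0 < K &
  forall f s (k : nat) (j : int) (n : Z) (y : R) (x : V), (j <= k%:Z)%R -> 0 <= y ->
  (forall m, (\int[mu]_(z in dyadic_cube j (n + m)) ((weighted_lp theta0 s f k z) `^ p)%:E
     <= (y * (shift_weight m) `^ b)%:E)%E) -> dyadic_cube j n x ->
  weighted_lp theta0 s f k x `^ p <= K * (2 ^+ k) ^+ d * y.
Proof.
move=> p0 b0; have b2 : 0 <= b + 2 by rewrite addr_ge0.
have [K K0 hK] := lp_fun_plancherel_polya hd hth p0 b2.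
have S0 := @total_weight_gt0 R d.
pose K' := K * ((2 ^+ d) `^ (b + 2) * @total_weight R d).
have K'0 : 0 < K' by rewrite !mulr_gt0 ?powR_gt0 ?exprn_gt0.
exists K' => // f s k j n y x jk y0 hy hx.
pose F z := weighted_lp theta0 s f k z `^ p.
have mF : measurable_fun setT F by exact: measurable_weighted_lp_powR.
have F0 z : 0 <= F z by exact: powR_ge0.
have kap0 : 0 <= 2 ^+ k :> R by rewrite exprn_ge0.
have ks : 1 <= 2 ^+ k * dyadic_side j :> R.
  rewrite /dyadic_side exprnP -expfzDr// -[1](expr0z 2) ler_eXz2l ?ltr1n// subr_ge0//.
have h1 := integral_decay_cube mF F0 kap0 ks b0 y0 hx hy.
rewrite -lee_fin.
pose t := (2 `^ (k%:R * s)) `^ p.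
have FE z : F z = t * normc (lp_fun theta0 f k z) `^ p.
  by rewrite /F weighted_lpE powRM ?powR_ge0 ?normc_ge0.
have t0 : 0 <= t by exact: powR_ge0.
have kd0 : 0 <= (2 ^+ k) ^+ d :> R by rewrite exprn_ge0.
have mG : measurable_fun setT (fun z : V => normc (lp_fun theta0 f k z) `^ p).
  exact: (measurableT_comp (measurable_powR p) (measurable_normc (lp_fun_continuous _ _ _))).
rewrite -/(F x) FE EFinM.
apply: (le_trans (lee_wpmul2l _ (hK f k x))); first by rewrite lee_fin.
rewrite -EFinM muleCA.
apply: (@le_trans _ _ ((K * (2 ^+ k) ^+ d)%:E * ((2 ^+ d) `^ (b + 2) * y * @total_weight R d)%:E)%E).
  apply: lee_wpmul2l; first by rewrite lee_fin mulr_ge0// ltW.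
  apply: (le_trans _ h1).
  apply: (le_trans (@scaled_integral_le R d t 1 _ (fun z => F z * decay (2 ^+ k) (b + 2) x z) _ _ _ _ _ _ _)) => //.
  - by apply: measurable_funM => //; exact: measurable_decay.
  - by apply: measurable_funM => //; exact: measurable_decay.
  - by move=> z; rewrite mulr_ge0 ?powR_ge0 ?decay_ge0.
  - by move=> z; rewrite mulr_ge0 ?decay_ge0.
  - by move=> z; rewrite mul1r FE mulrA.
  - by rewrite mul1e.
rewrite -EFinM lee_fin /K' le_eqVlt; apply/orP; left; apply/eqP; ring.
Qed.

(** The power p2 of the piece splits as p2 - p1 and p1: the first factor is bounded
    by the supremum on the cube, the second one is integrated. The powers of 2 ^ k
    cancel because s1 - d / p1 = s2 - d / p2. *)
Lemma nikolskii_cube (s1 s2 p1 p2 b : R) : 0 < p1 -> p1 < p2 ->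
  s1 - d%:R / p1 = s2 - d%:R / p2 -> 0 <= b -> exists2 K : R, 0 < K &
  forall f (k : nat) (j : int) (n : Z) (y : R), (j <= k%:Z)%R -> 0 <= y ->
  (forall m, (\int[mu]_(z in dyadic_cube j (n + m)) ((weighted_lp theta0 s1 f k z) `^ p1)%:E
     <= (y * (shift_weight m) `^ b)%:E)%E) ->
  (\int[mu]_(z in dyadic_cube j n) ((weighted_lp theta0 s2 f k z) `^ p2)%:E
     <= (K * y `^ (p2 / p1))%:E)%E.
Proof.
move=> p10 p12 hs b0; have p20 : 0 < p2 by exact: lt_trans p12.
have [K K0 hK] := sup_on_cube p10 b0.
pose e := (p2 - p1) / p1.
have e0 : 0 < e by rewrite divr_gt0// subr_gt0.
exists (K `^ e); first by rewrite powR_gt0.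
move=> f k j n y jk y0 hy.
pose w1 z := weighted_lp theta0 s1 f k z.
have w10 z : 0 <= w1 z by exact: weighted_lp_ge0.
pose c := 2 `^ (k%:R * (s2 - s1)) `^ p2 * (K * (2 ^+ k) ^+ d * y) `^ e.
have c0 : 0 <= c by rewrite mulr_ge0 ?powR_ge0.
have mw := measurable_weighted_lp_powR s1 f k p1.
have step : (\int[mu]_(z in dyadic_cube j n) ((weighted_lp theta0 s2 f k z) `^ p2)%:E <=
    \int[mu]_(z in dyadic_cube j n) (c%:E * ((w1 z) `^ p1)%:E))%E.
  apply: ge0_le_integral => //.
  - exact: measurable_dyadic_cube.
  - by move=> z _; rewrite lee_fin powR_ge0.
  - by apply: measurable_funTS; apply/measurable_EFinP; exact: measurable_weighted_lp_powR.
  - by apply: measurable_funTS; apply: measurable_funeM; exact/measurable_EFinP.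
  - move=> z hz; rewrite -EFinM lee_fin (weighted_lp_shift s1) powRM ?powR_ge0 ?weighted_lp_ge0//.
    rewrite -mulrA ler_wpM2l ?powR_ge0// -/(w1 z).
    have -> : p2 = p1 * e + p1 by rewrite /e mulrC divfK ?subrK// gt_eqF.
    rewrite powRD; last first.
      apply/implyP => /eqP h; exfalso.
      by have := mulr_gt0 p10 e0; have := p10; set u := p1 * e in h *; lra.
    rewrite ler_wpM2r ?powR_ge0// powRrM ge0_ler_powR ?nnegrE ?powR_ge0 ?(ltW e0)//.
      by rewrite !mulr_ge0 ?exprn_ge0// ltW.
    exact: hK jk y0 hy hz.
apply: (le_trans step).
have -> : (\int[mu]_(z in dyadic_cube j n) (c%:E * ((w1 z) `^ p1)%:E) =
    c%:E * \int[mu]_(z in dyadic_cube j n) ((w1 z) `^ p1)%:E)%E.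
  apply: ge0_integralZl => //.
  - exact: measurable_dyadic_cube.
  - by apply: measurable_funTS; exact/measurable_EFinP.
  - by move=> z _; rewrite lee_fin powR_ge0.
have h0 : (\int[mu]_(z in dyadic_cube j n) ((w1 z) `^ p1)%:E <= y%:E)%E.
  by have := hy 0; rewrite addr0 shift_weight0 powR1 mulr1.
have cE : (0 <= c%:E)%E by rewrite lee_fin.
apply: (le_trans (lee_wpmul2l cE h0)).
rewrite -EFinM lee_fin le_eqVlt; apply/orP; left; apply/eqP.
have kd0 : 0 <= (2 ^+ k) ^+ d :> R by rewrite !exprn_ge0.
have E1 : 2 `^ (k%:R * (s2 - s1)) `^ p2 * ((2 ^+ k) ^+ d) `^ e = 1 :> R.
  rewrite -(powR_mulrn d) ?exprn_ge0// -(powR_mulrn k) ?ler0n// -!powRrM.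
  rewrite -powRD; last by rewrite pnatr_eq0 implybT.
  rewrite (_ : _ + _ = 0) ?powRr0//.
  have -> : s2 - s1 = d%:R / p2 - d%:R / p1 by lra.
  by rewrite /e; field; rewrite !gt_eqF.
have E3 : y `^ e * y = y `^ (p2 / p1).
  have -> : p2 / p1 = e + 1 by rewrite /e; field; rewrite gt_eqF.
  rewrite powRD ?powRr1//; apply/implyP => /eqP h; exfalso.
  by move: h; have := e0; lra.
rewrite -E3 /c !powRM ?mulr_ge0 ?(ltW K0)//.
rewrite [LHS](_ : _ = (2 `^ (k%:R * (s2 - s1)) `^ p2 * ((2 ^+ k) ^+ d) `^ e) * (K `^ e * (y `^ e * y))); last by ring.
by rewrite E1 mul1r.
Qed.

End nikolskii.

(** * Powers of extended reals *)

Section ereal_powers.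
Context {R : realType}.
Implicit Types x y : \bar R.

Lemma le_poweR x y (r : R) : 0 <= r -> (0 <= x)%E -> (x <= y)%E -> (x `^ r <= y `^ r)%E.
Proof.
move=> r0 x0 xy; apply: gt0_ler_poweR => //; rewrite in_itv /= leey andbT//.
exact: le_trans xy.
Qed.

Lemma poweR_inv_le x (y p : R) : 0 < p -> (0 <= x)%E -> 0 <= y ->
  (x `^ p^-1 <= y%:E)%E = (x <= (y `^ p)%:E)%E.
Proof.
move=> p0 x0 y0; apply/idP/idP => h.
  have := le_poweR (ltW p0) (poweR_ge0 _ _) h.
  by rewrite -poweRrM mulVf ?gt_eqF// poweRe1.
have pV : 0 <= p^-1 by rewrite invr_ge0 ltW.
have := le_poweR pV x0 h.
by rewrite poweR_EFin -powRrM mulfV ?gt_eqF// powRr1.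
Qed.

Lemma poweR_le_inv x (y p : R) : 0 < p -> (0 <= x)%E ->
  (x `^ p <= y%:E)%E -> (x <= (y `^ p^-1)%:E)%E.
Proof.
move=> p0 x0 h; have pV : 0 <= p^-1 by rewrite invr_ge0 ltW.
have := le_poweR pV (poweR_ge0 _ _) h.
by rewrite -poweRrM mulfV ?gt_eqF// poweRe1.
Qed.

Lemma lq_tail_inv_le (q y : R) m (a : nat -> \bar R) : 0 < q -> 0 <= y ->
  (lq_tail q%:E m a <= y%:E)%E = (\sum_(m <= k <oo) a k `^ q <= (y `^ q)%:E)%E.
Proof.
move=> q0 y0; rewrite /lq_tail poweR_inv_le//.
by apply: nneseries_ge0 => k _ _; exact: poweR_ge0.
Qed.

Lemma nneseries_term_le m (u : nat -> \bar R) k : (m <= k)%N -> (forall i, 0 <= u i)%E ->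
  (u k <= \sum_(m <= i <oo) u i)%E.
Proof.
move=> mk u0; apply: (le_trans _ (@nneseries_lim_ge R u xpredT m k.+1 (fun i _ _ => u0 i))).
by rewrite big_nat_recr//= leeDr// sume_ge0.
Qed.

End ereal_powers.

(** * The B spaces *)

Section besov.
Context {R : realType} {d : nat}.
Local Notation V := 'rV[R]_d.
Local Notation Z := 'rV[int]_d.
Local Notation mu := (@lebesgue_rV R d).
Variables (theta0 : V -> R[i]).
Hypotheses (hd : (0 < d)%N) (hth : resolution_generator theta0).
Variables (s1 s2 p1 p2 : R).
Hypotheses (p10 : 0 < p1) (p12 : p1 < p2) (hs : s1 - d%:R / p1 = s2 - d%:R / p2).

Definition cube_mass (s p : R) f (j : int) (n : Z) (k : nat) : \bar R :=
  (\int[mu]_(x in dyadic_cube j n) ((weighted_lp theta0 s f k x) `^ p)%:E)%E.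

Lemma cube_mass_ge0 s p f j n k : (0 <= cube_mass s p f j n k)%E.
Proof. by apply: integral_ge0 => x _; rewrite lee_fin powR_ge0. Qed.

(** For fixed k let T k be the sum over all translates of their q-th power
    contributions, with summable weights. Each contribution is at most T k divided
    by its weight, which has the form required by nikolskii_cube, and the latter
    returns a multiple of T k after the power q / p2. The sum of T over k is finite because the weights are
    summable and all translates obey the same bound. *)
Lemma besov_cube_fin (q : R) : 0 < q -> exists2 K : R, 0 < K &
  forall f (j : int) (n : Z) (J : nat) (B : R), (j <= J%:Z)%R -> 0 <= B ->
  (forall m, lq_tail q%:E J (fun k => cube_mass s1 p1 f j (n + m) k `^ p1^-1) <= B%:E)%E ->
  (lq_tail q%:E J (fun k => cube_mass s2 p2 f j n k `^ p2^-1) <= (K * B)%:E)%E.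
Proof.
move=> q0; have p20 : 0 < p2 by exact: lt_trans p12.
(* The exponent for which T k * shift_weight m ^+ 2, to the power p1 / q, grows like shift_weight m `^ b. *)
pose b := 2 * (p1 / q).
have b0 : 0 <= b by rewrite mulr_ge0// divr_ge0// ltW.
have [K K0 hK] := nikolskii_cube hd hth p10 p12 hs b0.
have S0 := @total_weight_gt0 R d.
exists (K `^ p2^-1 * (@total_weight R d) `^ q^-1); first by rewrite mulr_gt0 ?powR_gt0.
move=> f j n J B jJ B0 hB.
pose S (m : Z) k := ((cube_mass s1 p1 f j (n + m) k `^ p1^-1) `^ q)%E.
have S_ge0 m k : (0 <= S m k)%E by exact: poweR_ge0.
have hS m : (\sum_(J <= k <oo) S m k <= (B `^ q)%:E)%E.
  by rewrite -lq_tail_inv_le.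
pose W i k : \bar R := if @pickle_inv Z i is Some m then ((shift_weight m ^- 2)%:E * S m k)%E else 0%E.
have W0 i k : (0 <= W i k)%E.
  rewrite /W; case: pickle_inv => // m; rewrite mule_ge0// lee_fin invr_ge0 exprn_ge0//.
  exact/ltW/shift_weight_gt0.
pose T k := (\sum_(i <oo) W i k)%E.
have T0 k : (0 <= T k)%E by apply: nneseries_ge0 => i _ _; exact: W0.
have hT : (\sum_(J <= k <oo) T k <= (@total_weight R d * B `^ q)%:E)%E.
  rewrite eseries_cond [leLHS](nneseries_interchange _ _ (fun k i => W0 i k)).
  rewrite mulrC EFinM -total_weightE -nneseriesZl; last by move=> i _; rewrite lee_fin summable_weight_ge0.
  apply: lee_nneseries => [i _ _|i _]; first by apply: nneseries_ge0 => k _ _; exact: W0.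
  rewrite -eseries_cond /W /summable_weight; case: pickle_inv => [m|]; last first.
    by rewrite eseries0// mule0.
  rewrite nneseriesZl// muleC; apply: lee_wpmul2r => //.
  by rewrite lee_fin invr_ge0 exprn_ge0// ltW// shift_weight_gt0.
have SB0 : 0 <= @total_weight R d * B `^ q by rewrite mulr_ge0 ?powR_ge0// ltW.
have Tfin k : (J <= k)%N -> T k = (fine (T k))%:E.
  move=> Jk; rewrite fineK// ge0_fin_numE//.
  by apply: (le_lt_trans (nneseries_term_le Jk T0)); apply: (le_lt_trans hT); rewrite ltry.
rewrite lq_tail_inv_le// ?mulr_ge0 ?powR_ge0//.
apply: (@le_trans _ _ ((K `^ (q / p2))%:E * \sum_(J <= k <oo) T k)%E); last first.
  apply: (le_trans (lee_wpmul2l _ hT)); first by rewrite lee_fin powR_ge0.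
  rewrite -EFinM lee_fin -mulrA !powRM ?mulr_ge0 ?powR_ge0 ?(ltW S0)//.
  by rewrite -!powRrM mulVf ?gt_eqF// powRr1 ?(ltW S0)// [p2^-1 * q]mulrC.
rewrite -nneseriesZl; last by move=> k _; exact: T0.
rewrite eseries_cond [leRHS]eseries_cond.
apply: lee_nneseries => [k _ _|k]; first exact: poweR_ge0.
move=> /andP[_ Jk].
set t := fine (T k); have t0 : 0 <= t by exact: fine_ge0.
have jk : (j <= k%:Z)%R by apply: (le_trans jJ); rewrite lez_nat.
have key m : (cube_mass s1 p1 f j (n + m) k <= (t `^ (p1 / q) * shift_weight m `^ b)%:E)%E.
  have o0 := @shift_weight_gt0 R d m.
  have h1 : ((shift_weight m ^- 2)%:E * S m k <= t%:E)%E.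
    rewrite -Tfin//; have := @nneseries_term_le R 0 (fun i => W i k) (pickle m) isT (fun i => W0 i k).
    by rewrite {1}/W pickleK_inv.
  have h2 : (S m k <= (t * shift_weight m ^+ 2)%:E)%E.
    by rewrite mulrC EFinM -lee_pdivrMl// exprn_gt0.
  have := poweR_le_inv q0 (poweR_ge0 _ _) h2.
  rewrite poweR_inv_le ?powR_ge0 ?cube_mass_ge0// => h3.
  apply: (le_trans h3); rewrite lee_fin -powRrM powRM ?exprn_ge0 ?(ltW o0)//.
  by rewrite -(powR_mulrn 2) ?(ltW o0)// -powRrM [q^-1 * p1]mulrC.
have := hK f k j n (t `^ (p1 / q)) jk (powR_ge0 _ _) key.
rewrite -/(cube_mass s2 p2 f j n k) => h.
have p2V : 0 <= p2^-1 by rewrite invr_ge0 ltW.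
have := le_poweR (ltW q0) (poweR_ge0 _ _) (le_poweR p2V (cube_mass_ge0 _ _ _ _ _ _) h).
move/le_trans; apply.
rewrite Tfin// -/t -EFinM !poweR_EFin lee_fin.
rewrite !powRM ?powR_ge0 ?(ltW K0)// -!powRrM [p2^-1 * q]mulrC.
rewrite (_ : p1 / q * _ = 1) ?powRr1//.
by field; rewrite !gt_eqF.
Qed.

Lemma besov_cube_infty : exists2 K : R, 0 < K &
  forall f (j : int) (n : Z) (J : nat) (B : R), (j <= J%:Z)%R -> 0 <= B ->
  (forall m, lq_tail (+oo)%E J (fun k => cube_mass s1 p1 f j (n + m) k `^ p1^-1) <= B%:E)%E ->
  (lq_tail (+oo)%E J (fun k => cube_mass s2 p2 f j n k `^ p2^-1) <= (K * B)%:E)%E.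
Proof.
have p20 : 0 < p2 by exact: lt_trans p12.
have [K K0 hK] := nikolskii_cube hd hth p10 p12 hs (lexx 0).
exists (K `^ p2^-1); first by rewrite powR_gt0.
move=> f j n J B jJ B0 hB; apply: ub_ereal_sup => _ [k /= Jk <-].
have jk : (j <= k%:Z)%R by apply: (le_trans jJ); rewrite lez_nat.
have key m : (cube_mass s1 p1 f j (n + m) k <= (B `^ p1 * shift_weight m `^ 0)%:E)%E.
  rewrite powRr0 mulr1 -poweR_inv_le ?cube_mass_ge0//.
  by apply: (le_trans _ (hB m)); apply: ereal_sup_ubound; exists k.
have := hK f k j n (B `^ p1) jk (powR_ge0 _ _) key.
rewrite -/(cube_mass s2 p2 f j n k) poweR_inv_le ?cube_mass_ge0 ?mulr_ge0 ?powR_ge0//.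
move/le_trans; apply; rewrite lee_fin powRM ?powR_ge0// -!powRrM mulVf ?gt_eqF// powRr1 ?(ltW K0)//.
by rewrite mulrCA mulfV ?gt_eqF// mulr1.
Qed.

Lemma besov_bound (q : \bar R) (phi : R -> R) : (0 < q)%E -> (forall t, 0 < t -> 0 < phi t) ->
  exists2 K : R, 0 < K & forall f (A : R), 0 < A ->
  (B_norm theta0 s1 p1 q phi f <= A%:E)%E -> (B_norm theta0 s2 p2 q phi f <= (K * A)%:E)%E.
Proof.
move=> q0 phi0.
have [K K0 hK] : exists2 K : R, 0 < K &
  forall f (j : int) (n : Z) (J : nat) (B : R), (j <= J%:Z)%R -> 0 <= B ->
  (forall m, lq_tail q J (fun k => cube_mass s1 p1 f j (n + m) k `^ p1^-1) <= B%:E)%E ->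
  (lq_tail q J (fun k => cube_mass s2 p2 f j n k `^ p2^-1) <= (K * B)%:E)%E.
  case: q q0 => [q|_|//]; last exact: besov_cube_infty.
  by rewrite lte_fin; exact: besov_cube_fin.
exists K => // f A A0 hA; apply: ub_ereal_sup => _ [[j n] _ <-] /=.
have s0 := @dyadic_side_gt0 R j; have ph0 := phi0 _ s0.
rewrite lee_pdivrMl// -EFinM mulrCA.
apply: hK => [||m].
- by rewrite gez0_abs le_max lexx ?orbT.
- by rewrite mulr_ge0// ltW.
- rewrite EFinM -lee_pdivrMl//; apply: (le_trans _ hA).
  by apply: ereal_sup_ubound; exists (j, n + m).
Qed.

End besov.

(** * Sequences below two geometric sequences *)

Section interpolation.
Context {R : realType}.

Lemma lq_tail_ge (r : \bar R) m (a : nat -> \bar R) k : (0 < r)%E -> (forall i, 0 <= a i)%E ->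
  (m <= k)%N -> (a k <= lq_tail r m a)%E.
Proof.
move=> r0 a0 mk; case: r r0 => [r|_|//] /=; last first.
  by apply: ereal_sup_ubound; exists k.
rewrite lte_fin => r0; have rV : 0 <= r^-1 by rewrite invr_ge0 ltW.
have := le_poweR rV (poweR_ge0 _ _) (@nneseries_term_le _ m (fun i => a i `^ r)%E k mk (fun i => poweR_ge0 _ _)).
by rewrite -poweRrM mulfV ?gt_eqF// poweRe1.
Qed.

(** The smaller of s and 1 / s is controlled by an increment of the bounded function
    s / (1 + s) along a geometric progression. Sums of such minima then telescope,
    with a bound that does not depend on the starting point. *)
Lemma peak_telescope (rho s : R) : 1 < rho -> 0 < s ->
  (if s <= 1 then s else s^-1) <=
  2 * (1 + rho) / (rho - 1) * (rho * s / (1 + rho * s) - s / (1 + s)).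
Proof.
move=> rho1 s0; have rho0 : 0 < rho by exact: lt_trans rho1.
have r1 : 0 < rho - 1 by rewrite subr_gt0.
have a0 : 0 < 1 + s by rewrite addr_gt0.
have b0 : 0 < 1 + rho * s by rewrite addr_gt0// mulr_gt0.
have -> : 2 * (1 + rho) / (rho - 1) * (rho * s / (1 + rho * s) - s / (1 + s)) =
    2 * (1 + rho) * s / ((1 + rho * s) * (1 + s)).
  by field; rewrite !gt_eqF.
rewrite ler_pdivlMr ?mulr_gt0//; have [s1|s1] := leP s 1.
  rewrite mulrC ler_wpM2r ?(ltW s0)//.
  rewrite mulrC; apply: ler_pM; rewrite ?(ltW a0) ?(ltW b0)//; first by lra.
  by rewrite lerD2l// ler_piMr// ltW.
rewrite mulrC ler_pdivrMr// -mulrA mulrC mulrAC.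
rewrite mulrC; nra.
Qed.

Lemma peak_sum (rho s : R) m : 1 < rho -> 0 < s ->
  (\sum_(m <= k <oo) (if rho ^+ k * s <= 1 then rho ^+ k * s else (rho ^+ k * s)^-1)%:E
    <= (2 * (1 + rho) / (rho - 1))%:E)%E.
Proof.
move=> rho1 s0; have rho0 : 0 < rho by exact: lt_trans rho1.
have t0 k : 0 < rho ^+ k * s by rewrite mulr_gt0 ?exprn_gt0.
have r1 : 0 < rho - 1 by rewrite subr_gt0.
set c := 2 * (1 + rho) / (rho - 1).
have c0 : 0 <= c by rewrite divr_ge0 ?(ltW r1)// mulr_ge0// addr_ge0// ltW.
apply: lime_le.
  apply: is_cvg_nneseries => k _ _; rewrite lee_fin; case: ifP => _; first exact: ltW.
  by rewrite invr_ge0 ltW.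
near=> N; rewrite sumEFin lee_fin.
pose u k := rho ^+ k * s / (1 + rho ^+ k * s).
have u0 k : 0 <= u k by rewrite divr_ge0// ?addr_ge0// ltW.
have u1 k : u k <= 1 by rewrite ler_pdivrMr ?addr_gt0// mul1r lerDr.
apply: (@le_trans _ _ (\sum_(m <= k < N) (c * (u k.+1 - u k)))).
  apply: ler_sum => k _; rewrite (_ : u k.+1 = rho * (rho ^+ k * s) / (1 + rho * (rho ^+ k * s))); last first.
    by rewrite /u exprS mulrA.
  exact: peak_telescope.
rewrite -mulr_sumr; have [mN|Nm] := leqP m N; last first.
  by rewrite big_geq ?mulr0// ltnW.
rewrite telescope_sumr// ler_piMr//.
by have := u0 m; have := u1 N; lra.
Unshelve. all: by end_near.
Qed.

Variables (al de : R) (al0 : 0 < al) (de0 : 0 < de).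
Let th := al / (al + de).

(** The two bounds cross at the value Z = X^(1-th) Y^th. To either side of the
    crossing v k / Z decays geometrically, which peak_sum adds up. *)
Lemma interpolated_tail (q : \bar R) : (0 < q)%E -> exists2 C : R, 0 < C &
  forall (X Y : R) (J : nat) (v : nat -> R), 0 < X -> 0 <= Y -> (forall k, 0 <= v k) ->
  (forall k, (J <= k)%N -> v k <= X * 2 `^ (k%:R * al)) ->
  (forall k, (J <= k)%N -> v k <= Y * 2 `^ (- (k%:R * de))) ->
  (lq_tail q J (fun k => (v k)%:E) <= (C * (X `^ (1 - th) * Y `^ th))%:E)%E.
Proof.
have ad0 : 0 < al + de by rewrite addr_gt0.
have th0 : 0 < th by rewrite divr_gt0.
have th1 : 0 < 1 - th by rewrite subr_gt0 /th ltr_pdivrMr// mul1r ltrDl.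
case: q => [q|_|//]; last first.
  exists 1 => // X Y J v X0 Y0 v0 hX hY; rewrite mul1r.
  apply: ub_ereal_sup => _ [k /= Jk <-]; rewrite lee_fin.
  have -> : v k = v k `^ (1 - th) * v k `^ th.
    rewrite -powRD ?subrK ?powRr1//; last by rewrite oner_eq0.
  have h1 : v k `^ (1 - th) <= (X * 2 `^ (k%:R * al)) `^ (1 - th).
    by rewrite ge0_ler_powR ?nnegrE ?(ltW th1) ?mulr_ge0 ?powR_ge0 ?(ltW X0)// hX.
  have h2 : v k `^ th <= (Y * 2 `^ (- (k%:R * de))) `^ th.
    by rewrite ge0_ler_powR ?nnegrE ?(ltW th0) ?mulr_ge0 ?powR_ge0// hY.
  apply: (le_trans (ler_pM (powR_ge0 _ _) (powR_ge0 _ _) h1 h2)).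
  rewrite !powRM ?powR_ge0 ?(ltW X0)// mulrACA -!powRrM -powRD; last by rewrite pnatr_eq0 implybT.
  rewrite (_ : _ * (1 - th) + _ = 0) ?powRr0 ?mulr1//.
  by rewrite /th; field; rewrite gt_eqF.
rewrite lte_fin => q0.
(* The slower of the two decay rates, in the variable t = X 2 ^ (k (al + de)) / Y that equals 1 at the crossing. *)
pose m := Num.min th (1 - th).
have m0 : 0 < m by rewrite lt_min th0.
pose rho := 2 `^ ((al + de) * (m * q)).
have rho1 : 1 < rho.
  have e0 : 0 < (al + de) * (m * q) by rewrite !mulr_gt0.
  have : 1 `^ ((al + de) * (m * q)) < rho by rewrite /rho gt0_ltr_powR ?nnegrE// ltr1n.
  by rewrite powR1.
pose c := 2 * (1 + rho) / (rho - 1).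
have c0 : 0 < c.
  by rewrite divr_gt0 ?subr_gt0// mulr_gt0// addr_gt0// (lt_trans _ rho1).
exists (c `^ q^-1); first exact: powR_gt0.
move=> X Y J v X0 Y0 v0 hX hY.
have Z0 : 0 <= X `^ (1 - th) * Y `^ th by rewrite mulr_ge0 ?powR_ge0.
rewrite lq_tail_inv_le ?mulr_ge0 ?powR_ge0//.
have [Y00|Yn0] := eqVneq Y 0.
  rewrite eseries_cond eseries0 ?lee_fin ?powR_ge0// => k _ Jk.
  have := hY k Jk; rewrite Y00 mul0r => vk; have -> : v k = 0 by apply/eqP; rewrite eq_le vk v0.
  by rewrite poweR0r// gt_eqF.
have {Yn0}Yp : 0 < Y by rewrite lt_neqAle eq_sym Yn0.
set Z := X `^ (1 - th) * Y `^ th in Z0 *.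
pose s := (X / Y) `^ (m * q).
have s0 : 0 < s by rewrite powR_gt0// divr_gt0.
rewrite powRM ?powR_ge0// -powRrM mulVf ?gt_eqF// powRr1 ?(ltW c0)// mulrC EFinM.
apply: (@le_trans _ _ ((Z `^ q)%:E * \sum_(J <= k <oo) (if rho ^+ k * s <= 1 then rho ^+ k * s else (rho ^+ k * s)^-1)%:E)%E); last first.
  by apply: lee_wpmul2l; [rewrite lee_fin powR_ge0|exact: peak_sum].
have t0 k : 0 < rho ^+ k * s by rewrite mulr_gt0 ?exprn_gt0// (lt_trans _ rho1).
rewrite -nneseriesZl; last first.
  move=> k _; rewrite lee_fin; case: ifP => _; first exact: ltW.
  by rewrite invr_ge0 ltW.
rewrite eseries_cond [leRHS]eseries_cond.
apply: lee_nneseries => [k _ _|k]; first exact: poweR_ge0.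
move=> /andP[_ Jk].
pose t := X / Y * 2 `^ (k%:R * (al + de)).
have tp : 0 < t by rewrite !mulr_gt0 ?invr_gt0 ?powR_gt0.
have -> : rho ^+ k * s = t `^ (m * q).
  rewrite /t powRM ?powR_ge0 ?divr_ge0 ?(ltW X0)// [RHS]mulrC -/s.
  congr (_ * _); rewrite -(powR_mulrn k (powR_ge0 _ _)) -!powRrM.
  by congr (2 `^ _); ring.
have tE e : t `^ e = X `^ e * Y `^ (- e) * 2 `^ (k%:R * (al + de) * e).
  rewrite /t !powRM ?invr_ge0 ?mulr_ge0 ?powR_ge0 ?invr_ge0 ?(ltW X0) ?(ltW Yp)//.
  by rewrite -powR_inv1 ?(ltW Yp)// -!powRrM mulN1r.
have XE : X * 2 `^ (k%:R * al) = Z * t `^ th.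
  rewrite tE /Z (_ : _ * _ * _ = (X `^ (1 - th) * X `^ th) * (Y `^ th * Y `^ (- th)) * 2 `^ (k%:R * (al + de) * th)); last by ring.
  rewrite -!powRD ?(gt_eqF X0) ?(gt_eqF Yp) ?implybT// subrK subrr powRr0 powRr1 ?(ltW X0)// mulr1.
  by congr (_ * 2 `^ _); rewrite /th; field; rewrite gt_eqF.
have YE : Y * 2 `^ (- (k%:R * de)) = Z * t `^ (- (1 - th)).
  rewrite tE /Z (_ : _ * _ * _ = (X `^ (1 - th) * X `^ (- (1 - th))) * (Y `^ th * Y `^ (- - (1 - th))) * 2 `^ (k%:R * (al + de) * - (1 - th))); last by ring.
  rewrite -!powRD ?(gt_eqF X0) ?(gt_eqF Yp) ?implybT// opprK subrr [th + _]addrC subrK powRr0 powRr1 ?(ltW Yp)// mul1r.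
  by congr (_ * 2 `^ _); rewrite /th; field; rewrite gt_eqF.
rewrite poweR_EFin -EFinM lee_fin.
have mq0 : 0 < m * q by rewrite mulr_gt0.
have [t1|t1] := leP t 1.
  have -> : t `^ (m * q) <= 1.
    have : t `^ (m * q) <= 1 `^ (m * q) by rewrite ge0_ler_powR ?nnegrE ?(ltW mq0) ?(ltW tp).
    by rewrite powR1.
  rewrite powRrM -powRM ?powR_ge0// ge0_ler_powR ?nnegrE ?(ltW q0) ?mulr_ge0 ?powR_ge0//.
  apply: (le_trans (hX k Jk)); rewrite XE ler_wpM2l//.
  by rewrite ger_powR ?tp ?t1// ge_min lexx.
have -> : (t `^ (m * q) <= 1) = false.
  have : 1 `^ (m * q) < t `^ (m * q) by rewrite gt0_ltr_powR ?nnegrE// (ltW tp).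
  by rewrite powR1 ltNge => /negbTE.
rewrite -powRN -mulNr powRrM -powRM ?powR_ge0// ge0_ler_powR ?nnegrE ?(ltW q0) ?mulr_ge0 ?powR_ge0//.
apply: (le_trans (hY k Jk)); rewrite YE ler_wpM2l// ler_powR ?(ltW t1)// lerN2.
by rewrite ge_min lexx orbT.
Qed.

End interpolation.

Lemma measurable_lq_tail dT (T : measurableType dT) (R : realType) (q : \bar R) m
    (h : nat -> T -> R) : (0 < q)%E -> (forall k, measurable_fun setT (h k)) ->
  measurable_fun setT (fun x => lq_tail q m (fun k => (h k x)%:E)).
Proof.
move=> q0 mh; case: q q0 => [q|_|//].
  move=> _; apply: (measurableT_comp (measurable_poweR q^-1)).
  under eq_fun do rewrite eseries_cond.
  apply: ge0_emeasurable_sum => [k x _ _|k _]; first exact: poweR_ge0.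
  by apply: (measurableT_comp (measurable_poweR q)); exact/measurable_EFinP.
by apply: (measurable_fun_esups (f := fun k x => (h k x)%:E)) => k; exact/measurable_EFinP.
Qed.

(** * The F spaces *)

Section lizorkin.
Context {R : realType} {d : nat}.
Local Notation V := 'rV[R]_d.
Local Notation Z := 'rV[int]_d.
Local Notation mu := (@lebesgue_rV R d).
Variables (theta0 : V -> R[i]).
Hypotheses (hd : (0 < d)%N) (hth : resolution_generator theta0).
Variables (s1 s2 p1 p2 : R).
Hypotheses (p10 : 0 < p1) (p12 : p1 < p2) (hs : s1 - d%:R / p1 = s2 - d%:R / p2).

Let al := d%:R / p2.
Let de := d%:R / p1 - d%:R / p2.

Let p20 : 0 < p2. Proof. exact: lt_trans p12. Qed.

Let al0 : 0 < al. Proof. by rewrite divr_gt0 ?ltr0n. Qed.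

Let de0 : 0 < de.
Proof. by rewrite subr_gt0 ltr_pM2l ?ltr0n// ltf_pV2. Qed.

Let thE : al / (al + de) = p1 / p2.
Proof.
rewrite /al /de addrC subrK; field.
by rewrite !gt_eqF ?ltr0n.
Qed.

Local Notation tail s q m f x := (lq_tail q m (fun k => (weighted_lp theta0 s f k x)%:E)).

Let w_ge0 s f x k : (0 <= (weighted_lp theta0 s f k x)%:E)%E.
Proof. by rewrite lee_fin weighted_lp_ge0. Qed.

(** Each term is bounded by the whole tail for (s1, r), which gives the decreasing
    bound with exponent s1 - s2; the hypothesis on X gives the increasing one with
    exponent d / p2. The crossing parameter is p1 / p2. *)
Lemma lizorkin_pointwise (q r : \bar R) : (0 < q)%E -> (0 < r)%E -> exists2 c : R, 0 < c &
  forall f (X : R) J (x : V), 0 < X ->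
  (forall k, (J <= k)%N -> weighted_lp theta0 s1 f k x <= X * 2 `^ (k%:R * (d%:R / p1))) ->
  (tail s2 q J f x `^ p2 <= (c * X `^ (p2 - p1))%:E * tail s1 r J f x `^ p1)%E.
Proof.
move=> q0 r0; have [C C0 hC] := interpolated_tail al0 de0 q0.
exists (C `^ p2); first by rewrite powR_gt0.
move=> f X J x X0 hX.
have c0 : 0 < C `^ p2 * X `^ (p2 - p1) by rewrite mulr_gt0 ?powR_gt0.
have G0 : (0 <= tail s1 r J f x)%E.
  by apply: (le_trans (w_ge0 s1 f x J)); exact: (lq_tail_ge r0 (w_ge0 s1 f x)).
have tk k : (J <= k)%N -> ((weighted_lp theta0 s1 f k x)%:E <= tail s1 r J f x)%E.
  exact: (lq_tail_ge r0 (w_ge0 s1 f x)).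
have T0 : (0 <= tail s2 q J f x)%E.
  by apply: (le_trans (w_ge0 s2 f x J)); exact: (lq_tail_ge q0 (w_ge0 s2 f x)).
case GE : (lq_tail r J _) G0 tk => [G| |//] G0 tk; last first.
  by rewrite poweRyr ?gt_eqF// gt0_muley ?lte_fin// leey.
rewrite lee_fin in G0.
have shift k : weighted_lp theta0 s2 f k x = 2 `^ (- (k%:R * de)) * weighted_lp theta0 s1 f k x.
  rewrite (weighted_lp_shift theta0 s1) (_ : s2 - s1 = - de) ?mulrN//.
  by rewrite /de; move: hs; set a := _ / p1; set b := _ / p2; lra.
have h1 k : (J <= k)%N -> weighted_lp theta0 s2 f k x <= X * 2 `^ (k%:R * al).
  move=> Jk; rewrite shift; apply: (le_trans (ler_wpM2l (powR_ge0 _ _) (hX k Jk))).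
  rewrite mulrCA -powRD; last by rewrite pnatr_eq0 implybT.
  by rewrite (_ : _ + _ = k%:R * al)// /de /al; ring.
have h2 k : (J <= k)%N -> weighted_lp theta0 s2 f k x <= G * 2 `^ (- (k%:R * de)).
  move=> Jk; rewrite shift mulrC ler_wpM2r ?powR_ge0// -lee_fin; exact: tk.
have := hC X G J (fun k => weighted_lp theta0 s2 f k x) X0 G0 (fun k => weighted_lp_ge0 _ _ _ _ _) h1 h2.
move=> /(le_poweR (ltW p20) T0)/le_trans; apply.
rewrite poweR_EFin poweR_EFin -EFinM lee_fin thE !powRM ?mulr_ge0 ?powR_ge0 ?(ltW C0)//.
rewrite -!powRrM divfK ?gt_eqF// mulrA (_ : (1 - p1 / p2) * p2 = p2 - p1)//.
by field; rewrite gt_eqF.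
Qed.

(** A point x lies in a dyadic cube of side 2 ^- k. For k >= j, phi at that side is
    at most phi at the side of P, so the norm controls the masses of the k-th piece
    around x with the factor that belongs to P, and sup_on_cube turns this into the
    pointwise bound required by lizorkin_pointwise. *)
Lemma lizorkin_bound (q r : \bar R) (phi : R -> R) : (0 < q)%E -> (0 < r)%E ->
  (forall t, 0 < t -> 0 < phi t) -> (forall t s, 0 < t -> t <= s -> phi t <= phi s) ->
  exists2 K : R, 0 < K & forall f (A : R), 0 < A ->
  (F_norm theta0 s1 p1 r phi f <= A%:E)%E -> (F_norm theta0 s2 p2 q phi f <= (K * A)%:E)%E.
Proof.
move=> q0 r0 phi0 phi_mono.
have [K1 K10 hK1] := sup_on_cube hd hth p10 (lexx 0).
have [c c0 hc] := lizorkin_pointwise q0 r0.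
exists ((c * (K1 `^ p1^-1) `^ (p2 - p1)) `^ p2^-1); first by rewrite powR_gt0// mulr_gt0 ?powR_gt0.
move=> f A A0 hA.
have mt s p (t : \bar R) m : (0 < t)%E -> measurable_fun setT (fun x => tail s t m f x `^ p)%E.
  move=> t0; apply: (measurableT_comp (measurable_poweR p)).
  by apply: measurable_lq_tail => // k; exact: measurable_weighted_lp.
have cube j (n : Z) : (\int[mu]_(x in dyadic_cube j n) (tail s1 r `|Num.max j 0|%N f x `^ p1)
    <= ((phi (dyadic_side j) * A) `^ p1)%:E)%E.
  have ph0 := phi0 _ (@dyadic_side_gt0 R j).
  rewrite -poweR_inv_le ?(mulr_ge0 (ltW ph0) (ltW A0))//; last first.
    by apply: integral_ge0 => x _; exact: poweR_ge0.
  rewrite EFinM -lee_pdivrMl//; apply: (le_trans _ hA).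
  by apply: ereal_sup_ubound; exists (j, n).
apply: ub_ereal_sup => _ [[j n] _ <-] /=.
set J := `|Num.max j 0|%N.
have jJ : (j <= J%:Z)%R by rewrite gez0_abs le_max lexx ?orbT.
have s0 := @dyadic_side_gt0 R j; have ph0 := phi0 _ s0.
set B := phi (dyadic_side j) * A.
have B0 : 0 < B by rewrite mulr_gt0.
pose X := K1 `^ p1^-1 * B.
have X0 : 0 < X by rewrite mulr_gt0 ?powR_gt0.
have hX k x : (J <= k)%N -> weighted_lp theta0 s1 f k x <= X * 2 `^ (k%:R * (d%:R / p1)).
  move=> Jk; have [n' hn'] := dyadic_cube_cover k%:Z x.
  have step m : (\int[mu]_(z in dyadic_cube k%:Z (n' + m)) (weighted_lp theta0 s1 f k z `^ p1)%:E
      <= (B `^ p1 * shift_weight m `^ 0)%:E)%E.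
    rewrite powRr0 mulr1.
    apply: (@le_trans _ _ ((phi (dyadic_side k%:Z) * A) `^ p1)%:E); last first.
      have sk0 := @dyadic_side_gt0 R k%:Z.
      have sk : dyadic_side k%:Z <= dyadic_side j :> R.
        rewrite /dyadic_side ler_eXz2l ?ltr1n// lerN2 (le_trans jJ)// lez_nat.
      rewrite lee_fin ge0_ler_powR ?nnegrE ?(ltW p10) ?(ltW B0) ?mulr_ge0 ?(ltW A0) ?(ltW (phi0 _ sk0))//.
      by rewrite ler_wpM2r ?(ltW A0)// phi_mono.
    apply: (le_trans _ (cube k%:Z (n' + m))); apply: ge0_le_integral.
    - exact: measurable_dyadic_cube.
    - by move=> z _; rewrite lee_fin powR_ge0.
    - by apply: measurable_funTS; apply/measurable_EFinP; exact: measurable_weighted_lp_powR.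
    - by apply: measurable_funTS; exact: mt.
    - move=> z _; rewrite -poweR_EFin; apply: (le_poweR (ltW p10) (w_ge0 _ _ _ _)).
      by apply: (lq_tail_ge r0 (w_ge0 s1 f z)); rewrite max_l.
  have := hK1 f s1 k k%:Z n' (B `^ p1) x (lexx _) (powR_ge0 _ _) step hn'.
  rewrite -lee_fin -poweR_EFin => /(poweR_le_inv p10 (w_ge0 _ _ _ _)); rewrite lee_fin => /le_trans; apply.
  have E b : 0 < b -> (K1 * (2 ^+ k) ^+ d * b `^ p1) `^ p1^-1 = K1 `^ p1^-1 * b * 2 `^ (k%:R * (d%:R / p1)).
    move=> b0; rewrite !powRM ?mulr_ge0 ?exprn_ge0 ?powR_ge0 ?(ltW K10)//.
    rewrite -(powR_mulrn d) ?exprn_ge0// -(powR_mulrn k) ?ler0n// -!powRrM.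
    by rewrite mulfV ?gt_eqF// powRr1 ?(ltW b0)// mulrAC mulrA.
  by rewrite E.
rewrite lee_pdivrMl// -EFinM mulrCA -/B.
set K := _ `^ p2^-1.
have K0 : 0 <= K by exact: powR_ge0.
rewrite poweR_inv_le ?(mulr_ge0 K0 (ltW B0))//; last first.
  by apply: integral_ge0 => x _; exact: poweR_ge0.
have cX : (0 <= (c * X `^ (p2 - p1))%:E)%E by rewrite lee_fin mulr_ge0 ?powR_ge0 ?(ltW c0).
apply: (@le_trans _ _ (\int[mu]_(x in dyadic_cube j n) ((c * X `^ (p2 - p1))%:E * tail s1 r J f x `^ p1))%E).
  apply: ge0_le_integral.
  - exact: measurable_dyadic_cube.
  - by move=> z _; exact: poweR_ge0.
  - by apply: measurable_funTS; exact: mt.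
  - by apply: measurable_funTS; apply: measurable_funeM; exact: mt.
  - by move=> x _; apply: hc => // k; exact: hX.
have -> : (\int[mu]_(x in dyadic_cube j n) ((c * X `^ (p2 - p1))%:E * tail s1 r J f x `^ p1) =
    (c * X `^ (p2 - p1))%:E * \int[mu]_(x in dyadic_cube j n) (tail s1 r J f x `^ p1))%E.
  apply: ge0_integralZl => //.
  - exact: measurable_dyadic_cube.
  - by apply: measurable_funTS; exact: mt.
  - by move=> z _; exact: poweR_ge0.
apply: (le_trans (lee_wpmul2l cX (cube j n))).
rewrite -EFinM lee_fin -/B le_eqVlt; apply/orP; left; apply/eqP.
have E b : 0 < b -> c * (K1 `^ p1^-1 * b) `^ (p2 - p1) * b `^ p1 = (K * b) `^ p2.
  move=> b0; rewrite [RHS]powRM ?(ltW b0)// /K -[X in _ = X * _]powRrM mulVf ?gt_eqF// powRr1; last first.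
    by rewrite mulr_ge0 ?powR_ge0 ?(ltW c0).
  rewrite powRM ?powR_ge0 ?(ltW b0)// -!mulrA; congr (_ * (_ * _)).
  by rewrite -powRD ?subrK// (gt_eqF b0) implybT.
exact: E.
Qed.

End lizorkin.

(** * The embeddings *)

Lemma continuously_embedded_bound (R : realType) (E : zmodType) (S : set E)
    (nX nY : E -> \bar R) (K : R) : 0 < K ->
  (forall f A, 0 < A -> (nX f <= A%:E)%E -> (nY f <= (K * A)%:E)%E) ->
  continuously_embedded [set f | S f /\ (nX f < +oo)%E] nX [set f | S f /\ (nY f < +oo)%E] nY.
Proof.
move=> K0 hK; split=> [f [Sf hf]|f _ e e0].
  split=> //.
  have [A A0 hA] : exists2 A : R, 0 < A & (nX f <= A%:E)%E.
    case E1 : (nX f) hf => [a| |] // _; last by exists 1 => //; rewrite leNye.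
    by exists (`|a| + 1); rewrite ?ltr_wpDl// lee_fin (le_trans (ler_norm _))// lerDl.
  by apply: (le_lt_trans (hK f A A0 hA)); rewrite ltry.
exists (e / (2 * K)) => [|g _ hg]; first by rewrite divr_gt0// mulr_gt0.
have a0 : 0 < e / (2 * K) by rewrite divr_gt0// mulr_gt0.
apply: (le_lt_trans (hK _ _ a0 (ltW hg))); rewrite lte_fin.
have -> : K * (e / (2 * K)) = e / 2 by field; rewrite gt_eqF.
by lra.
Qed.
Theorem theorem4p14 (R : realType) (d : nat) (hd : (0 < d)%N)
    (theta0 : 'rV[R]_d -> R[i]) (htheta : resolution_generator theta0)
    (r q : \bar R) (hr : (0 < r)%E) (hq : (0 < q)%E)
    (s1 s2 p1 p2 : R) (hs : s2 < s1) (hp1 : 0 < p1) (hp : p1 < p2)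
    (hsp : s1 - d%:R / p1 = s2 - d%:R / p2)
    (phi : R -> R) (hphi1 : class_G d p1 phi) (hphi2 : class_G d p2 phi) :
  continuously_embedded
    (B_space theta0 s1 p1 q phi) (B_norm theta0 s1 p1 q phi)
    (B_space theta0 s2 p2 q phi) (B_norm theta0 s2 p2 q phi)
  /\
  (((r < +oo)%E -> eps_condition d p1 phi) ->
   ((q < +oo)%E -> eps_condition d p2 phi) ->
   continuously_embedded
     (F_space theta0 s1 p1 r phi) (F_norm theta0 s1 p1 r phi)
     (F_space theta0 s2 p2 q phi) (F_norm theta0 s2 p2 q phi)).
Proof.
have [phi0 phi_mono _] := hphi1.
split=> [|_ _].
  have [K K0 hK] := besov_bound hd htheta hp1 hp hsp hq phi0.
  exact: continuously_embedded_bound K0 hK.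
have [K K0 hK] := lizorkin_bound hd htheta hp1 hp hsp hq hr phi0 phi_mono.
exact: continuously_embedded_bound K0 hK.
Qed.
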